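(* Let $f$ be a germ at the origin $O$ of a holomorphic self-map of $\mathbb{C}^2$ with $f(O)=O$, $f\neq\mathrm{id}_{\mathbb{C}^2}$, tangent to the identity ($df_O=\mathrm{id}$), and fixing pointwise the line $S=\{z_1=0\}$. Let $\nu\ge 1$ be the order of contact of $f$ with $S$, so that $f(z)=z+z_1^\nu f^o(z)$ with $f^o$ not divisible by $z_1$. Assume that the origin is a singular point for $f$ on $S$ (that is, $f^o(O)=O$), that $f$ has pure order $1$ at the origin (that is, the linear part $P^1$ of $f^o$ at $O$ is not identically zero), and that $P^1$ sends the line $\{z_1=0\}$ into itself. Let $$E=\bigcup_{q=1}^{\nu}\frac1q\mathbb{N}\ \cup\ \Bigl\{\frac1d : d\in\mathbb{N},\ d\ge 2\Bigr\}\cup\{0\}\cup\mathbb{Q}^-\subset\mathbb{C}.$$ Then $f$ is formally conjugated (by a formal change of coordinates preserving $\{z_1=0\}$) to a map $\hat f$ of one (and only one) of the following normal forms: $(\star_1^\lambda)$ with $\lambda\in\mathbb{C}\setminus E$: $$\hat f(z)=\bigl(z_1+z_1^\nu[\lambda z_1+a z_1^{\nu+1}+z_2^2t(z_2)],\ z_2+z_1^\nu z_2\bigr),$$ where $a\in\mathbb{C}$ and $t\in\mathbb{C}[[\zeta]]$; $(\star_1^\lambda)$ with $\lambda=0$: $$\hat f(z)=\bigl(z_1+z_1^\nu[z_1^2g(z_1)+z_2^2t(z_2)],\ z_2+z_1^\nu z_2\bigr),$$ where $g,t\in\mathbb{C}[[\zeta]]$; $(\star_1^\lambda)$ with $\lambda=-p/q\in\mathbb{Q}^-$,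 $p,q$ relatively prime positive integers: $$\hat f(z)=\bigl(z_1+z_1^\nu[z_1g_1(z_1^qz_2^p)+z_1^{\nu+1}g_2(z_1^qz_2^p)+z_2^2t(z_2)],\ z_2+z_1^\nu z_2\bigr),$$ where $g_1,g_2,t\in\mathbb{C}[[\zeta]]$ with $g_1(0)=\lambda$; $(\star_1^\lambda)$ with $\lambda=1/q$, $q\in\mathbb{N}$, $q\ge 2$: $$\hat f(z)=\bigl(z_1+z_1^\nu[\lambda z_1+z_1^{\nu+1}p_o(z_1^{-q}z_2)+z_2^2t(z_2)],\ z_2+z_1^\nu(z_2+az_1^q)\bigr),$$ where $a\in\mathbb{C}$, $p_o\in\mathbb{C}[\zeta]$ is a polynomial of degree at most $\nu/q$, and $t\in\mathbb{C}[[\zeta]]$; $(\star_1^\lambda)$ with $\lambda=p/q\in\mathbb{Q}$, $1\le q\le\nu$, $p\ge 2$, $p,q$ relatively prime integers: $$\hat f(z)=\bigl(z_1+z_1^\nu[\lambda z_1+z_1^{\nu+1}p_o(z_1^{-q}z_2^p)+z_2^2t(z_2)],\ z_2+z_1^\nu z_2\bigr),$$ where $p_o\in\mathbb{C}[\zeta]$ is a polynomial of degree at most $\nu/q$, and $t\in\mathbb{C}[[\zeta]]$; $(\star_1^\lambda)$ with $\lambda=1$: $$\hat f(z)=\bigl(z_1+z_1^\nu[z_1+z_1p_\nu(z_1,z_2)+z_2^2t(z_2)],\ z_2+z_1^\nu z_2\bigr),$$ where $p_\nu\in\mathbb{C}[z_1,z_2]$ is a homogeneous polynomial of degree $\nu$,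 and $t\in\mathbb{C}[[\zeta]]$; $(J_1)$: $$\hat f(z)=\bigl(z_1+z_1^\nu[z_1+az_1z_2^\nu+z_2^2t(z_2)],\ z_2+z_1^\nu(z_1+z_2)\bigr),$$ where $a\in\mathbb{C}$ and $t\in\mathbb{C}[[\zeta]]$; $(\star_2)$: $$\hat f(z)=\bigl(z_1+z_1^\nu[z_1+z_1^{\nu+1}g_1(z_2)+z_2^2t(z_2)],\ z_2+z_1^\nu z_2^2g_2(z_2)\bigr),$$ where $g_1,g_2,t\in\mathbb{C}[[\zeta]]$; $(J_0)$: $$\hat f(z)=\bigl(z_1+z_1^\nu[z_1z_2g_1(z_2)+z_2^2t(z_2)],\ z_2+z_1^\nu[z_1+z_2^2g_2(z_2)]\bigr),$$ where $g_1,g_2,t\in\mathbb{C}[[\zeta]]$. In all these cases, $t\equiv 0$ if and only if $f$ is tangential to $S$.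
   Context: Coordinates on $\mathbb{C}^2$ are $z=(z_1,z_2)$. Order of contact: for $f\ne\mathrm{id}$ fixing $\{z_1=0\}$ pointwise, the order of contact $\nu\ge1$ of $f$ with $S=\{z_1=0\}$ is the maximal integer such that $f(z)=z+z_1^\nu f^o(z)$ for a holomorphic germ $f^o=(f^o_1,f^o_2)$; thus $f^o$ is not divisible by $z_1$ (its two components are not both divisible by $z_1$). Expand $f^o(z)=P^1(z)+P^2(z)+\cdots$ (when $f^o(O)=O$), where $P^j=(P^j_1,P^j_2)$ is a pair of homogeneous polynomials of degree $j$ in $z_1,z_2$. The pure order of $f$ at the origin is the least $j\ge1$ with $P^j\not\equiv O$. The condition that $P^1$ sends $\{z_1=0\}$ into itself means that $P^1_1$ has no $z_2$-term, i.e. $P^1_1(0,z_2)\equiv0$. $f$ is tangential to $S$ if $f^o$ sends $S$ into itself, i.e. if $z_1$ divides $f^o_1$. A formal change of coordinates is a pair $\chi$ of formal power series in $z_1,z_2$ without constant term and with invertible linear part; all changes of coordinates considered preserve the line $\{z_1=0\}$, i.e. the first component of $\chi$ is divisible by $z_1$. $f$ is formally conjugated to $\hat f$ if $\chi^{-1}\circ f\circ\chi=\hat f$ as formal power series for such a $\chi$. $\mathbb{C}[[\zeta]]$ is the ring of formal power series in one variable, $\mathbb{Q}^-$ is the set of negative rational numbers. The parameters $a$, $g$, $g_1$, $g_2$, $t$, $p_o$, $p_\nu$ are arbitrary (''generic'' in the sense of unrestricted) within the indicated classes. ''One and only one of the normal forms'' refers to the listed families (with the value of $\lambda$ for the families $(\star_1^\lambda)$),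 not to the parameters within a family. *)

(* Defs.v *)
From HB Require Import structures.
From mathcomp Require Import all_boot all_order all_algebra.
From mathcomp Require Import complex.
From mathcomp Require Import boolp classical_sets reals.

Set Implicit Arguments.
Unset Strict Implicit.
Unset Printing Implicit Defensive.

Import Order.TTheory GRing.Theory Num.Theory.
Local Open Scope ring_scope.


(* [coef F i j] is the coefficient of z_1^i z_2^j. *)
Record fps2 (K : Type) := FPS2 { coef : nat -> nat -> K }.

HB.instance Definition _ (K : Type) := gen_eqMixin (fps2 K).
HB.instance Definition _ (K : Type) := gen_choiceMixin (fps2 K).

Lemma fps2P (K : Type) (F G : fps2 K) :
  (forall i j, coef F i j = coef G i j) -> F = G.
Proof.
case: F G => [F] [G] /= h; congr FPS2.
by apply/funext => i; apply/funext => j.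
Qed.

Section Fps2Ring.
Variable K : comNzRingType.
Implicit Types F G H : fps2 K.

Definition fps2_zero : fps2 K := FPS2 (fun _ _ => 0).
Definition fps2_opp F := FPS2 (fun i j => - coef F i j).
Definition fps2_add F G := FPS2 (fun i j => coef F i j + coef G i j).
Definition fps2_one : fps2 K :=
  FPS2 (fun i j => ((i == 0%N) && (j == 0%N))%:R).
Definition fps2_mul F G :=
  FPS2 (fun i j => \sum_(a < i.+1) \sum_(b < j.+1)
    coef F a b * coef G (i - a)%N (j - b)%N).
Definition fps2_scale (c : K) F := FPS2 (fun i j => c * coef F i j).

Fact fps2_addA : associative fps2_add.
Proof. by move=> F G H; apply: fps2P => i j /=; rewrite addrA. Qed.
Fact fps2_addC : commutative fps2_add.
Proof. by move=> F G; apply: fps2P => i j /=; rewrite addrC. Qed.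
Fact fps2_add0 : left_id fps2_zero fps2_add.
Proof. by move=> F; apply: fps2P => i j /=; rewrite add0r. Qed.
Fact fps2_addN : left_inverse fps2_zero fps2_opp fps2_add.
Proof. by move=> F; apply: fps2P => i j /=; rewrite addNr. Qed.

HB.instance Definition _ := GRing.isZmodule.Build (fps2 K)
  fps2_addA fps2_addC fps2_add0 fps2_addN.

(* Truncation to a polynomial, to inherit the ring laws of {poly {poly K}}. *)
Let tr n F : {poly {poly K}} := \poly_(i < n) \poly_(j < n) coef F i j.

Let coef_tr n F i j : (i < n)%N -> (j < n)%N -> (tr n F)`_i`_j = coef F i j.
Proof. by move=> hi hj; rewrite coef_poly hi coef_poly hj. Qed.

Let coef2M (p q : {poly {poly K}}) i j :
  (p * q)`_i`_j =
  \sum_(a < i.+1) \sum_(b < j.+1) p`_a`_b * q`_(i - a)`_(j - b).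
Proof. by rewrite coefM coef_sum; apply: eq_bigr => a _; rewrite coefM. Qed.

Let coef_mul_tr n F G i j : (i < n)%N -> (j < n)%N ->
  coef (fps2_mul F G) i j = (tr n F * tr n G)`_i`_j.
Proof.
move=> hi hj; rewrite coef2M /=; apply: eq_bigr => a _; apply: eq_bigr => b _.
have ha : (a < n)%N by apply: leq_ltn_trans hi; rewrite -ltnS.
have hb : (b < n)%N by apply: leq_ltn_trans hj; rewrite -ltnS.
by rewrite !coef_tr // (leq_ltn_trans (leq_subr _ _)).
Qed.

Fact fps2_mulC : commutative fps2_mul.
Proof.
move=> F G; apply: fps2P => i j; pose n := (i + j).+1.
have hi : (i < n)%N by rewrite ltnS leq_addr.
have hj : (j < n)%N by rewrite ltnS leq_addl.
by rewrite !(@coef_mul_tr n) // mulrC.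
Qed.

Fact fps2_mulA : associative fps2_mul.
Proof.
move=> F G H; apply: fps2P => i j; pose n := (i + j).+1.
have hi : (i < n)%N by rewrite ltnS leq_addr.
have hj : (j < n)%N by rewrite ltnS leq_addl.
rewrite !(@coef_mul_tr n) // !coef2M.
transitivity ((tr n F * (tr n G * tr n H))`_i`_j); last rewrite mulrA;
  rewrite coef2M; apply: eq_bigr => a _; apply: eq_bigr => b _;
  have ha : (a < n)%N by [apply: leq_ltn_trans hi; rewrite -ltnS];
  have hb : (b < n)%N by [apply: leq_ltn_trans hj; rewrite -ltnS].
- by rewrite (@coef_tr _ (fps2_mul G H)) ?(@coef_mul_tr n) //;
    rewrite (leq_ltn_trans (leq_subr _ _)).
- by rewrite (@coef_tr _ (fps2_mul F G)) ?(@coef_mul_tr n).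
Qed.

Fact fps2_mul1 : left_id fps2_one fps2_mul.
Proof.
move=> F; apply: fps2P => i j /=.
rewrite big_ord_recl big_ord_recl /= mul1r !subn0.
rewrite big1 ?addr0 => [|b _]; last by rewrite mul0r.
by rewrite big1 ?addr0 // => a _; rewrite big1 // => b _; rewrite mul0r.
Qed.

Fact fps2_mulDl : left_distributive fps2_mul fps2_add.
Proof.
move=> F G H; apply: fps2P => i j /=; rewrite -big_split; apply: eq_bigr => a _.
by rewrite -big_split; apply: eq_bigr => b _; rewrite mulrDl.
Qed.

Fact fps2_one_neq0 : fps2_one != 0.
Proof.
apply/eqP => /(congr1 (fun F => coef F 0%N 0%N)) /= /eqP.
by rewrite oner_eq0.
Qed.

HB.instance Definition _ := GRing.Zmodule_isComNzRing.Build (fps2 K)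
  fps2_mulA fps2_mulC fps2_mul1 fps2_mulDl fps2_one_neq0.

Fact fps2_scaleA a b F : fps2_scale a (fps2_scale b F) = fps2_scale (a * b) F.
Proof. by apply: fps2P => i j /=; rewrite mulrA. Qed.
Fact fps2_scale1 : left_id 1 fps2_scale.
Proof. by move=> F; apply: fps2P => i j /=; rewrite mul1r. Qed.
Fact fps2_scaleDr : right_distributive fps2_scale +%R.
Proof. by move=> a F G; apply: fps2P => i j /=; rewrite mulrDr. Qed.
Fact fps2_scaleDl F : {morph fps2_scale^~ F : a b / a + b}.
Proof. by move=> a b; apply: fps2P => i j /=; rewrite mulrDl. Qed.

HB.instance Definition _ := GRing.Zmodule_isLmodule.Build K (fps2 K)
  fps2_scaleA fps2_scale1 fps2_scaleDr fps2_scaleDl.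

Fact fps2_scaleAl (a : K) F G : a *: (F * G) = a *: F * G.
Proof.
apply: fps2P => i j /=; rewrite mulr_sumr; apply: eq_bigr => k _.
by rewrite mulr_sumr; apply: eq_bigr => l _; rewrite mulrA.
Qed.

HB.instance Definition _ := GRing.Lmodule_isLalgebra.Build K (fps2 K)
  fps2_scaleAl.
HB.instance Definition _ := GRing.Lalgebra_isComAlgebra.Build K (fps2 K).

End Fps2Ring.

Definition z1 {K : comNzRingType} : fps2 K :=
  FPS2 (fun i j => ((i == 1%N) && (j == 0%N))%:R).
Definition z2 {K : comNzRingType} : fps2 K :=
  FPS2 (fun i j => ((i == 0%N) && (j == 1%N))%:R).

(* A one-variable power series is given by its sequence of coefficients. *)
Definition fps1 (K : Type) := nat -> K.

Section Substitution.
Variable K : comNzRingType.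

(* The substitutions below are meant for arguments without constant term: then
   G_1^a G_2^b has no monomial of degree < a + b, so that the coefficient of
   z_1^i z_2^j in the infinite sum only involves exponents at most i + j. *)
Definition subst1 (t : fps1 K) (G : fps2 K) : fps2 K :=
  FPS2 (fun i j => \sum_(k < (i + j).+1) t k * coef (G ^+ k) i j).

Definition subst2 (F : fps2 K) (G : fps2 K * fps2 K) : fps2 K :=
  FPS2 (fun i j => \sum_(a < (i + j).+1) \sum_(b < (i + j).+1)
    coef F a b * coef (G.1 ^+ a * G.2 ^+ b) i j).

Definition comp (F G : fps2 K * fps2 K) : fps2 K * fps2 K :=
  (subst2 F.1 G, subst2 F.2 G).

Definition idmap2 : fps2 K * fps2 K := (z1, z2).

Definition no_const (F : fps2 K * fps2 K) : Prop :=
  coef F.1 0 0 = 0 /\ coef F.2 0 0 = 0.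

(* Entry (i, j) is the coefficient of z_j in the i-th component. *)
Definition linear_part (F : fps2 K * fps2 K) : 'M[K]_2 :=
  \matrix_(i < 2, j < 2)
    coef (if i == 0 then F.1 else F.2) (j == 0 : nat) (j != 0 : nat).

Definition hom_comp (d : nat) (F : fps2 K) : fps2 K :=
  FPS2 (fun i j => if (i + j)%N == d then coef F i j else 0).

Definition hom_part (d : nat) (F : fps2 K * fps2 K) : fps2 K * fps2 K :=
  (hom_comp d F.1, hom_comp d F.2).

Definition homogeneous (d : nat) (p : fps2 K) : Prop := hom_comp d p = p.

Definition has_pure_order (F : fps2 K * fps2 K) (k : nat) : Prop :=
  [/\ (1 <= k)%N, hom_part k F <> (0, 0)
    & forall j, (1 <= j < k)%N -> hom_part j F = (0, 0)].

End Substitution.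

Arguments idmap2 {K}.

Section FormalConjugacy.
Variable K : comUnitRingType.
Implicit Types F G chi psi : fps2 K * fps2 K.

Definition z1_divides (F : fps2 K) : Prop := exists H : fps2 K, F = z1 * H.

Definition coord_change chi : Prop :=
  [/\ no_const chi, linear_part chi \in unitmx & z1_divides chi.1].

Definition formal_inverse chi psi : Prop :=
  [/\ no_const psi, comp chi psi = idmap2 & comp psi chi = idmap2].

Definition formally_conjugated F G : Prop :=
  exists chi psi, [/\ coord_change chi, formal_inverse chi psi
    & comp psi (comp F chi) = G].

End FormalConjugacy.


(* A germ is handled through a globally defined representative, of which only
   the restrictions to neighbourhoods of the origin are used.  Radii are
   complex numbers, and [0 < r] forces r to be real. *)
Section Germs.
Variable R : realType.
Local Notation C := R[i].

Definition near_O (P : C * C -> Prop) : Prop :=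
  exists2 r : C, 0 < r & forall z : C * C, `|z.1| < r -> `|z.2| < r -> P z.

Definition sums_to (u : nat -> nat -> C) (l : C) : Prop :=
  forall e : C, 0 < e -> exists N : nat, forall m n, (N <= m)%N -> (N <= n)%N ->
    `|\sum_(i < m) \sum_(j < n) u i j - l| < e.

(* F is the Taylor expansion at O of the holomorphic germ phi. The bound on the
   coefficients makes the convergence absolute on the open polydisc. *)
Definition taylor_fun (phi : C * C -> C) (F : fps2 C) : Prop :=
  exists r M : C, [/\ 0 < r,
    (forall i j, `|coef F i j| * r ^+ (i + j) <= M)
    & forall z : C * C, `|z.1| < r -> `|z.2| < r ->
        sums_to (fun i j => coef F i j * (z.1 ^+ i * z.2 ^+ j)) (phi z)].

Definition taylor (f : C * C -> C * C) (F : fps2 C * fps2 C) : Prop :=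
  taylor_fun (fun z : C * C => (f z).1) F.1 /\
  taylor_fun (fun z : C * C => (f z).2) F.2.

Definition holomorphic_at_O (f : C * C -> C * C) : Prop :=
  exists F, taylor f F.

Definition fixes_line_pointwise (f : C * C -> C * C) : Prop :=
  near_O (fun z : C * C => z.1 = 0 -> f z = z).

Definition contact_decomp (f : C * C -> C * C) (nu : nat)
    (fo : C * C -> C * C) : Prop :=
  holomorphic_at_O fo /\
  near_O (fun z : C * C =>
    f z = (z.1 + z.1 ^+ nu * (fo z).1, z.2 + z.1 ^+ nu * (fo z).2)).

Definition order_of_contact (f : C * C -> C * C) (nu : nat) : Prop :=
  (exists fo, contact_decomp f nu fo) /\
  (forall mu, (exists fo, contact_decomp f mu fo) -> (mu <= nu)%N).

Definition maps_line_into_itself (h : C * C -> C * C) : Prop :=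
  near_O (fun z : C * C => z.1 = 0 -> (h z).1 = 0).

Definition tangential (f : C * C -> C * C) (nu : nat) : Prop :=
  exists2 fo, contact_decomp f nu fo & maps_line_into_itself fo.

End Germs.


Section NormalForms.
Variable R : realType.
Local Notation C := R[i].
Local Open Scope classical_set_scope.

Definition exceptional (nu : nat) : set C :=
  (\bigcup_(q in [set q : nat | (1 <= q <= nu)%N])
      [set n%:R / q%:R | n in [set: nat]])
  `|` [set (d%:R)^-1 | d in [set d : nat | (2 <= d)%N]]
  `|` [set 0]
  `|` [set ratr x | x in [set x : rat | x < 0]].

Local Close Scope classical_set_scope.

Inductive form_name := Star1 of C | J1 | Star2 | J0.

(* z_1^(nu+1) po(z_1^(-q) z_2^p); the exponents of z_1 are nonnegative as soon
   as po has degree at most nu / q. *)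
Definition twisted_poly (nu p q : nat) (po : {poly C}) : fps2 C :=
  \sum_(k < size po) po`_k *: (z1 ^+ (nu.+1 - q * k) * z2 ^+ (p * k)).

(* [normal_form nu k t fhat]: fhat is a normal form in the family k, with t
   being the series so denoted in every family. *)
Inductive normal_form (nu : nat) :
    form_name -> fps1 C -> fps2 C * fps2 C -> Prop :=
| NFgeneric (lam a : C) (t : fps1 C) of ~ exceptional nu lam :
    normal_form nu (Star1 lam) t
      (z1 + z1 ^+ nu * (lam *: z1 + a *: z1 ^+ nu.+1 + z2 ^+ 2 * subst1 t z2),
       z2 + z1 ^+ nu * z2)
| NFzero (g t : fps1 C) :
    normal_form nu (Star1 0) t
      (z1 + z1 ^+ nu * (z1 ^+ 2 * subst1 g z1 + z2 ^+ 2 * subst1 t z2),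
       z2 + z1 ^+ nu * z2)
| NFnegative (p q : nat) (g1 g2 t : fps1 C)
    of (0 < p)%N & (0 < q)%N & coprime p q & g1 0%N = - (p%:R / q%:R) :
    normal_form nu (Star1 (- (p%:R / q%:R))) t
      (z1 + z1 ^+ nu * (z1 * subst1 g1 (z1 ^+ q * z2 ^+ p)
                        + z1 ^+ nu.+1 * subst1 g2 (z1 ^+ q * z2 ^+ p)
                        + z2 ^+ 2 * subst1 t z2),
       z2 + z1 ^+ nu * z2)
| NFinverse (q : nat) (a : C) (po : {poly C}) (t : fps1 C)
    of (2 <= q)%N & ((size po).-1 <= nu %/ q)%N :
    normal_form nu (Star1 (q%:R^-1)) t
      (z1 + z1 ^+ nu * (q%:R^-1 *: z1 + twisted_poly nu 1 q po
                        + z2 ^+ 2 * subst1 t z2),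
       z2 + z1 ^+ nu * (z2 + a *: z1 ^+ q))
| NFpositive (p q : nat) (po : {poly C}) (t : fps1 C)
    of (1 <= q <= nu)%N & (2 <= p)%N & coprime p q
     & ((size po).-1 <= nu %/ q)%N :
    normal_form nu (Star1 (p%:R / q%:R)) t
      (z1 + z1 ^+ nu * ((p%:R / q%:R) *: z1 + twisted_poly nu p q po
                        + z2 ^+ 2 * subst1 t z2),
       z2 + z1 ^+ nu * z2)
| NFone (pnu : fps2 C) (t : fps1 C) of homogeneous nu pnu :
    normal_form nu (Star1 1) t
      (z1 + z1 ^+ nu * (z1 + z1 * pnu + z2 ^+ 2 * subst1 t z2),
       z2 + z1 ^+ nu * z2)
| NFJ1 (a : C) (t : fps1 C) :
    normal_form nu J1 t
      (z1 + z1 ^+ nu * (z1 + a *: (z1 * z2 ^+ nu) + z2 ^+ 2 * subst1 t z2),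
       z2 + z1 ^+ nu * (z1 + z2))
| NFStar2 (g1 g2 t : fps1 C) :
    normal_form nu Star2 t
      (z1 + z1 ^+ nu * (z1 + z1 ^+ nu.+1 * subst1 g1 z2
                        + z2 ^+ 2 * subst1 t z2),
       z2 + z1 ^+ nu * (z2 ^+ 2 * subst1 g2 z2))
| NFJ0 (g1 g2 t : fps1 C) :
    normal_form nu J0 t
      (z1 + z1 ^+ nu * (z1 * z2 * subst1 g1 z2 + z2 ^+ 2 * subst1 t z2),
       z2 + z1 ^+ nu * (z1 + z2 ^+ 2 * subst1 g2 z2)).

End NormalForms.

Arguments J1 {R}.
Arguments Star2 {R}.
Arguments J0 {R}.

(* Main.v *)
(* Writing f = id + z_1^nu f^o and fhat = id + z_1^nu q, the conjugacy equation
   f o chi = chi o fhat is solved degree by degree.  If p is the linear part of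
   f^o, adding to chi and q homogeneous terms H (with z_1 | H_1) and Q of degree
   m >= 2 changes the residual chi o fhat - f o chi, up to higher order, by
   z_1^nu (Q + dH.p - p(H) - nu (H_1 / z_1) p).  Once p is in one of its four
   normalized shapes this operator is computed on monomials: the monomials of
   each normal form span a complement of its image in every degree.  For
   p = (lam z_1, z_2) the only obstructions are z_1^(a+1) z_2^b in the first
   component when a lam + b = 0 or (a - nu) lam + b = 0, z_2^b in the first
   component, and z_1^a in the second one when a lam = 1; whence the arithmetic
   case distinction on lam.
   Conversely, comparing terms of lowest order in f o chi = chi o fhat shows that
   the linear part of f^o is determined up to linear conjugacy and scaling, which
   separates the families, and that z_1 | f^o_1 if and only if z_1 | q_1. *)

Require Import Defs.
From HB Require Import structures.
From mathcomp Require Import all_boot all_order all_algebra.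
From mathcomp Require Import complex.
From mathcomp Require Import boolp classical_sets reals.
From mathcomp Require Import ring zify.

Set Implicit Arguments.
Unset Strict Implicit.
Unset Printing Implicit Defensive.

Import Order.TTheory GRing.Theory Num.Theory.
Local Open Scope ring_scope.

(** * Formal power series in two variables *)

(** Total degree alone cannot drive the induction: a correction is read off from the residual
    divided by z_1^nu, so the residual must be divisible by z_1^nu as a series. This is where
    preservation of z_1 = 0 enters, and why orders of vanishing carry a weight w: one Taylor
    estimate then serves for total degree (w = 1) and for divisibility by z_1 (w = 0). The
    constraint z_1 | H_1 also explains the tail t: it leaves no unknown with which to remove the
    pure powers of z_2 from the first component. The condition a lam + b = 0 has another origin: the
    coefficient of z_1^(a+1) z_2^b in H_1 is then spent on the second component, where z_1^a
    z_2^(b+1) can be removed in no other way. Identities about substitution are proved by density,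
    being linear in the series and true on monomials. Since f^o is given as a function, and
    tangentiality only asks for some decomposition of f, the link with series rests on uniqueness of
    Taylor coefficients, proved here from the bare summation definition. *)

Section Coefficients.
Variable K : comNzRingType.
Implicit Types F G H : fps2 K.

Lemma cfD F G i j : coef (F + G) i j = coef F i j + coef G i j.
Proof. by []. Qed.

Lemma cfN F i j : coef (- F) i j = - coef F i j.
Proof. by []. Qed.

Lemma cfB F G i j : coef (F - G) i j = coef F i j - coef G i j.
Proof. by []. Qed.

Lemma cfZ c F i j : coef (c *: F) i j = c * coef F i j.
Proof. by []. Qed.

Lemma cf0 i j : coef (0 : fps2 K) i j = 0.
Proof. by []. Qed.

Lemma cfMn F n i j : coef (F *+ n) i j = coef F i j *+ n.
Proof. by elim: n => [|n IH]; rewrite ?mulr0n // !mulrS cfD IH. Qed.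

Lemma cf_natM n F i j : coef (n%:R * F) i j = n%:R * coef F i j.
Proof. by rewrite !mulr_natl cfMn. Qed.

Lemma cf_sum (I : Type) (r : seq I) (P : pred I) (F : I -> fps2 K) i j :
  coef (\sum_(k <- r | P k) F k) i j = \sum_(k <- r | P k) coef (F k) i j.
Proof. by elim/big_rec2: _ => // k x y _ <-. Qed.

Lemma cfM F G i j : coef (F * G) i j = \sum_(a < i.+1) \sum_(b < j.+1)
  coef F a b * coef G (i - a)%N (j - b)%N.
Proof. by []. Qed.

Lemma coef_z1M F i j : coef (z1 * F) i j = if i is i'.+1 then coef F i' j else 0.
Proof.
rewrite cfM; case: i => [|i].
  by rewrite big1 // => a _; rewrite big1 // => b _; rewrite /= ord1 /= mul0r.
rewrite big_ord_recl big1 ?add0r; last by move=> b _; rewrite /= mul0r.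
rewrite big_ord_recl [X in _ + X]big1 ?addr0; last first.
  by move=> a _; rewrite big1 // => b _; rewrite /= mul0r.
rewrite big_ord_recl big1 ?addr0 /=; last by move=> b _; rewrite /= mul0r.
by rewrite mul1r /bump /= !subSS !subn0.
Qed.

Lemma coef_z2M F i j : coef (z2 * F) i j = if j is j'.+1 then coef F i j' else 0.
Proof.
rewrite cfM big_ord_recl [X in _ + X]big1 ?addr0; last first.
  by move=> a _; rewrite big1 // => b _; rewrite /= mul0r.
case: j => [|j]; first by rewrite big_ord1 /= mul0r.
rewrite big_ord_recl /= mul0r add0r.
rewrite big_ord_recl big1 ?addr0 /=; last by move=> b _; rewrite /= mul0r.
by rewrite mul1r /bump /= !subSS !subn0.
Qed.

Lemma coef_z1XM n F i j :
  coef (z1 ^+ n * F) i j = if (n <= i)%N then coef F (i - n)%N j else 0.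
Proof.
elim: n i => [|n IH] i; first by rewrite expr0 mul1r subn0.
by rewrite exprS -mulrA coef_z1M; case: i => [|i] //; rewrite IH.
Qed.

Lemma coef_z2XM n F i j :
  coef (z2 ^+ n * F) i j = if (n <= j)%N then coef F i (j - n)%N else 0.
Proof.
elim: n j => [|n IH] j; first by rewrite expr0 mul1r subn0.
by rewrite exprS -mulrA coef_z2M; case: j => [|j] //; rewrite IH.
Qed.

Lemma cf1 i j : coef (1 : fps2 K) i j = ((i == 0%N) && (j == 0%N))%:R.
Proof. by []. Qed.

Lemma coef_mon a b i j :
  coef (z1 ^+ a * z2 ^+ b : fps2 K) i j = ((i == a) && (j == b))%:R.
Proof.
rewrite coef_z1XM -[z2 ^+ b]mulr1 coef_z2XM cf1.
case: (leqP a i) => ai; last first.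
  by case: eqP => // ia; rewrite ia ltnn in ai.
case: (leqP b j) => bj; last first.
  by rewrite andbC; case: eqP => // jb; rewrite jb ltnn in bj.
by congr (_%:R); lia.
Qed.

(* For w = 1 this bounds below the order of vanishing at the origin; for w = 0
   it says that z_1^n divides F. *)
Definition ord (w n : nat) F := forall i j, (i + w * j < n)%N -> coef F i j = 0.

Lemma ord_ge0 w F : ord w 0 F.
Proof. by []. Qed.

Lemma ord_zero w n : ord w n 0.
Proof. by []. Qed.

Lemma ordW w m n F : (m <= n)%N -> ord w n F -> ord w m F.
Proof. by move=> mn h i j hij; apply: h; apply: leq_trans mn. Qed.

Lemma ordD w n F G : ord w n F -> ord w n G -> ord w n (F + G).
Proof. by move=> hF hG i j h; rewrite cfD hF // hG // addr0. Qed.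

Lemma ordN w n F : ord w n F -> ord w n (- F).
Proof. by move=> hF i j h; rewrite cfN hF // oppr0. Qed.

Lemma ordB w n F G : ord w n F -> ord w n G -> ord w n (F - G).
Proof. by move=> hF hG; apply: ordD => //; apply: ordN. Qed.

Lemma ordZ w n c F : ord w n F -> ord w n (c *: F).
Proof. by move=> hF i j h; rewrite cfZ hF // mulr0. Qed.

Lemma ordM w m n F G : ord w m F -> ord w n G -> ord w (m + n) (F * G).
Proof.
move=> hF hG i j h; rewrite cfM big1 // => a _; rewrite big1 // => b _.
have [hab|hab] := ltnP (a + w * b) m; first by rewrite hF // mul0r.
rewrite hG ?mulr0 // mulnBr.
have := leq_mul (leqnn w) (ltn_ord b : (b <= j)%N); have := ltn_ord a; lia.
Qed.

Lemma ordMl w n F G : ord w n G -> ord w n (F * G).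
Proof. by move=> hG; apply: (@ordM _ 0). Qed.

Lemma ordMr w n F G : ord w n F -> ord w n (F * G).
Proof. by rewrite mulrC; apply: ordMl. Qed.

Lemma ordX w n F k : ord w n F -> ord w (k * n) (F ^+ k).
Proof. by move=> h; elim: k => // k IH; rewrite exprS mulSn; apply: ordM. Qed.

Lemma ord_z1X w n : ord w n (z1 ^+ n).
Proof.
move=> i j h; rewrite -[z1 ^+ n]mulr1 coef_z1XM.
by case: leqP => // ni; move: h; lia.
Qed.

Lemma ord_z1 w : ord w 1 z1.
Proof. exact: (@ord_z1X _ 1). Qed.

Lemma ord_z2 : ord 1 1 z2.
Proof. by move=> [|i] [|j] //=. Qed.

Lemma ordP F : (forall n, ord 1 n F) -> F = 0.
Proof. by move=> h; apply: fps2P => i j; apply: (h (i + j).+1); lia. Qed.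

(* The quotient of F by z_1^n when z_1^n divides F. *)
Definition shift (n : nat) F : fps2 K := FPS2 (fun i j => coef F (i + n) j).

Lemma shiftK n F : ord 0 n F -> F = z1 ^+ n * shift n F.
Proof.
move=> h; apply: fps2P => i j; rewrite coef_z1XM.
by case: leqP => ni; [rewrite /= subnK | apply: h; lia].
Qed.

Lemma shift1K F : (forall j, coef F 0 j = 0) -> F = z1 * shift 1 F.
Proof.
move=> h; rewrite -{1}[z1]expr1; apply: shiftK => i j hij.
by have -> : i = 0%N by lia.
Qed.

Lemma ord_shift n k F : ord 1 (n + k) F -> ord 1 k (shift n F).
Proof. by move=> h i j hij; apply: h; lia. Qed.

Lemma z1X_inj n : injective (fun F => z1 ^+ n * F).
Proof.
move=> F G /= /(congr1 (fun X => coef X)) e; apply: fps2P => i j.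
by move: (congr1 (fun X => X (i + n)%N j) e); rewrite !coef_z1XM leq_addl addnK.
Qed.

End Coefficients.

(** * Substitution and Taylor expansion *)

Section Density.
Variable K : comNzRingType.
Implicit Types (F G H : fps2 K) (X : fps2 K * fps2 K).

Definition trunc N F : fps2 K :=
  \sum_(a < N) \sum_(b < N) coef F a b *: (z1 ^+ a * z2 ^+ b).

Lemma coef_trunc N F i j : (i < N)%N -> (j < N)%N ->
  coef (trunc N F) i j = coef F i j.
Proof.
move=> hi hj; rewrite cf_sum (bigD1 (Ordinal hi)) //= [X in _ + X]big1 ?addr0.
  rewrite cf_sum (eq_bigr (fun b : 'I_N => coef F i b * (j == b)%:R)) => [|b _].
    rewrite (bigD1 (Ordinal hj)) //= eqxx mulr1 big1 ?addr0 // => b.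
    by rewrite -val_eqE /= eq_sym => /negbTE ->; rewrite mulr0.
  by rewrite cfZ coef_mon eqxx.
move=> a ha; rewrite cf_sum big1 // => b _; rewrite cfZ coef_mon.
by rewrite -val_eqE /= eq_sym in ha; rewrite (negbTE ha) mulr0.
Qed.

(* T is linear and each coefficient of T F depends on finitely many
   coefficients of F: such a T is determined by its values on monomials. *)
Definition local_linear (T : fps2 K -> fps2 K) :=
  linear T /\ forall i j, exists N, forall F,
    (forall a b, (a < N)%N -> (b < N)%N -> coef F a b = 0) -> coef (T F) i j = 0.

(** By locality a coefficient of [T F] is that of [T] at a truncation of [F], a finite combination
    of monomials; those of degree less than m do not occur in [F]. *)
Lemma local_linear_ord T w m n F : local_linear T ->
  (forall a b, (m <= a + b)%N -> ord w n (T (z1 ^+ a * z2 ^+ b))) ->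
  ord 1 m F -> ord w n (T F).
Proof.
move=> [Tlin Tloc] hT hF i j hij; have [N hN] := Tloc i j.
have TB F' G : T (F' - G) = T F' - T G.
  by rewrite addrC -scaleN1r Tlin scaleN1r addrC.
have T0 : T 0 = 0 by have := TB 0 0; rewrite !subrr.
have TZ c F' : T (c *: F') = c *: T F' by rewrite -[c *: F']addr0 Tlin T0 addr0.
have TD F' G : T (F' + G) = T F' + T G by rewrite -[F']scale1r Tlin !scale1r.
have -> : coef (T F) i j = coef (T (trunc N F)) i j.
  apply/eqP; rewrite -subr_eq0 -cfB -TB; apply/eqP; apply: hN => a b ha hb.
  by rewrite cfB coef_trunc // subrr.
rewrite (big_morph T TD T0) cf_sum big1 // => a _.
rewrite (big_morph T TD T0) cf_sum big1 // => b _.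
rewrite TZ cfZ; case: (ltnP (a + b) m) => hab.
  by rewrite hF ?mul0r // mul1n.
by rewrite hT ?mulr0.
Qed.

Lemma local_linear0 T F : local_linear T ->
  (forall a b, T (z1 ^+ a * z2 ^+ b) = 0) -> T F = 0.
Proof.
move=> hT h; apply: ordP => n; apply: (@local_linear_ord _ _ 0) => // a b _.
by rewrite h.
Qed.

Lemma local_linearB T U : local_linear T -> local_linear U ->
  local_linear (fun F => T F - U F).
Proof.
move=> [Tl Tc] [Ul Uc]; split=> [c F G|i j].
  by rewrite Tl Ul scalerBr opprD !addrA; congr (_ + _); rewrite addrAC.
have [N hN] := Tc i j; have [M hM] := Uc i j; exists (maxn N M) => F hF.
by rewrite cfB hN ?hM ?subrr // => a b ha hb; apply: hF; rewrite leq_max ?ha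
  ?hb ?orbT.
Qed.

Lemma local_linearMr T G : local_linear T -> local_linear (fun F => T F * G).
Proof.
move=> [Tl Tc]; split=> [c F H|i j]; first by rewrite Tl mulrDl scalerAl.
have cT (a : 'I_i.+1) (b : 'I_j.+1) : {N | forall F,
  (forall a b, (a < N)%N -> (b < N)%N -> coef F a b = 0) -> coef (T F) a b = 0}.
  exact/cid/Tc.
exists (\max_(a < i.+1) \max_(b < j.+1) sval (cT a b)) => F hF.
rewrite cfM big1 // => a _; rewrite big1 // => b _.
rewrite (svalP (cT a b)) ?mul0r // => a' b' ha hb; apply: hF.
  by apply: (leq_trans ha); apply: (leq_trans _ (leq_bigmax a)); apply:
    (leq_bigmax b).
by apply: (leq_trans hb); apply: (leq_trans _ (leq_bigmax a)); apply:
  (leq_bigmax b).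
Qed.

Lemma local_linear_comp T U : local_linear T -> local_linear U ->
  local_linear (fun F => T (U F)).
Proof.
move=> [Tl Tc] [Ul Uc]; split=> [c F H|i j]; first by rewrite Ul Tl.
have [M hM] := Tc i j.
have cU (a b : 'I_M) : {N | forall F,
  (forall a b, (a < N)%N -> (b < N)%N -> coef F a b = 0) -> coef (U F) a b = 0}.
  exact/cid/Uc.
exists (\max_(a < M) \max_(b < M) sval (cU a b)) => F hF; apply: hM => a b ha hb.
pose a' := Ordinal ha; pose b' := Ordinal hb.
apply: (svalP (cU a' b')) => c d hc hd; apply: hF.
  by apply: (leq_trans hc); apply: (leq_trans _ (leq_bigmax a')); apply:
    (leq_bigmax b').
by apply: (leq_trans hd); apply: (leq_trans _ (leq_bigmax a')); apply:
  (leq_bigmax b').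
Qed.

Lemma local_linear_mulr G : local_linear (fun F => F * G).
Proof.
apply: local_linearMr; split=> // i j; exists (maxn i j).+1 => F; apply.
  by rewrite ltnS leq_maxl.
by rewrite ltnS leq_maxr.
Qed.

Lemma local_linear_subst2 X : local_linear (fun F => subst2 F X).
Proof.
split=> [c F G|i j].
  apply: fps2P => i j; rewrite cfD cfZ /= mulr_sumr -big_split.
  apply: eq_bigr => a _; rewrite mulr_sumr -big_split; apply: eq_bigr => b _.
  by rewrite /= mulrDl mulrA.
exists (i + j).+1 => F hF /=; rewrite big1 // => a _; rewrite big1 // => b _.
by rewrite hF // mul0r.
Qed.

Definition d1 F : fps2 K := FPS2 (fun i j => i.+1%:R * coef F i.+1 j).
Definition d2 F : fps2 K := FPS2 (fun i j => j.+1%:R * coef F i j.+1).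

Lemma cf_d1 F i j : coef (d1 F) i j = i.+1%:R * coef F i.+1 j.
Proof. by []. Qed.

Lemma cf_d2 F i j : coef (d2 F) i j = j.+1%:R * coef F i j.+1.
Proof. by []. Qed.

Lemma local_linear_d1 : local_linear d1.
Proof.
split=> [c F G|i j].
  by apply: fps2P => i j; rewrite cfD cfZ /= mulrDr mulrCA.
by exists (i + j).+2 => F hF /=; rewrite hF ?mulr0 //; lia.
Qed.

Lemma local_linear_d2 : local_linear d2.
Proof.
split=> [c F G|i j].
  by apply: fps2P => i j; rewrite cfD cfZ /= mulrDr mulrCA.
by exists (i + j).+2 => F hF /=; rewrite hF ?mulr0 //; lia.
Qed.

Lemma d1_z1M F : d1 (z1 * F) = F + z1 * d1 F.
Proof.
apply: fps2P => i j; rewrite cfD cf_d1 !coef_z1M.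
by case: i => [|i] /=; rewrite ?mul1r ?addr0 // -[i.+2]addn1 natrD mulrDl mul1r
  addrC.
Qed.

Lemma d2_z2M F : d2 (z2 * F) = F + z2 * d2 F.
Proof.
apply: fps2P => i j; rewrite cfD cf_d2 !coef_z2M.
by case: j => [|j] /=; rewrite ?mul1r ?addr0 // -[j.+2]addn1 natrD mulrDl mul1r
  addrC.
Qed.

Lemma d1_z2M F : d1 (z2 * F) = z2 * d1 F.
Proof.
by apply: fps2P => i j; rewrite cf_d1 !coef_z2M; case: j; rewrite ?mulr0.
Qed.

Lemma d2_z1M F : d2 (z1 * F) = z1 * d2 F.
Proof.
by apply: fps2P => i j; rewrite cf_d2 !coef_z1M; case: i; rewrite ?mulr0.
Qed.

Lemma d1_ord n F : ord 1 n.+1 F -> ord 1 n (d1 F).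
Proof. by move=> h i j hij /=; rewrite h ?mulr0 //; lia. Qed.

Lemma d2_ord n F : ord 1 n.+1 F -> ord 1 n (d2 F).
Proof. by move=> h i j hij /=; rewrite h ?mulr0 //; lia. Qed.

End Density.

Section Substitution.
Variable K : comNzRingType.
Implicit Types (F G H : fps2 K) (X Y Z : fps2 K * fps2 K).

Definition ordp w n X := ord w n X.1 /\ ord w n X.2.

Lemma no_constP X : no_const X <-> ordp 1 1 X.
Proof.
split=> [[h1 h2]|[h1 h2]]; last by split; [apply: h1|apply: h2].
by split=> i j hij; have [-> ->] : i = 0%N /\ j = 0%N by lia.
Qed.

Lemma cf_subst2 F X i j : coef (subst2 F X) i j =
  \sum_(a < (i + j).+1) \sum_(b < (i + j).+1)
    coef F a b * coef (X.1 ^+ a * X.2 ^+ b) i j.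
Proof. by []. Qed.

Lemma subst2_lin X c F G : subst2 (c *: F + G) X = c *: subst2 F X + subst2 G X.
Proof. exact: (local_linear_subst2 X).1. Qed.

Lemma subst2D X F G : subst2 (F + G) X = subst2 F X + subst2 G X.
Proof. by rewrite -[F]scale1r subst2_lin !scale1r. Qed.

Lemma subst2B X F G : subst2 (F - G) X = subst2 F X - subst2 G X.
Proof. by rewrite addrC -scaleN1r subst2_lin scaleN1r addrC. Qed.

Lemma subst20 X : subst2 0 X = 0.
Proof. by have := subst2B X 0 0; rewrite !subrr. Qed.

Lemma subst2Z X c F : subst2 (c *: F) X = c *: subst2 F X.
Proof. by rewrite -[c *: F]addr0 subst2_lin subst20 addr0. Qed.

Lemma subst2_mon X a b : ordp 1 1 X ->
  subst2 (z1 ^+ a * z2 ^+ b) X = X.1 ^+ a * X.2 ^+ b.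
Proof.
move=> [h1 h2]; apply: fps2P => i j; rewrite cf_subst2.
have [hab|hab] := ltnP (i + j) (a + b).
  have -> : coef (X.1 ^+ a * X.2 ^+ b) i j = 0.
    apply: (@ordM _ 1 (a * 1) (b * 1)); [exact: ordX|exact: ordX|lia].
  apply: big1 => c _; apply: big1 => d _.
  rewrite coef_mon; case: eqP => [->|]; last by rewrite mul0r.
  case: eqP => [->|]; last by rewrite mul0r.
  rewrite (@ordM _ 1 (a * 1) (b * 1) _ _ _ _ i j) ?mulr0 //;
    [exact: ordX|exact: ordX|lia].
have ha : (a < (i + j).+1)%N by lia.
have hb : (b < (i + j).+1)%N by lia.
set D := coef _ i j.
transitivity (\sum_(c < (i + j).+1) \sum_(d < (i + j).+1)
    ((c == a :> nat) && (d == b :> nat))%:R * D).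
  apply: eq_bigr => c _; apply: eq_bigr => d _; rewrite coef_mon.
  by case: eqP => [->|]; rewrite ?mul0r //; case: eqP => [->|]; rewrite ?mul0r.
rewrite (bigD1 (Ordinal ha)) //= [X in _ + X]big1 ?addr0.
  rewrite (bigD1 (Ordinal hb)) //= !eqxx mul1r big1 ?addr0 // => d.
  by rewrite -val_eqE /= => /negbTE ->; rewrite mul0r.
move=> c; rewrite -val_eqE /= => /negbTE ->.
by rewrite big1 // => d _; rewrite mul0r.
Qed.

Lemma subst2_z1 X : ordp 1 1 X -> subst2 z1 X = X.1.
Proof. by move=> h; rewrite -[z1]mulr1 (@subst2_mon _ 1 0) // expr1 mulr1. Qed.

Lemma subst2_z2 X : ordp 1 1 X -> subst2 z2 X = X.2.
Proof. by move=> h; rewrite -[z2]mul1r (@subst2_mon _ 0 1) // expr1 mul1r. Qed.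

Lemma subst21 X : ordp 1 1 X -> subst2 1 X = 1.
Proof. by move=> h; rewrite -[1]mulr1 (@subst2_mon _ 0 0) // !expr0. Qed.

(** The defect of multiplicativity is symmetric and local linear in each factor, so density applies
    to one factor and then to the other. *)
Lemma subst2M X F G : ordp 1 1 X -> subst2 (F * G) X = subst2 F X * subst2 G X.
Proof.
move=> hX; apply/eqP; rewrite -subr_eq0; apply/eqP.
pose T G F := subst2 (F * G) X - subst2 F X * subst2 G X.
have TC F' G' : T F' G' = T G' F' by rewrite /T mulrC [subst2 _ _ * _]mulrC.
have hT F' : local_linear (T F').
  apply: local_linearB.
    exact: (local_linear_comp (local_linear_subst2 X) (local_linear_mulr F')).
  exact/local_linearMr/local_linear_subst2.
rewrite -/(T G F); apply: local_linear0 => // a b; rewrite TC.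
apply: local_linear0 => // c d; rewrite /T !subst2_mon // mulrACA -!exprD.
by rewrite subst2_mon // [X in _ - X]mulrACA -!exprD subrr.
Qed.

Lemma subst2X X F n : ordp 1 1 X -> subst2 (F ^+ n) X = subst2 F X ^+ n.
Proof.
move=> hX; elim: n => [|n IH]; first by rewrite !expr0 subst21.
by rewrite !exprS subst2M // IH.
Qed.

Lemma ord_subst2 n F X : ordp 1 1 X -> ord 1 n F -> ord 1 n (subst2 F X).
Proof.
move=> hX hF; apply: (local_linear_ord (local_linear_subst2 X) _ hF) => a b hab.
rewrite subst2_mon //; apply: (@ordW _ _ _ (a * 1 + b * 1)); first lia.
by case: hX => h1 h2; apply: ordM; apply: ordX.
Qed.

Lemma ordp_fcomp X Y : ordp 1 1 Y -> ordp 1 1 X -> ordp 1 1 (Defs.comp X Y).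
Proof. by move=> hY [h1 h2]; split; apply: ord_subst2. Qed.

Lemma subst2_fcomp F X Y : ordp 1 1 X -> ordp 1 1 Y ->
  subst2 (subst2 F X) Y = subst2 F (Defs.comp X Y).
Proof.
move=> hX hY; apply/eqP; rewrite -subr_eq0; apply/eqP.
apply: (@local_linear0 _ (fun F => subst2 (subst2 F X) Y - subst2 F (Defs.comp
  X Y))).
  apply: local_linearB; last exact: local_linear_subst2.
  exact: (local_linear_comp (local_linear_subst2 Y) (local_linear_subst2 X)).
move=> a b; rewrite !subst2_mon //; last exact: ordp_fcomp.
by rewrite subst2M // !subst2X // subrr.
Qed.

Lemma fcompA X Y Z : ordp 1 1 Y -> ordp 1 1 Z ->
  Defs.comp X (Defs.comp Y Z) = Defs.comp (Defs.comp X Y) Z.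
Proof. by move=> hY hZ; rewrite /Defs.comp !subst2_fcomp. Qed.

Lemma ordp_id : ordp 1 1 (@idmap2 K).
Proof. by split; [apply: ord_z1|apply: ord_z2]. Qed.

Lemma fcomp_id X : Defs.comp X idmap2 = X.
Proof.
have key F : subst2 F idmap2 = F.
  apply/eqP; rewrite -subr_eq0; apply/eqP.
  apply: (@local_linear0 _ (fun F => subst2 F idmap2 - F)).
    apply: local_linearB; first exact: local_linear_subst2.
    by have := local_linear_mulr (1 : fps2 K); under eq_fun do rewrite mulr1.
  by move=> a b; rewrite subst2_mon ?subrr //; apply: ordp_id.
by rewrite /Defs.comp !key -surjective_pairing.
Qed.

Lemma id_fcomp X : ordp 1 1 X -> Defs.comp idmap2 X = X.
Proof.
by move=> h; rewrite /Defs.comp /= subst2_z1 // subst2_z2 // -surjective_pairing.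
Qed.

Lemma subst2_id F : subst2 F (@idmap2 K) = F.
Proof. by have := fcomp_id (F, 0); rewrite /Defs.comp => -[]. Qed.

(** Taylor remainders at [X] in the direction [Y], after the constant term and after the first-order
    term. *)
Let rem1 X Y F := subst2 F (X + Y) - subst2 F X.
Let rem2 X Y F :=
  rem1 X Y F - (subst2 (d1 F) X * Y.1 + subst2 (d2 F) X * Y.2).

Lemma local_linear_ext (T U : fps2 K -> fps2 K) :
  local_linear T -> (forall F, T F = U F) -> local_linear U.
Proof.
by move=> hT e; have -> : U = T by apply/funext => F; rewrite e.
Qed.

(** Each of the a + b factors contributes order g, and each replacement of a factor of [X] by one of
    [Y] gains k. The three bounds are proved together because the second remainder of a product
    involves the first remainder of a factor. *)
Lemma taylor_mon w g k X Y a b : ordp 1 1 X -> ordp 1 1 Y ->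
  ordp w g X -> ordp w (g + k) Y ->
  [/\ ord w ((a + b) * g) (subst2 (z1 ^+ a * z2 ^+ b) X),
      ord w ((a + b) * g + k) (rem1 X Y (z1 ^+ a * z2 ^+ b)) &
      ord w ((a + b) * g + 2 * k) (rem2 X Y (z1 ^+ a * z2 ^+ b))].
Proof.
move=> hX hY [hX1 hX2] [hY1 hY2].
have hXY : ordp 1 1 (X + Y) by case: hX hY => ? ? [? ?]; split; apply: ordD.
(* Multiplication by one variable [z], with value [V] at [X] and [V + V'] at [X + Y]; the third
   premise is the Leibniz rule. *)
have step m (F z V V' : fps2 K) (P := z * F) :
    subst2 P X = V * subst2 F X -> subst2 P (X + Y) = (V + V') * subst2 F (X + Y) ->
    subst2 (d1 P) X * Y.1 + subst2 (d2 P) X * Y.2 =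
      V' * subst2 F X + V * (subst2 (d1 F) X * Y.1 + subst2 (d2 F) X * Y.2) ->
    ord w g V -> ord w (g + k) V' ->
    [/\ ord w (m * g) (subst2 F X), ord w (m * g + k) (rem1 X Y F) &
      ord w (m * g + 2 * k) (rem2 X Y F)] ->
    [/\ ord w (m.+1 * g) (subst2 P X), ord w (m.+1 * g + k) (rem1 X Y P) &
      ord w (m.+1 * g + 2 * k) (rem2 X Y P)].
  move=> e0 e1 e2 hV hV' [h0 h1 h2].
  have E1 : rem1 X Y P = V * rem1 X Y F + V' * rem1 X Y F + V' * subst2 F X.
    by rewrite /rem1 e0 e1; ring.
  have E2 : rem2 X Y P = V * rem2 X Y F + V' * rem1 X Y F.
    by rewrite /rem2 /rem1 e0 e1 e2; ring.
  split; first by rewrite e0 mulSn; apply: ordM.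
  - rewrite E1; apply: ordD; first apply: ordD.
    + by rewrite mulSn -addnA; apply: ordM.
    + by apply: (@ordW _ _ _ ((g + k) + (m * g + k))); [lia|apply: ordM].
    + by apply: (@ordW _ _ _ ((g + k) + m * g)); [lia|apply: ordM].
  - rewrite E2; apply: ordD; first by rewrite mulSn -addnA; apply: ordM.
    by apply: (@ordW _ _ _ ((g + k) + (m * g + k))); [lia|apply: ordM].
elim: a => [|a IH].
  rewrite expr0 add0n; elim: b => [|b IH].
    rewrite mulr1 mul0n; split=> //; rewrite /rem2 /rem1.
      by rewrite !subst21 // subrr.
    rewrite !subst21 // subrr sub0r.
    have -> : d1 1 = 0 :> fps2 K by apply: fps2P => i j /=; rewrite mulr0.
    have -> : d2 1 = 0 :> fps2 K.
      by apply: fps2P => i j /=; rewrite andbF mulr0.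
    by rewrite subst20 !mul0r addr0 oppr0.
  rewrite exprS mulrCA; apply: (step b _ z2 X.2 Y.2) IH => //.
  - by rewrite subst2M // subst2_z2.
  - by rewrite subst2M // subst2_z2.
  - by rewrite d1_z2M d2_z2M subst2D !subst2M // subst2_z2 //; ring.
rewrite exprS -mulrA addSn; apply: (step _ _ z1 X.1 Y.1) IH => //.
- by rewrite subst2M // subst2_z1.
- by rewrite subst2M // subst2_z1.
- by rewrite d1_z1M d2_z1M subst2D !subst2M // subst2_z1 //; ring.
Qed.

Lemma taylor1 w g k m X Y F : ordp 1 1 X -> ordp 1 1 Y ->
  ordp w g X -> ordp w (g + k) Y -> ord 1 m F ->
  ord w (m * g + k) (subst2 F (X + Y) - subst2 F X).
Proof.
move=> hX hY hgX hgY; apply: (@local_linear_ord _ (rem1 X Y)).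
  by apply: local_linearB; apply: local_linear_subst2.
move=> a b hab; have [_ h _] := taylor_mon a b hX hY hgX hgY.
by apply: ordW h; rewrite leq_add2r leq_mul2r hab orbT.
Qed.

Lemma taylor2 w g k m X Y F : ordp 1 1 X -> ordp 1 1 Y ->
  ordp w g X -> ordp w (g + k) Y -> ord 1 m F ->
  ord w (m * g + 2 * k) (subst2 F (X + Y) - subst2 F X
     - (subst2 (d1 F) X * Y.1 + subst2 (d2 F) X * Y.2)).
Proof.
move=> hX hY hgX hgY; apply: (@local_linear_ord _ (rem2 X Y)).
  apply: (@local_linear_ext (fun F => rem1 X Y F - subst2 (d1 F) X * Y.1
      - subst2 (d2 F) X * Y.2)).
    apply: local_linearB; first apply: local_linearB.
    - by apply: local_linearB; apply: local_linear_subst2.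
    - apply: local_linearMr.
      exact: (local_linear_comp (local_linear_subst2 X) (local_linear_d1 K)).
    - apply: local_linearMr.
      exact: (local_linear_comp (local_linear_subst2 X) (local_linear_d2 K)).
  by move=> F'; rewrite /rem2 opprD addrA.
move=> a b hab; have [_ _ h] := taylor_mon a b hX hY hgX hgY.
by apply: ordW h; rewrite leq_add2r leq_mul2r hab orbT.
Qed.

Lemma ord_linear_part F : ord 1 1 F ->
  ord 1 2 (F - (coef F 1 0 *: z1 + coef F 0 1 *: z2)).
Proof.
move=> hF i j; rewrite cfB cfD !cfZ.
case: i j => [|[|i]] [|[|j]] //= _; rewrite ?mulr1 ?mulr0 ?addr0 ?add0r ?subrr //.
by rewrite hF // subr0.
Qed.

Lemma subst2_ord2 g F X : ordp 1 g.+1 X -> ord 1 1 F ->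
  ord 1 (2 * g.+1) (subst2 F X - (coef F 1 0 *: X.1 + coef F 0 1 *: X.2)).
Proof.
move=> hX hF; have h1 : ordp 1 1 X by case: hX => a b; split; [apply: ordW
  a|apply: ordW b].
have -> : coef F 1 0 *: X.1 + coef F 0 1 *: X.2 =
          subst2 (coef F 1 0 *: z1 + coef F 0 1 *: z2) X.
  by rewrite subst2D !subst2Z subst2_z1 // subst2_z2.
rewrite -subst2B.
apply: (local_linear_ord (local_linear_subst2 X) _ (ord_linear_part hF)) => a b hab.
rewrite subst2_mon //; apply: (@ordW _ _ _ (a * g.+1 + b * g.+1)).
  by rewrite -mulnDl leq_mul2r hab orbT.
by case: hX => *; apply: ordM; apply: ordX.
Qed.

End Substitution.

(** * Limits in the adic topology *)

Section Limits.
Variable K : comNzRingType.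
Implicit Types (x y : (fps2 K * fps2 K) * (fps2 K * fps2 K)).

Let close n x y := ordp 1 n (x.1 - y.1) /\ ordp 1 n (x.2 - y.2).

(** Dependent choice, then a coefficientwise limit: stage n no longer changes degrees below n, so
    the coefficient (i, j) is read at stage i + j + 1. [A] is not assumed closed; properties pass to
    the limit by congruence at the place of use. Pairs of maps are needed because a coordinate
    change and a normal form are built together. *)
Lemma adic_limit (A : nat -> (fps2 K * fps2 K) * (fps2 K * fps2 K) -> Prop) x0 :
  A 0%N x0 -> (forall n x, A n x -> exists2 y, A n.+1 y & close n y x) ->
  exists x, forall n, exists2 y, A n y & close n x y.
Proof.
move=> A0 step.
pose next n (x : {x | A n x}) : {y | A n.+1 y & close n y (sval x)} :=
  cid2 (step n (sval x) (svalP x)).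
pose s : forall n, {x | A n x} := fix s n := match n with
  | 0%N => exist _ x0 A0
  | n'.+1 => exist _ (s2val (next n' (s n'))) (s2valP (next n' (s n')))
  end.
pose S n := sval (s n); have SP n : A n (S n) := svalP (s n).
have sS n : close n (S n.+1) (S n) := s2valP' (next n (s n)).
move: S SP sS => {s next} S SP sS.
have sD n k i j : (i + j < n)%N ->
  [/\ coef (S (n + k)%N).1.1 i j = coef (S n).1.1 i j,
      coef (S (n + k)%N).1.2 i j = coef (S n).1.2 i j,
      coef (S (n + k)%N).2.1 i j = coef (S n).2.1 i j &
      coef (S (n + k)%N).2.2 i j = coef (S n).2.2 i j].
  move=> hij; elim: k => [|k [<- <- <- <-]]; first by rewrite addn0.
  rewrite addnS; have h : (i + 1 * j < n + k)%N by lia.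
  by case: (sS (n + k)%N) => -[] /(_ i j h) /eqP e1 /(_ i j h) /eqP e2
    [] /(_ i j h) /eqP e3 /(_ i j h) /eqP e4; move: e1 e2 e3 e4;
    rewrite !cfB !subr_eq0 => /eqP -> /eqP -> /eqP -> /eqP ->.
pose lim (f : _ -> fps2 K) := FPS2 (fun i j => coef (f (S (i + j).+1)) i j).
exists ((lim (fun x => x.1.1), lim (fun x => x.1.2)),
        (lim (fun x => x.2.1), lim (fun x => x.2.2))) => n.
exists (S n); first exact: SP.
have lt i j : (i + 1 * j < n)%N -> n = ((i + j).+1 + (n - (i + j).+1))%N by lia.
by split; split=> i j /lt e; rewrite cfB /= e;
  have [] := sD (i + j).+1 (n - (i + j).+1)%N i j (leqnn _) => e1 e2 e3 e4;
  rewrite ?e1 ?e2 ?e3 ?e4 subrr.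
Qed.

End Limits.

(** * Congruences modulo orders of vanishing *)

Section Congruences.
Variable K : comNzRingType.
Implicit Types (F G H : fps2 K) (X Y Z : fps2 K * fps2 K).

Lemma ordpW w m n X : (m <= n)%N -> ordp w n X -> ordp w m X.
Proof. by move=> mn [h1 h2]; split; apply: (ordW mn). Qed.

Lemma ordpD w n X Y : ordp w n X -> ordp w n Y -> ordp w n (X + Y).
Proof. by move=> [h1 h2] [h3 h4]; split; apply: ordD. Qed.

Lemma ord_subB w n F G H : ord w n (F - G - (H - G)) -> ord w n (F - H).
Proof. by rewrite opprB addrA subrK. Qed.

Lemma ordp_eq X Y : (forall n, ordp 1 n (X - Y)) -> X = Y.
Proof.
move=> h; apply/eqP; rewrite -subr_eq0; apply/eqP.
by apply: injective_projections; apply: ordP => n; case: (h n).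
Qed.

Lemma ordp_sub w n X Y :
  ord w n (X.1 - Y.1) -> ord w n (X.2 - Y.2) -> ordp w n (X - Y).
Proof. by []. Qed.

Lemma ordpN w n X : ordp w n X -> ordp w n (- X).
Proof. by move=> [h1 h2]; split; apply: ordN. Qed.

Lemma ordpB w n X Y : ordp w n X -> ordp w n Y -> ordp w n (X - Y).
Proof. by move=> hX hY; apply: ordpD => //; apply: ordpN. Qed.

Lemma ordB_sym w n F G : ord w n (F - G) -> ord w n (G - F).
Proof. by move=> h; rewrite -opprB; apply: ordN. Qed.

Lemma ord_eq w n F G : ord w n (F - G) ->
  forall i j, (i + w * j < n)%N -> coef F i j = coef G i j.
Proof. by move=> h i j /h /eqP; rewrite cfB subr_eq0 => /eqP. Qed.

Lemma ord_near w n F G : ord w n (F - G) -> ord w n G -> ord w n F.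
Proof. by move=> h hG; rewrite -[F](subrK G); apply: ordD. Qed.

Lemma ord_trans w n G F H : ord w n (F - G) -> ord w n (G - H) -> ord w n (F - H).
Proof. by move=> h h'; rewrite -[F](subrK G) -addrA; apply: ordD. Qed.

Lemma ordp_sym w n X Y : ordp w n (X - Y) -> ordp w n (Y - X).
Proof. by move=> [h h']; split; apply: ordB_sym. Qed.

Lemma ordp_trans w n Y X Z :
  ordp w n (X - Y) -> ordp w n (Y - Z) -> ordp w n (X - Z).
Proof.
by move=> [h1 h2] [h3 h4]; split; [apply: ord_trans h1 h3|apply: ord_trans h2 h4].
Qed.

Lemma ordp_near w n X Y : ordp w n (X - Y) -> ordp w n Y -> ordp w n X.
Proof.
by move=> [h1 h2] [h3 h4]; split; [apply: ord_near h1 h3|apply: ord_near h2 h4].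
Qed.

Lemma ordp_refl w n X : ordp w n (X - X).
Proof. by rewrite subrr; split; apply: ord_zero. Qed.

Lemma ordp_add w n X Y Z : ordp w n (X - Z) -> ordp w n Y -> ordp w n (X + Y - Z).
Proof. by move=> h h'; rewrite addrAC; apply: ordpD. Qed.

Lemma ordp_addl w n X Y : ordp w n Y -> ordp w n (X + Y - X).
Proof. by rewrite addrAC subrr add0r. Qed.

Lemma subst2_congr n F X Y : ordp 1 1 X -> ordp 1 1 Y -> ordp 1 n (X - Y) ->
  ord 1 1 F -> ord 1 n (subst2 F X - subst2 F Y).
Proof.
move=> hX hY hXY hF; have hd : ordp 1 1 (X - Y) by apply: ordpB.
have h : ordp 1 (1 + n.-1) (X - Y) by case: n hXY.
have := taylor1 hY hd hY h hF; rewrite [Y + _]addrC subrK.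
by apply: ordW; lia.
Qed.

Lemma ord_subst2_const F X : ordp 1 1 X ->
  ord 1 1 (subst2 F X - coef F 0 0 *: 1).
Proof.
move=> hX; rewrite -[X in _ - _ *: X](subst21 hX) -subst2Z -subst2B.
apply: ord_subst2 => // i j hij; have [-> ->] : i = 0%N /\ j = 0%N by lia.
by rewrite cfB cfZ /= mulr1 subrr.
Qed.

(** The terms quadratic in [Y] start in degree 2m + 3, and freezing the derivatives at the origin
    costs a factor of order one times [Y]. *)
Lemma taylor_linear m X Y F : ordp 1 1 X -> ordp 1 m.+2 Y -> ord 1 1 F ->
  ord 1 m.+3 (subst2 F (X + Y) - subst2 F X
              - (coef F 1 0 *: Y.1 + coef F 0 1 *: Y.2)).
Proof.
move=> hX hY hF.
have h := @taylor2 _ 1 1 m.+1 1 X Y F hX (ordpW (isT : (1 <= m.+2)%N) hY) hX hY hF.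
have -> : subst2 F (X + Y) - subst2 F X - (coef F 1 0 *: Y.1 + coef F 0 1 *: Y.2) =
  (subst2 F (X + Y) - subst2 F X - (subst2 (d1 F) X * Y.1 + subst2 (d2 F) X * Y.2))
  + ((subst2 (d1 F) X - coef F 1 0 *: 1) * Y.1
     + (subst2 (d2 F) X - coef F 0 1 *: 1) * Y.2).
  by rewrite !mulrBl -!scalerAl !mul1r; ring.
apply: ordD; first by apply: ordW h; lia.
have -> : coef F 1 0 = coef (d1 F) 0 0 by rewrite cf_d1 mul1r.
have -> : coef F 0 1 = coef (d2 F) 0 0 by rewrite cf_d2 mul1r.
by case: hY => h1 h2; apply: ordD; (apply: (@ordM _ 1 1 m.+2) => //;
  apply: ord_subst2_const).
Qed.

Lemma conjugation_sym (F G X Y : fps2 K * fps2 K) : ordp 1 1 X -> ordp 1 1 Y ->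
  ordp 1 1 F -> ordp 1 1 G -> Defs.comp X Y = idmap2 -> Defs.comp Y X = idmap2 ->
  Defs.comp F X = Defs.comp X G -> Defs.comp G Y = Defs.comp Y F.
Proof.
move=> hX hY hF hG XY YX e.
have hGY := ordp_fcomp hY hG; have hFX := ordp_fcomp hX hF.
rewrite -[LHS]id_fcomp // -YX -(fcompA Y hX hGY) (fcompA X hG hY) -e.
by rewrite -(fcompA F hX hY) XY fcomp_id.
Qed.

Lemma coef_subst2_10 F X : ordp 1 1 X -> ord 1 1 F ->
  coef (subst2 F X) 1 0 = coef F 1 0 * coef X.1 1 0 + coef F 0 1 * coef X.2 1 0.
Proof. by move=> hX hF; rewrite (ord_eq (subst2_ord2 hX hF)). Qed.

Lemma coef_subst2_01 F X : ordp 1 1 X -> ord 1 1 F ->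
  coef (subst2 F X) 0 1 = coef F 1 0 * coef X.1 0 1 + coef F 0 1 * coef X.2 0 1.
Proof. by move=> hX hF; rewrite (ord_eq (subst2_ord2 hX hF)). Qed.

Lemma conjugation_trans (F G H X Y : fps2 K * fps2 K) : ordp 1 1 X -> ordp 1 1 Y ->
  ordp 1 1 G -> ordp 1 1 H -> Defs.comp F X = Defs.comp X G ->
  Defs.comp G Y = Defs.comp Y H ->
  Defs.comp F (Defs.comp X Y) = Defs.comp (Defs.comp X Y) H.
Proof.
move=> hX hY hG hH eX eY.
by rewrite (fcompA F hX hY) eX -(fcompA X hG hY) eY (fcompA X hY hH).
Qed.

End Congruences.

(** * Formal changes of coordinates *)

Section Inverse.
Variable K : fieldType.
Implicit Types (F G H : fps2 K) (X Y Z : fps2 K * fps2 K).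

(** Only the linear part is constrained, which is enough to solve X o Y = id by successive
    approximation. Divisibility of the first component by z_1 is recovered for the inverse
    afterwards. *)
Definition triangular X := [/\ ordp 1 1 X, coef X.1 0 1 = 0,
  coef X.1 1 0 != 0 & coef X.2 0 1 != 0].

Lemma right_inverse X : triangular X ->
  exists2 Y, triangular Y & Defs.comp X Y = idmap2.
Proof.
move=> [hX X01 X10 X2]; set a := coef X.1 1 0 in X10; set c := coef X.2 1 0.
set d := coef X.2 0 1 in X2.
(* The inverse of the lower triangular linear part of [X], applied to a pair of series. *)
pose solve (E : fps2 K * fps2 K) :=
  (a^-1 *: E.1, d^-1 *: (E.2 - c *: (a^-1 *: E.1))).
have solve1 E : a *: (solve E).1 + (0 : K) *: (solve E).2 = E.1.
  by rewrite scale0r addr0 scalerA divff // scale1r.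
have solve2 E : c *: (solve E).1 + d *: (solve E).2 = E.2.
  by rewrite [X in _ + X]scalerA divff // scale1r addrC subrK.
have ord_solve n E : ordp 1 n E -> ordp 1 n (solve E).
  by move=> [h1 h2]; split; apply: ordZ => //; apply: ordB => //; do 2 apply: ordZ.
pose Y0 := solve idmap2.
pose A n (x : (fps2 K * fps2 K) * (fps2 K * fps2 K)) :=
  [/\ ordp 1 2 (x.1 - Y0), x.2 = 0 & ordp 1 n.+2 (Defs.comp X x.1 - idmap2)].
have hY0 : ordp 1 1 Y0 by apply: ord_solve; apply: ordp_id.
have near1 Y : ordp 1 2 (Y - Y0) -> ordp 1 1 Y.
  by move=> h; apply: ordp_near hY0; apply: ordpW h.
have A0 : A 0%N (Y0, 0).
  have t1 := subst2_ord2 hY0 hX.1; rewrite X01 solve1 in t1.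
  have t2 := subst2_ord2 hY0 hX.2; rewrite solve2 in t2.
  by split; [apply: ordp_refl | by [] | apply: ordp_sub; [apply: t1|apply: t2]].
have step n x : A n x -> exists2 y, A n.+1 y &
    ordp 1 n (y.1 - x.1) /\ ordp 1 n (y.2 - x.2).
  (* Newton correction with the derivative frozen at the origin: it cancels the error in degree n +
     2. The second slot of the pair is idle and stays 0. *)
  move=> [h0 x2 hE]; pose H := solve (idmap2 - Defs.comp X x.1).
  have hH : ordp 1 n.+2 H.
    by apply: ord_solve; rewrite -opprB; apply: ordpN.
  have hd : ordp 1 2 (x.1 + H - Y0) by apply: ordp_add h0 _; apply: ordpW hH.
  have hE' : ordp 1 n.+3 (Defs.comp X (x.1 + H) - idmap2).
    have t1 := taylor_linear (near1 _ h0) hH hX.1.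
    have t2 := taylor_linear (near1 _ h0) hH hX.2.
    rewrite X01 solve1 in t1; rewrite solve2 in t2.
    by apply: ordp_sub; [apply: ord_subB t1 | apply: ord_subB t2].
  exists (x.1 + H, 0); first exact: And3 hd erefl hE'.
  split; last by rewrite x2; apply: ordp_refl.
  by apply: ordp_addl; apply: ordpW hH; lia.
have [x hx] := adic_limit A0 step.
have hxY : ordp 1 2 (x.1 - Y0).
  by have [y [h _ _] [h' _]] := hx 2%N; apply: ordp_trans h' h.
have hx1 := near1 _ hxY; exists x.1.
  have e10 F G : ord 1 2 (F - G) -> coef F 1 0 = coef G 1 0 by move/ord_eq; apply.
  have e01 F G : ord 1 2 (F - G) -> coef F 0 1 = coef G 0 1 by move/ord_eq; apply.
  case: hxY => h1 h2; split=> //.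
  - by rewrite (e01 _ _ h1) cfZ /= mulr0.
  - by rewrite (e10 _ _ h1) cfZ /= mulr1 invr_eq0.
  - by rewrite (e01 _ _ h2) cfZ cfB !cfZ /= !mulr0 subr0 mulr1 invr_eq0.
have E n : ordp 1 n (Defs.comp X x.1 - idmap2).
  have [y [hy _ hE] [hxy _]] := hx n.+1.
  have hy1 := near1 _ hy.
  apply: (@ordp_trans _ _ _ (Defs.comp X y.1)); last by apply: ordpW hE; lia.
  have hxy' : ordp 1 n (x.1 - y.1) by apply: ordpW hxy.
  by case: hX => hX1 hX2; apply: ordp_sub; apply: subst2_congr.
exact: ordp_eq E.
Qed.

(** A right inverse [Y] is triangular, hence has a right inverse in its turn, and associativity
    identifies the latter with [X]. *)
Lemma triangular_inverse X : triangular X ->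
  exists Y, [/\ triangular Y, Defs.comp X Y = idmap2 & Defs.comp Y X = idmap2].
Proof.
move=> hX; have [Y hY XY] := right_inverse hX.
have [Z hZ YZ] := right_inverse hY.
have [hX1 _ _ _] := hX; have [hY1 _ _ _] := hY; have [hZ1 _ _ _] := hZ.
suff eZ : Z = X by exists Y; split; [exact: hY | exact: XY | rewrite -eZ].
by rewrite -[Z]id_fcomp // -XY -fcompA // YZ fcomp_id.
Qed.

Lemma coord_changeP X : coord_change X <->
  triangular X /\ forall j, coef X.1 0 j = 0.
Proof.
have detE : coef X.1 0 1 = 0 ->
    \det (linear_part X) = coef X.1 1 0 * coef X.2 0 1.
  move=> h; rewrite det_trig ?big_ord_recl ?big_ord0 ?mxE ?mulr1 //.
  apply/is_trig_mxP => i j; rewrite mxE.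
  by case: i j => [[|[|i]] hi] // [[|[|j]] hj].
split=> [[/no_constP hX hL [u hu]]|[[hX h01 h10 h2] h0]].
  have h0 j : coef X.1 0 j = 0 by rewrite hu coef_z1M.
  split=> //; move: hL; rewrite unitmxE unitfE detE ?h0 // mulf_eq0 negb_or.
  by case/andP.
split; first exact/no_constP.
  by rewrite unitmxE unitfE detE // mulf_neq0.
by exists (shift 1 X.1); apply: shift1K.
Qed.

(** Replaces the inverse by the intertwining relation F o X = X o G, the form in which conjugacy is
    solved and exploited below. *)
Lemma formally_conjugated_intro (F G X : fps2 K * fps2 K) : coord_change X ->
  ordp 1 1 F -> ordp 1 1 G -> Defs.comp F X = Defs.comp X G ->
  formally_conjugated F G.
Proof.
move=> hX hF hG e; have [hT _] := (coord_changeP X).1 hX.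
have [Y [hY XY YX]] := triangular_inverse hT.
have [hX1 _ _ _] := hT; have [hY1 _ _ _] := hY.
have YFX : Defs.comp Y (Defs.comp F X) = G 
  by rewrite e fcompA; [rewrite YX; exact: id_fcomp | exact: hX1 | exact: hG].
exists X, Y; split; [exact: hX | split | exact: YFX].
- exact/no_constP.
- exact: XY.
- exact: YX.
Qed.

Lemma formally_conjugated_elim (F G : fps2 K * fps2 K) : ordp 1 1 F ->
  formally_conjugated F G ->
  ordp 1 1 G /\ exists2 X, coord_change X & Defs.comp F X = Defs.comp X G.
Proof.
move=> hF [X [Y [hX [/no_constP hY XY YX] <-]]].
have [[hX1 _ _ _] _] := (coord_changeP X).1 hX.
split; first by apply: ordp_fcomp => //; apply: ordp_fcomp.
exists X; first exact: hX.
have hFX := ordp_fcomp hX1 hF.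
by rewrite (fcompA X hY hFX) XY (id_fcomp hFX).
Qed.

Lemma coord_change_comp X Y : coord_change X -> coord_change Y ->
  coord_change (Defs.comp X Y).
Proof.
move=> /coord_changeP [[hX X01 X10 X2] X0] /coord_changeP [[hY Y01 Y10 Y2] Y0].
have [hX1 hX2] := hX.
apply/coord_changeP; split.
  split; first exact: ordp_fcomp.
  - by rewrite [LHS]coef_subst2_01 ?X01 ?Y01 ?mulr0 ?mul0r ?addr0.
  - by rewrite [X in X != _]coef_subst2_10 ?X01 ?mul0r ?addr0 ?mulf_neq0.
  - by rewrite [X in X != _]coef_subst2_01 ?Y01 ?mulr0 ?add0r ?mulf_neq0.
move=> j; rewrite -[(Defs.comp X Y).1]/(subst2 X.1 Y) [X.1]shift1K //.
by rewrite subst2M // subst2_z1 // [Y.1]shift1K // -mulrA coef_z1M.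
Qed.

Lemma formally_conjugated_trans (F G H : fps2 K * fps2 K) : ordp 1 1 F ->
  formally_conjugated F G -> formally_conjugated G H -> formally_conjugated F H.
Proof.
move=> hF /(formally_conjugated_elim hF) [hG [X hX eX]].
move=> /(formally_conjugated_elim hG) [hH [Y hY eY]].
have [[hX1 _ _ _] _] := (coord_changeP X).1 hX.
have [[hY1 _ _ _] _] := (coord_changeP Y).1 hY.
apply: (formally_conjugated_intro (coord_change_comp hX hY) hF hH).
exact: conjugation_trans hX1 hY1 hG hH eX eY.
Qed.

End Inverse.

(** * The homological operator *)

Section Perturbation.
Variable K : comNzRingType.
Variable nu : nat.
Hypothesis nu_gt0 : (0 < nu)%N.
Implicit Types (F G H : fps2 K) (X Y Z q Q p : fps2 K * fps2 K).

Definition germ q : fps2 K * fps2 K :=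
  (z1 + z1 ^+ nu * q.1, z2 + z1 ^+ nu * q.2).

Lemma ord_z1XM w m F : ord w m F -> ord w (nu + m) (z1 ^+ nu * F).
Proof. by move=> h; apply: ordM => //; apply: ord_z1X. Qed.

Lemma ordp_germ q : ordp 1 1 (germ q).
Proof.
have h F : ord 1 1 (z1 ^+ nu * F) by apply: ordMr; apply: ordW (@ord_z1X _ 1 nu).
by split; apply: ordD; rewrite ?h //; [apply: ord_z1 | apply: ord_z2].
Qed.

Lemma germ0 q : germ q = idmap2 + (z1 ^+ nu * q.1, z1 ^+ nu * q.2).
Proof. by []. Qed.

Lemma germD q Q : germ (q + Q) = germ q + (z1 ^+ nu * Q.1, z1 ^+ nu * Q.2).
Proof. by rewrite /germ /= !mulrDr !addrA. Qed.

(** Variation of chi o fhat, where [F] is one component of chi. Three errors add up: [F] displaced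
    along z_1^nu Q ([e1]), [H] displaced along z_1^nu (q + Q) ([e2]), and q + Q replaced by p in the
    derivative of [H] ([e3]). *)
Lemma left_perturbation m q Q p F H : ordp 1 1 q -> ordp 1 m.+2 Q ->
  ordp 1 2 (q - p) -> ord 1 1 F -> ord 1 m.+2 H ->
  ord 1 (nu + m.+3) (subst2 (F + H) (germ (q + Q)) - subst2 F (germ q) - H
    - z1 ^+ nu * (coef F 1 0 *: Q.1 + coef F 0 1 *: Q.2
                  + (d1 H * p.1 + d2 H * p.2))).
Proof.
move=> [hq1 hq2] [hQ1 hQ2] [hqp1 hqp2] hF hH.
pose Y := (z1 ^+ nu * Q.1, z1 ^+ nu * Q.2).
pose s := q + Q; pose Y' := (z1 ^+ nu * s.1, z1 ^+ nu * s.2).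
have hY : ordp 1 (nu + m.+2) Y by split; apply: ord_z1XM.
have hs1 : ord 1 1 s.1 by apply: ordD => //; apply: ordW hQ1.
have hs2 : ord 1 1 s.2 by apply: ordD => //; apply: ordW hQ2.
have hY' : ordp 1 (1 + nu) Y' by rewrite addnC; split; apply: ord_z1XM.
have e1 : ord 1 (nu + m.+3) (subst2 F (germ q + Y) - subst2 F (germ q)
    - (coef F 1 0 *: Y.1 + coef F 0 1 *: Y.2)).
  have := @taylor_linear _ (nu + m) (germ q) Y F (ordp_germ q).
  by rewrite -!addnS; apply.
have e2 : ord 1 (nu + m.+3) (subst2 H (idmap2 + Y') - subst2 H idmap2
    - (subst2 (d1 H) idmap2 * Y'.1 + subst2 (d2 H) idmap2 * Y'.2)).
  have hY1 : ordp 1 1 Y' by apply: ordpW hY'.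
  have := taylor2 (ordp_id K) hY1 (ordp_id K) hY' hH.
  by apply: ordW; lia.
have e3 : ord 1 (nu + m.+3) (z1 ^+ nu * (d1 H * (s.1 - p.1) + d2 H * (s.2 - p.2))).
  have h1 : ord 1 2 (s.1 - p.1).
    rewrite /s addrAC; apply: ordD => //.
    by apply: ordW hQ1.
  have h2 : ord 1 2 (s.2 - p.2).
    rewrite /s addrAC; apply: ordD => //.
    by apply: ordW hQ2.
  apply: ord_z1XM; rewrite -[m.+3](addn2 m.+1).
  by apply: ordD; apply: ordM => //; [apply: d1_ord | apply: d2_ord].
rewrite !subst2_id -germ0 in e2; rewrite -germD in e1.
have -> : subst2 (F + H) (germ (q + Q)) - subst2 F (germ q) - H
    - z1 ^+ nu * (coef F 1 0 *: Q.1 + coef F 0 1 *: Q.2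
                  + (d1 H * p.1 + d2 H * p.2)) =
  (subst2 F (germ (q + Q)) - subst2 F (germ q)
    - (coef F 1 0 *: Y.1 + coef F 0 1 *: Y.2))
  + (subst2 H (germ s) - H - (d1 H * Y'.1 + d2 H * Y'.2))
  + z1 ^+ nu * (d1 H * (s.1 - p.1) + d2 H * (s.2 - p.2)).
  rewrite subst2D /Y /Y' -/s /fst /snd -/(fst s) -/(snd s) !scalerAr.
  by ring.
by apply: ordD => //; apply: ordD.
Qed.

Lemma expr_unit_ord n u : ord 1 1 (u - 1) -> ord 1 1 (u ^+ n - 1 : fps2 K).
Proof.
move=> h; elim: n => [|n IH]; first by rewrite expr0 subrr; apply: ord_zero.
have -> : u ^+ n.+1 - 1 = u * (u ^+ n - 1) + (u - 1) by rewrite exprS; ring.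
by apply: ordD => //; apply: ordMl.
Qed.

Lemma expr_perturbation n m u h : ord 1 1 (u - 1) -> ord 1 m.+1 h ->
  ord 1 m.+2 ((u + h) ^+ n - u ^+ n - n%:R * h : fps2 K).
Proof.
move=> hu hh; elim: n => [|n IH].
  by rewrite !expr0 subrr mul0r subrr; apply: ord_zero.
have -> : (u + h) ^+ n.+1 - u ^+ n.+1 - n.+1%:R * h =
  (u + h) * ((u + h) ^+ n - u ^+ n - n%:R * h) + h * (u ^+ n - 1)
  + n%:R * (h * (u + h - 1)).
  by rewrite !exprS -[n.+1]addn1 natrD; ring.
rewrite -[m.+2]addn1 in IH *.
apply: ordD; first (apply: ordD; first exact: ordMl).
  by apply: ordM => //; apply: expr_unit_ord.
apply: ordMl; apply: ordM => //; rewrite addrAC; apply: ordD => //.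
by apply: ordW hh.
Qed.

(** Variation of the term X_1^nu f(X) of f o chi. Writing X_1 = z_1 u with u(O) = 1 and H_1 = z_1 h,
    the power z_1^nu (u + h)^nu varies by nu h z_1^nu to first order: this is the source of the term
    nu (H_1 / z_1) p. *)
Lemma right_perturbation m X (H : fps2 K * fps2 K) f V : ordp 1 2 (X - idmap2) ->
  (forall j, coef X.1 0 j = 0) -> ordp 1 m.+2 H -> (forall j, coef H.1 0 j = 0) ->
  ord 1 1 f -> V = coef f 1 0 *: z1 + coef f 0 1 *: z2 ->
  ordp 1 1 X ->
  ord 1 (nu + m.+3)
    ((X + H).1 ^+ nu * subst2 f (X + H) - X.1 ^+ nu * subst2 f X
     - z1 ^+ nu * (coef f 1 0 *: H.1 + coef f 0 1 *: H.2
                   + nu%:R * (shift 1 H.1 * V))).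
Proof.
move=> hX X0 hH H0 hf hV hX1.
set u := shift 1 X.1; set h := shift 1 H.1.
have eX : X.1 = z1 * u by apply: shift1K.
have eH : H.1 = z1 * h by apply: shift1K.
have hh : ord 1 m.+1 h by apply: ord_shift; case: hH.
have hu : ord 1 1 (u - 1).
  move=> i j; rewrite mul1n => hij; have [-> ->] : i = 0%N /\ j = 0%N by lia.
  have [h1 _] := hX; have := @ord_eq _ 1 2 _ _ h1 1%N 0%N isT.
  by rewrite cfB /u /= => ->; rewrite subrr.
set g := subst2 f X; set g' := subst2 f (X + H).
set P := coef f 1 0 *: H.1 + coef f 0 1 *: H.2.
have hP : ord 1 m.+2 P by case: hH => h1 h2; apply: ordD; apply: ordZ.
have hg' : ord 1 m.+3 (g' - g - P) by apply: taylor_linear.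
have hXH : ordp 1 1 (X + H) by apply: ordpD => //; apply: ordpW hH.
have hg1 : ord 1 1 g' by apply: ord_subst2.
have hV' : ord 1 2 (g' - V).
  apply: (@ord_trans _ _ _ (subst2 f idmap2)); last first.
    by rewrite subst2_id hV; apply: ord_linear_part.
  apply: subst2_congr => //; first exact: ordp_id.
  by rewrite addrAC; apply: ordpD => //; apply: ordpW hH.
have -> : (X + H).1 = z1 * (u + h) by rewrite mulrDr -eX -eH.
rewrite eX !exprMn.
have -> : z1 ^+ nu * (u + h) ^+ nu * g' - z1 ^+ nu * u ^+ nu * g
    - z1 ^+ nu * (P + nu%:R * (h * V)) =
  z1 ^+ nu * (((u + h) ^+ nu - u ^+ nu - nu%:R * h) * g'
     + u ^+ nu * (g' - g - P) + (u ^+ nu - 1) * P + nu%:R * (h * (g' - V))).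
  by ring.
apply: ord_z1XM; apply: ordD; last first.
  by apply: ordMl; rewrite -[m.+3](addn2 m.+1); apply: ordM.
apply: ordD; last by rewrite -[m.+3](add1n m.+2); apply: ordM => //; apply:
  expr_unit_ord.
apply: ordD; last exact: ordMl.
rewrite -[m.+3](addn1 m.+2); apply: ordM => //.
exact: expr_perturbation.
Qed.

Definition residual Fo X q := Defs.comp X (germ q) - Defs.comp (germ Fo) X.

(* With p the linear part of F^o, this is the first-order variation of the
   residual, divided by z_1^nu, under X -> X + H and q -> q + Q, minus Q. *)
Definition homological p (H : fps2 K * fps2 K) : fps2 K * fps2 K :=
  (d1 H.1 * p.1 + d2 H.1 * p.2
     - (coef p.1 1 0 *: H.1 + coef p.1 0 1 *: H.2
        + nu%:R * (shift 1 H.1 * p.1)),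
   d1 H.2 * p.1 + d2 H.2 * p.2
     - (coef p.2 1 0 *: H.1 + coef p.2 0 1 *: H.2
        + nu%:R * (shift 1 H.1 * p.2))).

Definition linearize Fo : fps2 K * fps2 K :=
  (coef Fo.1 1 0 *: z1 + coef Fo.1 0 1 *: z2,
   coef Fo.2 1 0 *: z1 + coef Fo.2 0 1 *: z2).

Lemma coef_linear_10 (a b : K) : coef (a *: z1 + b *: z2) 1 0 = a.
Proof. by rewrite cfD !cfZ /= mulr1 mulr0 addr0. Qed.

Lemma coef_linear_01 (a b : K) : coef (a *: z1 + b *: z2) 0 1 = b.
Proof. by rewrite cfD !cfZ /= mulr1 mulr0 add0r. Qed.

Lemma ordp_linearize Fo : ordp 1 1 Fo -> ordp 1 2 (Fo - linearize Fo).
Proof. by move=> [h1 h2]; split; apply: ord_linear_part. Qed.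

Lemma ord_germ_comp f X w : ordp 1 1 X ->
  subst2 (w + z1 ^+ nu * f) X = subst2 w X + X.1 ^+ nu * subst2 f X.
Proof. by move=> hX; rewrite subst2D subst2M // subst2X // subst2_z1. Qed.

Lemma comp_germ Fo X : ordp 1 1 X -> Defs.comp (germ Fo) X =
  (X.1 + X.1 ^+ nu * subst2 Fo.1 X, X.2 + X.1 ^+ nu * subst2 Fo.2 X).
Proof.
by move=> hX; rewrite /Defs.comp !ord_germ_comp // subst2_z1 // subst2_z2.
Qed.

(** [germ q] is the identity modulo z_1^nu, and X_1^nu is a multiple of z_1^nu because z_1 divides
    X_1. This legitimates dividing the residual by z_1^nu. *)
Lemma residual_divisible (Fo X q : fps2 K * fps2 K) : ordp 1 1 X -> (forall j,
  coef X.1 0 j = 0) ->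
  ordp 1 1 q -> ordp 0 nu (residual Fo X q).
Proof.
move=> hX X0 hq; rewrite /residual comp_germ //.
have h0 F : ord 0 nu (z1 ^+ nu * F) by apply: ordMr; apply: ord_z1X.
have hl F : ord 0 nu (subst2 F (germ q) - F).
  rewrite -{2}[F]subst2_id germ0.
  have hY : ordp 1 1 (z1 ^+ nu * q.1, z1 ^+ nu * q.2).
    by case: hq => h1 h2; split; apply: ordMl.
  (* Weight 0: the Taylor estimate is read as divisibility by z_1^nu. *)
  by apply: (@taylor1 _ 0 0 nu 0 _ _ F (ordp_id K) hY); [split | split; apply:
    h0 | ].
have hr F : ord 0 nu (X.1 ^+ nu * F).
  by rewrite [X.1]shift1K // exprMn -mulrA; apply: h0.
split; rewrite /= opprD addrA; apply: ordB => //; exact: hl.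
Qed.

Lemma ord_collect n (A E T S : fps2 K) : ord 0 nu A -> ord 1 n E ->
  S = shift nu A -> ord 1 n (z1 ^+ nu * (S + T)) -> ord 1 n (A + E + z1 ^+ nu * T).
Proof.
move=> /shiftK eA hE -> hT; rewrite {1}eA addrAC -mulrDr; exact: ordD.
Qed.

Lemma ord_sub2 w n (A B C D : fps2 K) : ord w n (A - C) -> ord w n (B - D) ->
  ord w n (A - B - (C - D)).
Proof. by move=> h h'; have := ordB h h'; congr (ord w n _); ring. Qed.

Lemma residual_congr n (Fo X Y q Q : fps2 K * fps2 K) : ordp 1 1 X -> ordp 1 1 Y ->
  ordp 1 n (X - Y) -> ordp 1 n (q - Q) -> 
  ordp 1 n (residual Fo X q - residual Fo Y Q).
Proof.
move=> hX hY hXY [hq1 hq2].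
have hg : ordp 1 n (germ q - germ Q).
  split; rewrite /= opprD addrACA subrr add0r -mulrBr; apply: ordW (ord_z1XM
    _); try eassumption; lia.
have [hG1 hG2] := ordp_germ Fo.
have [hXY1 hXY2] := hXY.
have cl (F G : fps2 K) : ord 1 n (F - G) -> ord 1 1 F -> 
    ord 1 n (subst2 F (germ q) - subst2 G (germ Q)).
  move=> hFG hF; apply: (@ord_trans _ _ _ (subst2 F (germ Q))).
    by apply: subst2_congr => //; apply: ordp_germ.
  by rewrite -subst2B; apply: ord_subst2 => //; apply: ordp_germ.
have hs := subst2_congr hX hY hXY.
case: hX => hX1 hX2; split.
  exact: ord_sub2 (cl _ _ hXY1 hX1) (hs _ hG1).
exact: ord_sub2 (cl _ _ hXY2 hX2) (hs _ hG2).
Qed.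

Lemma ord_combine n (A B C D E H P Q x Z : fps2 K) : ord 1 n (A - B - H - Z *
  (Q + D)) ->
  ord 1 n (C - E - Z * P) ->
  ord 1 n (A - (x + H + C) - (B - (x + E)) - Z * (Q + (D - P))).
Proof. by move=> h1 h2; have := ordB h1 h2; congr (ord 1 n _); ring. Qed.

Lemma residual_perturbation m Fo X q (H Q : fps2 K * fps2 K) :
  ordp 1 1 Fo -> ordp 1 2 (X - idmap2) -> (forall j, coef X.1 0 j = 0) ->
  ordp 1 2 (q - linearize Fo) -> ordp 1 m.+2 H -> (forall j, coef H.1 0 j = 0) ->
  ordp 1 m.+2 Q ->
  exists2 E, ordp 1 (nu + m.+3) E &
    residual Fo (X + H) (q + Q) = residual Fo X q + E +
     (z1 ^+ nu * (Q + homological (linearize Fo) H).1,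
      z1 ^+ nu * (Q + homological (linearize Fo) H).2).
Proof.
move=> hF hX X0 hq hH H0 hQ; set p := linearize Fo.
have hX1 : ordp 1 1 X by apply: ordp_near (ordp_id K); apply: ordpW hX.
have hXH : ordp 1 1 (X + H) by apply: ordpD => //; apply: ordpW hH.
have hp : ordp 1 1 p.
  by split; apply: ordD; apply: ordZ; [exact: ord_z1|exact: ord_z2|exact:
    ord_z1|exact: ord_z2].
have hq1 : ordp 1 1 q by apply: ordp_near hp; apply: ordpW hq.
have [hX11 hX12] := hX1; have [hH1 hH2] := hH; have [hF1 hF2] := hF.
have [hXi1 hXi2] := hX.
have l1 := left_perturbation hq1 hQ hq hX11 hH1.
have l2 := left_perturbation hq1 hQ hq hX12 hH2.
have r1 := right_perturbation hX X0 hH H0 hF1 erefl hX1.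
have r2 := right_perturbation hX X0 hH H0 hF2 erefl hX1.
rewrite (ord_eq hXi1 (isT : (1 + 1 * 0 < 2)%N)) (ord_eq hXi1 (isT : (0 + 1 * 1
  < 2)%N)) in l1.
rewrite (ord_eq hXi2 (isT : (1 + 1 * 0 < 2)%N)) (ord_eq hXi2 (isT : (0 + 1 * 1
  < 2)%N)) in l2.
rewrite /= scale1r scale0r addr0 in l1; rewrite /= scale1r scale0r add0r in l2.
exists (residual Fo (X + H) (q + Q) - residual Fo X q -
     (z1 ^+ nu * (Q + homological (linearize Fo) H).1,
      z1 ^+ nu * (Q + homological (linearize Fo) H).2)); last first.
  by move: (residual _ (X + H) _) (residual _ X q) (_, _) => A B C;
    rewrite -addrA subrK addrC subrK.
rewrite /residual !comp_germ //; split.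
  rewrite /homological /p /linearize /fst /snd !coef_linear_10 !coef_linear_01.
  exact: ord_combine l1 r1.
rewrite /homological /p /linearize /fst /snd !coef_linear_10 !coef_linear_01.
exact: ord_combine l2 r2.
Qed.

End Perturbation.

Section HomologicalOperator.
Variable K : comNzRingType.
Variables (nu : nat) (lam mu del : K).
Implicit Types (H : fps2 K * fps2 K).

Definition linear_field : fps2 K * fps2 K :=
  (lam *: z1 + 0 *: z2, mu *: z1 + del *: z2).

(** [hom1] and [hom2] give the coefficients of [homological] at [linear_field], so that solvability
    becomes a recurrence. The terms shifting (i, j) to (i - 1, j + 1) come from mu z_1 d/dz_2; in 1
    + nu, the 1 comes from p(H) and the nu from (H_1 / z_1) p; the shift to (i + 1, j - 1) comes
    from del z_2 (H_1 / z_1). *)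
Definition hom1 (h : nat -> nat -> K) i j : K :=
  (i%:R * lam + j%:R * del) * h i j
  + (if i is i'.+1 then mu * (j.+1%:R * h i' j.+1) else 0)
  - (1 + nu%:R) * (lam * h i j).

Definition hom2 (h1 h2 : nat -> nat -> K) i j : K :=
  (i%:R * lam + j%:R * del) * h2 i j
  + (if i is i'.+1 then mu * (j.+1%:R * h2 i' j.+1) else 0)
  - (mu * h1 i j + del * h2 i j)
  - nu%:R * (mu * h1 i j + (if j is j'.+1 then del * h1 i.+1 j' else 0)).

Lemma coef_euler F i j :
  coef (d1 F * linear_field.1 + d2 F * linear_field.2) i j =
  (i%:R * lam + j%:R * del) * coef F i j
  + (if i is i'.+1 then mu * (j.+1%:R * coef F i' j.+1) else 0).
Proof.
rewrite /linear_field /fst /snd scale0r addr0 mulrDr -!scalerAr.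
rewrite (mulrC (d1 F)) !(mulrC (d2 F)) !cfD !cfZ !coef_z1M coef_z2M.
by case: i j => [|i] [|j]; rewrite ?cf_d1 ?cf_d2 /=; ring.
Qed.

Lemma coef_homological1 H i j : (forall j, coef H.1 0 j = 0) ->
  coef (homological nu linear_field H).1 i j = hom1 (coef H.1) i j.
Proof.
move=> H0; rewrite /homological /fst -/(fst H) -/(fst linear_field) cfB coef_euler.
rewrite /linear_field /fst -/(fst H) coef_linear_10 coef_linear_01 !scale0r !addr0.
rewrite cfD cfZ cf_natM -scalerAr cfZ (mulrC (shift _ _)) coef_z1M /hom1.
case: i => [|i]; first by rewrite H0; ring.
by rewrite /shift /= addn1; ring.
Qed.

Lemma coef_homological2 H i j : (forall j, coef H.1 0 j = 0) ->
  coef (homological nu linear_field H).2 i j = hom2 (coef H.1) (coef H.2) i j.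
Proof.
move=> H0; rewrite /homological /snd -/(snd H) -/(snd linear_field) cfB coef_euler.
rewrite /linear_field /snd -/(snd H) coef_linear_10 coef_linear_01.
rewrite cfD cfD !cfZ cf_natM mulrDr -!scalerAr cfD !cfZ !(mulrC (shift _ _)).
rewrite coef_z1M coef_z2M /hom2.
case: i => [|i]; first by rewrite H0; case: j => [|j]; rewrite /shift /=
  ?add0n; ring.
by case: j => [|j]; rewrite /shift /= ?addn1; ring.
Qed.

End HomologicalOperator.

(** * Normalization degree by degree *)

Section Normalization.
Variable K : fieldType.
Variables (nu : nat) (lam mu del : K).
Hypothesis nu_gt0 : (0 < nu)%N.
Variables N1 N2 : nat -> nat -> bool.

(* N1 and N2 are the monomials allowed in the two components of a normal form:
   the other monomials can be eliminated in every degree m >= 2. *)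
Definition solvable := forall m, (2 <= m)%N -> forall r1 r2 : nat -> nat -> K,
  exists h1 h2 : nat -> nat -> K, (forall j, h1 0%N j = 0) /\
    forall i j, (i + j)%N = m ->
      (~~ N1 i j -> hom1 nu lam mu del h1 i j = r1 i j) /\
      (~~ N2 i j -> hom2 nu lam mu del h1 h2 i j = r2 i j).

Let supported (q : fps2 K * fps2 K) := forall i j, (2 <= i + j)%N ->
  (~~ N1 i j -> coef q.1 i j = 0) /\ (~~ N2 i j -> coef q.2 i j = 0).

Let homog m (h : nat -> nat -> K) := FPS2 (fun i j => if (i + j)%N == m then h
  i j else 0).

Let coef_homog m h i j :
  coef (homog m h) i j = if (i + j)%N == m then h i j else 0.
Proof. by []. Qed.

Lemma ord_homog m h : ord 1 m (homog m h).
Proof. by move=> i j hij /=; case: eqP => // e; move: hij; rewrite -e; lia. Qed.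

Theorem normalization (Fo : fps2 K * fps2 K) : ordp 1 1 Fo -> linearize Fo =
  linear_field lam mu del ->
  solvable ->
  exists q, [/\ formally_conjugated (germ nu Fo) (germ nu q),
    ordp 1 1 q, ordp 1 2 (q - Fo) & supported q].
Proof.
move=> hF hL solve.
pose p := linearize Fo.
have hp : ordp 1 1 p.
  by split; apply: ordD; apply: ordZ; [exact: ord_z1|exact: ord_z2|exact:
    ord_z1|exact: ord_z2].
(* Invariant of the construction. The nu in the order of the residual stands for the factor z_1^nu;
   the start is the identity with the linear part [p], for which the residual has order nu + 2. *)
pose A n (x : (fps2 K * fps2 K) * (fps2 K * fps2 K)) :=
  [/\ ordp 1 2 (x.1 - idmap2), forall j, coef x.1.1 0 j = 0, ordp 1 2 (x.2 - p),
      supported x.2 & ordp 1 (nu + n.+2) (residual nu Fo x.1 x.2)].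
have near_id (X : fps2 K * fps2 K) : ordp 1 2 (X - idmap2) -> ordp 1 1 X.
  by move=> h; apply: ordp_near (ordp_id K); apply: ordpW h.
have near_p (q : fps2 K * fps2 K) : ordp 1 2 (q - p) -> ordp 1 1 q.
  by move=> h; apply: ordp_near hp; apply: ordpW h.
have A0 : A 0%N (idmap2, p).
  split; [exact: ordp_refl| by [] |exact: ordp_refl| | ].
    by move=> i j hij; split=> _; rewrite cfD !cfZ;
      case: i j hij => [|[|i]] [|[|j]] //= _; rewrite !mulr0 addr0.
  have hres F G : ord 1 2 (F - G) -> ord 1 (nu + 2) (z1 ^+ nu * F - z1 ^+ nu *
    G : fps2 K).
    by rewrite -mulrBr; apply: ord_z1XM.
  rewrite /residual fcomp_id id_fcomp; last exact: ordp_germ.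
  have [h1 h2] := ordp_sym (ordp_linearize hF).
  by split; rewrite /= opprD addrACA subrr add0r; apply: hres.
have step n x : A n x -> exists2 y, A n.+1 y &
    ordp 1 n (y.1 - x.1) /\ ordp 1 n (y.2 - x.2).
  move: x => [X q] [/= hX X0 hq hs hR].
  have [R01 R02] := residual_divisible nu Fo (near_id _ hX) X0 (near_p _ hq).
  (* The residual divided by z_1^nu, an exact quotient by [residual_divisible]. *)
  pose S := (shift nu (residual nu Fo X q).1, shift nu (residual nu Fo X q).2).
  have hS : ordp 1 n.+2 S by case: hR => h1 h2; split; apply: ord_shift.
  have [h1 [h2 [h10 hh]]] := solve n.+2 isT (fun i j => - coef S.1 i j)
    (fun i j => - coef S.2 i j).
  pose H := (homog n.+2 h1, homog n.+2 h2).
  have hH : ordp 1 n.+2 H by split; apply: ord_homog.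
  have H0 j : coef H.1 0 j = 0 by rewrite /= h10 if_same.
  pose D := homological nu p H.
  (* [Q] absorbs what [H] leaves of the residual in degree n + 2; by the choice of [H] only allowed
     monomials remain, so the support condition persists. *)
  pose Q := (homog n.+2 (fun i j => - coef S.1 i j - coef D.1 i j),
             homog n.+2 (fun i j => - coef S.2 i j - coef D.2 i j)).
  have hQ : ordp 1 n.+2 Q by split; apply: ord_homog.
  have [E hE eE] := residual_perturbation nu_gt0 hF hX X0 hq hH H0 hQ.
  have e1 i j : (i + j)%N = n.+2 ->
      hom1 nu lam mu del (coef H.1) i j = hom1 nu lam mu del h1 i j.
    move=> hij; rewrite /hom1 /= hij eqxx; case: i hij => [|i] // hij.
    by rewrite addnS -addSn hij eqxx.
  have e2 i j : (i + j)%N = n.+2 -> hom2 nu lam mu del (coef H.1) (coef H.2) i j =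
      hom2 nu lam mu del h1 h2 i j.
    move=> hij; rewrite /hom2 /= hij eqxx; congr (_ + _ - _ - _ * (_ + _)).
      by case: i hij => [|i] // hij; rewrite addnS -addSn hij eqxx.
    by case: j hij => [|j] // hij; rewrite addSn -addnS hij eqxx.
  have hD i j : (i + j < n.+2)%N -> coef D.1 i j = 0 /\ coef D.2 i j = 0.
    have z k l : (k + l < n.+2)%N || (n.+2 < k + l)%N -> coef H.1 k l = 0 /\
      coef H.2 k l = 0.
      by rewrite /= -neq_ltn => /negbTE ->.
    move=> hij; rewrite /D /p hL coef_homological1 // coef_homological2 //
      /hom1 /hom2.
    have [-> ->] := z i j ltac:(by rewrite hij).
    case: i j hij => [|i] [|j] hij; rewrite ?(mulr0, addr0, subr0) //.
    - by have [-> _] := z 1%N j ltac:(lia); rewrite ?(mulr0, addr0, subr0).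
    - by have [-> ->] := z i 1%N ltac:(lia); rewrite ?(mulr0, addr0, subr0).
    - have [-> ->] := z i j.+2 ltac:(lia); have [-> _] := z i.+2 j ltac:(lia).
      by rewrite ?(mulr0, addr0, subr0).
  exists (X + H, q + Q); last by split; apply: ordp_addl; [apply: ordpW
    hH|apply: ordpW hQ]; lia.
  have D1 i j : (i + j)%N = n.+2 -> ~~ N1 i j -> coef D.1 i j = - coef S.1 i j.
    by move=> hij hN; rewrite /D /p hL coef_homological1 // e1 //; case: (hh i
      j hij) => ->.
  have D2 i j : (i + j)%N = n.+2 -> ~~ N2 i j -> coef D.2 i j = - coef S.2 i j.
    by move=> hij hN; rewrite /D /p hL coef_homological2 // e2 //; case: (hh i
      j hij) => _ ->.
  have coefQ i j : (i + j)%N = n.+2 ->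
      coef Q.1 i j = - coef S.1 i j - coef D.1 i j /\
      coef Q.2 i j = - coef S.2 i j - coef D.2 i j.
    by move=> e; rewrite /Q /fst /snd !coef_homog e eqxx.
  have [S01 S02] := hS.
  have hT1 : ord 1 n.+3 (S.1 + (Q.1 + D.1)).
    move=> i j; rewrite mul1n ltnS leq_eqVlt cfD cfD => /orP[/eqP hij|hij].
      by have [-> _] := coefQ i j hij; rewrite subrK subrr.
    have [-> _] := hD i j hij; rewrite S01 ?mul1n // add0r addr0.
    by rewrite coef_homog (ltn_eqF hij).
  have hT2 : ord 1 n.+3 (S.2 + (Q.2 + D.2)).
    move=> i j; rewrite mul1n ltnS leq_eqVlt cfD cfD => /orP[/eqP hij|hij].
      by have [_ ->] := coefQ i j hij; rewrite subrK subrr.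
    have [_ ->] := hD i j hij; rewrite S02 ?mul1n // add0r addr0.
    by rewrite coef_homog (ltn_eqF hij).
  have hR' : ordp 1 (nu + n.+3) (residual nu Fo (X + H) (q + Q)).
    rewrite eE; case: hE => E1 E2; split.
      by apply: (ord_collect R01 E1 erefl); apply: ord_z1XM.
    by apply: (ord_collect R02 E2 erefl); apply: ord_z1XM.
  split; [| | | | exact: hR'].
  - by apply: ordp_add hX _; apply: ordpW hH.
  - by move=> j; rewrite /fst cfD X0 H0 addr0.
  - by apply: ordp_add hq _; apply: ordpW hQ.
  - move=> i j hij; have [s1 s2] := hs i j hij.
    rewrite /fst /snd !cfD; have [e|/negbTE ne] := eqVneq (i + j)%N n.+2.
      have [-> ->] := coefQ i j e.
      split=> hN; first by rewrite s1 // add0r D1 // opprK addNr.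
      by rewrite s2 // add0r D2 // opprK addNr.
    by rewrite !coef_homog ne !addr0.
have [[X q] hx] := adic_limit A0 step.
have cl n : exists X' q', [/\ A n (X', q'), ordp 1 n (X - X') & ordp 1 n (q - q')].
  by have [[X' q'] hA [h1 h2]] := hx n; exists X', q'.
have [X' [q' [[/= hX' _ hq' _ _] XX' qq']]] := cl 2%N.
have hX : ordp 1 2 (X - idmap2) := ordp_trans XX' hX'.
have hq : ordp 1 2 (q - p) := ordp_trans qq' hq'.
have hX1 := near_id _ hX; have hq1 := near_p _ hq.
have X0 j : coef X.1 0 j = 0.
  have [X2 [q2 [[/= _ h _ _ _] [XX2 _] _]]] := cl j.+1.
  by rewrite (ord_eq XX2) // mul1n add0n.
have hs : supported q.
  move=> i j hij; have [X2 [q2 [[/= _ _ _ h _] _ [h1 h2]]]] := cl (i + j).+1.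
  by rewrite (ord_eq h1) ?mul1n // (ord_eq h2) ?mul1n //; apply: h.
exists q; split=> //; last first.
  by apply: (ordp_trans hq); apply: ordp_sym; apply: ordp_linearize.
apply: (@formally_conjugated_intro _ _ _ X).
- apply/coord_changeP; split=> //; case: hX => h1 h2; split=> //.
  + by rewrite (ord_eq h1) /= ?oner_neq0.
  + by rewrite (ord_eq h2) /= ?oner_neq0.
- exact: ordp_germ.
- exact: ordp_germ.
(* The residual depends continuously on both maps, so it vanishes to every order at the limit. *)
have R0 n : ordp 1 n (residual nu Fo X q).
  have [X2 [q2 [[/= h2 _ h3 _ h] XX2 qq2]]] := cl n.+1.
  have hX2 := near_id _ h2.
  apply: (@ordp_near _ _ _ _ (residual nu Fo X2 q2)); last by apply: ordpW h; lia.
  by apply: ordpW (residual_congr nu_gt0 Fo hX1 hX2 XX2 qq2).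
by apply: esym; apply: ordp_eq => n; apply: R0.
Qed.

End Normalization.

(** * Conjugacy invariants *)

Section LowOrder.
Variable K : comNzRingType.
Implicit Types (F G u : fps2 K) (X Y q Fo : fps2 K * fps2 K).

Lemma coefM_00 F G : coef (F * G) 0 0 = coef F 0 0 * coef G 0 0.
Proof. by rewrite cfM !big_ord1. Qed.

Lemma coefX_00 n F : coef (F ^+ n) 0 0 = coef F 0 0 ^+ n.
Proof. by elim: n => [|n IH]; rewrite ?expr0 // !exprS coefM_00 IH. Qed.

Lemma coefM_10 F G : ord 1 1 G -> coef (F * G) 1 0 = coef F 0 0 * coef G 1 0.
Proof.
move=> hG; rewrite cfM !big_ord_recl !big_ord0 !addr0 /= /bump /= subnn subn0.
by rewrite [coef G 0 0]hG // mulr0 addr0.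
Qed.

Lemma coefM_01 F G : ord 1 1 G -> coef (F * G) 0 1 = coef F 0 0 * coef G 0 1.
Proof.
move=> hG; rewrite cfM !big_ord_recl !big_ord0 !addr0 /= /bump /= subnn subn0.
by rewrite [coef G 0 0]hG // mulr0 addr0.
Qed.

Lemma taylor_germ w nu F q : (0 < nu)%N -> (w <= 1)%N -> ordp w w q -> ord 1 1 F ->
  ordp 1 1 q ->
  ord w (w + 2 * nu)
    (subst2 F (germ nu q) - F - z1 ^+ nu * (d1 F * q.1 + d2 F * q.2)).
Proof.
move=> nu_gt0 w1 hq hF hq1; pose Y := (z1 ^+ nu * q.1, z1 ^+ nu * q.2).
have hY : ordp 1 1 Y by case: hq1 => h1 h2; split; apply: ordMl.
have hYw : ordp w (w + nu) Y.
  by case: hq => h1 h2; rewrite addnC; split; apply: ord_z1XM.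
have hid : ordp w w (@idmap2 K).
  by split=> i j /=; case: eqP => //= ->; case: eqP => //= ->; lia.
have := taylor2 (ordp_id K) hY hid hYw hF; rewrite -germ0 !subst2_id.
by rewrite mul1n; congr ord; rewrite /Y /=; ring.
Qed.

(** The conjugacy equation to first order in z_1^nu, divided by z_1^nu. Weight 1 retains the linear
    parts, weight 0 the equation modulo z_1^nu; both invariants, the family and tangentiality, come
    from this one estimate. *)
Lemma conjugation_quotient w nu Fo q X : (0 < nu)%N -> (w <= 1)%N -> ordp w w q ->
  ordp 1 1 Fo -> ordp 1 1 q -> ordp 1 1 X -> (forall j, coef X.1 0 j = 0) ->
  Defs.comp (germ nu Fo) X = Defs.comp X (germ nu q) ->
  ord w (w + nu) (d1 X.1 * q.1 + d2 X.1 * q.2 - shift 1 X.1 ^+ nu * subst2 Fo.1 X)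
  /\ ord w (w + nu) (d1 X.2 * q.1 + d2 X.2 * q.2 - shift 1 X.1 ^+ nu * subst2
    Fo.2 X).
Proof.
move=> nu_gt0 w1 hqw hF hq hX X0; rewrite comp_germ // => e.
have e1 : X.1 + X.1 ^+ nu * subst2 Fo.1 X = subst2 X.1 (germ nu q) := congr1 fst e.
have e2 : X.2 + X.1 ^+ nu * subst2 Fo.2 X = subst2 X.2 (germ nu q) := congr1 snd e.
have eX : X.1 = z1 * shift 1 X.1 by apply: shift1K.
have z1X_ord n F : ord w (nu + n) (z1 ^+ nu * F) -> ord w n F.
  by move=> h i j hij; have := h (i + nu)%N j; rewrite coef_z1XM leq_addl addnK;
    apply; lia.
have E (G H : fps2 K) : ord 1 1 G -> G + X.1 ^+ nu * H = subst2 G (germ nu q) ->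
    ord w (w + nu) (d1 G * q.1 + d2 G * q.2 - shift 1 X.1 ^+ nu * H).
  move=> hG eG; apply: z1X_ord.
  have := taylor_germ nu_gt0 w1 hqw hG hq; rewrite -eG => /ordN.
  rewrite addnCA addnn -mul2n; congr ord.
  by rewrite {1}eX exprMn; ring.
by case: hX => h1 h2; split; [exact: E h1 e1 | exact: E h2 e2].
Qed.

(** In matrix form A Q = a^nu P A, where A is the linear part of [X] and P, Q those of [Fo] and [q];
    a^nu is the value of (X_1 / z_1)^nu at the origin. *)
Lemma conjugation_linear_parts nu Fo q X : (0 < nu)%N ->
  ordp 1 1 Fo -> ordp 1 1 q -> ordp 1 1 X -> (forall j, coef X.1 0 j = 0) ->
  Defs.comp (germ nu Fo) X = Defs.comp X (germ nu q) ->
  forall a c d, coef X.1 1 0 = a -> coef X.2 1 0 = c -> coef X.2 0 1 = d ->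
  [/\ a * coef q.1 1 0 = a ^+ nu * (coef Fo.1 1 0 * a + coef Fo.1 0 1 * c),
      a * coef q.1 0 1 = a ^+ nu * (coef Fo.1 0 1 * d),
      c * coef q.1 1 0 + d * coef q.2 1 0 =
        a ^+ nu * (coef Fo.2 1 0 * a + coef Fo.2 0 1 * c) &
      c * coef q.1 0 1 + d * coef q.2 0 1 = a ^+ nu * (coef Fo.2 0 1 * d)].
Proof.
move=> nu_gt0 hF hq hX X0 e a c d ea ec ed.
have [h1 h2] := conjugation_quotient nu_gt0 (leqnn 1) hq hF hq hX X0 e.
have [hq1 hq2] := hq; have [hF1 hF2] := hF.
have hs F : ord 1 1 F -> ord 1 1 (subst2 F X) by apply: ord_subst2.
have ord2 F : ord 1 (1 + nu) F -> coef F 1 0 = 0 /\ coef F 0 1 = 0.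
  by move=> h; split; apply: h; lia.
have su : coef (shift 1 X.1 ^+ nu) 0 0 = a ^+ nu by rewrite coefX_00 -ea.
have [] := ord2 _ h1; have [] := ord2 _ h2.
rewrite !cfB !cfD !coefM_10 ?coefM_01 //; try exact: hs.
rewrite !coef_subst2_10 ?coef_subst2_01 // !cf_d1 !cf_d2 !mul1r !X0 su ea ec ed.
by rewrite !mul0r !addr0 !mulr0 !add0r => /subr0_eq <- /subr0_eq <- /subr0_eq
  <- /subr0_eq <-.
Qed.

End LowOrder.

Section Invariants.
Variable K : fieldType.
Implicit Types (F G u : fps2 K) (X Y q Fo : fps2 K * fps2 K).

Lemma ord0_cancel u F : coef u 0 0 != 0 -> ord 0 1 (u * F) -> ord 0 1 F.
Proof.
move=> u0 h i j; rewrite mul0n addn0 ltnS leqn0 => /eqP ->.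
elim/ltn_ind: j => j IH; have /eqP := h 0%N j isT.
rewrite cfM big_ord1 big_ord_recl /= !subn0 big1 => [|b _].
  by rewrite addr0 mulf_eq0 (negbTE u0) /= => /eqP.
by rewrite IH ?mulr0 // /bump /=; have := ltn_ord b; lia.
Qed.

(** Write X_1 = z_1 u. Composing with the inverse [Y] gives z_1 = Y_1 u(Y), and u(Y) is a unit, so
    z_1 divides Y_1. *)
Lemma coord_change_inverse X : coord_change X ->
  exists Y, [/\ coord_change Y, Defs.comp X Y = idmap2 & Defs.comp Y X = idmap2].
Proof.
move=> /coord_changeP[hX X0]; have [Y [hY XY YX]] := triangular_inverse hX.
exists Y; split; [|exact: XY|exact: YX].
apply/coord_changeP; split=> // j; have [hY1 _ _ _] := hY.
have [_ _ X10 _] := hX.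
suff h : ord 0 1 Y.1 by apply: h.
apply: (@ord0_cancel (subst2 (shift 1 X.1) Y)).
  have /eqP := ord_subst2_const (shift 1 X.1) hY1 (isT : (0 + 1 * 0 < 1)%N).
  by rewrite cfB cfZ cf1 mulr1 subr_eq0 => /eqP ->.
have /(congr1 fst) e := XY; rewrite mulrC.
have <- : subst2 X.1 Y = Y.1 * subst2 (shift 1 X.1) Y.
  by rewrite {1}[X.1]shift1K // subst2M // subst2_z1.
by rewrite [subst2 _ _]e; apply: ord_z1.
Qed.

Lemma formally_conjugated_sym (F' G' : fps2 K * fps2 K) : ordp 1 1 F' ->
  formally_conjugated F' G' -> formally_conjugated G' F'.
Proof.
move=> hF /(formally_conjugated_elim hF)[hG [X hX e]].
have [Y [hY XY YX]] := coord_change_inverse hX.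
have /coord_changeP[[hY1 _ _ _] _] := hY; have /coord_changeP[[hX1 _ _ _] _] := hX.
apply: (formally_conjugated_intro hY hG hF).
exact: conjugation_sym hX1 hY1 hF hG XY YX e.
Qed.

(** Modulo z_1 the weight 0 equation reduces to d1 X_1 q_1 = 0: z_1 divides d2 X_1 because it
    divides X_1, and it divides F^o_1(X) because it divides F^o_1 and X_1. Finally d1 X_1 is a
    unit. *)
Lemma tangential_conj1 nu Fo q : (0 < nu)%N -> ordp 1 1 Fo -> ordp 1 1 q ->
  formally_conjugated (germ nu Fo) (germ nu q) -> ord 0 1 Fo.1 -> ord 0 1 q.1.
Proof.
move=> nu_gt0 hF hq /(formally_conjugated_elim (ordp_germ nu_gt0 Fo)).
move=> [_ [X /coord_changeP[[hX _ X10 _] X0] e]] hF0.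
have [h _] := @conjugation_quotient _ 0 nu Fo q X nu_gt0 isT (conj (@ord_ge0 _
  _ _) (@ord_ge0 _ _ _)) hF hq hX X0 e.
apply: (@ord0_cancel (d1 X.1)); first by rewrite cf_d1 mul1r.
have -> : d1 X.1 * q.1 = (d1 X.1 * q.1 + d2 X.1 * q.2 - shift 1 X.1 ^+ nu *
  subst2 Fo.1 X)
    - d2 X.1 * q.2 + shift 1 X.1 ^+ nu * subst2 Fo.1 X.
  by rewrite addrAC subrK addrK.
apply: ordD; first apply: ordB.
- by apply: ordW h; lia.
- apply: ordMr => i j; rewrite mul0n addn0 ltnS leqn0 => /eqP ->.
  by rewrite cf_d2 X0 mulr0.
apply: ordMl; have -> : Fo.1 = z1 * shift 1 Fo.1 by apply: shift1K => j; apply: hF0.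
rewrite (subst2M _ _ hX) (subst2_z1 hX); apply: ordMr => i j.
by rewrite mul0n addn0 ltnS leqn0 => /eqP ->.
Qed.

Lemma tangential_conj nu Fo q : (0 < nu)%N -> ordp 1 1 Fo -> ordp 1 1 q ->
  formally_conjugated (germ nu Fo) (germ nu q) -> (ord 0 1 Fo.1 <-> ord 0 1 q.1).
Proof.
move=> nu_gt0 hF hq h; split; first exact: tangential_conj1 h.
apply: (@tangential_conj1 nu) => //; apply: formally_conjugated_sym => //.
exact: ordp_germ.
Qed.

(** Conjugation by the linear map A = (a z_1, c z_1 + d z_2) is exact: q is a^nu A^(-1) Fo(A z). *)
Lemma linear_change nu Fo a c d : (0 < nu)%N -> ordp 1 1 Fo ->
  coef Fo.1 0 1 = 0 -> a != 0 -> d != 0 ->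
  exists q, [/\ ordp 1 1 q, formally_conjugated (germ nu Fo) (germ nu q) &
    [/\ coef q.1 1 0 = a ^+ nu * coef Fo.1 1 0, coef q.1 0 1 = 0,
    c * coef q.1 1 0 + d * coef q.2 1 0 =
        a ^+ nu * (coef Fo.2 1 0 * a + coef Fo.2 0 1 * c) &
    coef q.2 0 1 = a ^+ nu * coef Fo.2 0 1]].
Proof.
move=> nu_gt0 hF F01 a0 d0.
pose X := (a *: z1, c *: z1 + d *: z2) : fps2 K * fps2 K.
have hX : ordp 1 1 X.
  by split; [|apply: ordD]; apply: ordZ; [exact: ord_z1|exact: ord_z1|exact:
    ord_z2].
have X10 : coef X.1 1 0 = a by rewrite cfZ /= mulr1.
have X0 j : coef X.1 0 j = 0 by rewrite cfZ /= mulr0.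
have X20 : coef X.2 1 0 = c by rewrite coef_linear_10.
have X21 : coef X.2 0 1 = d by rewrite coef_linear_01.
have hXc : coord_change X.
  apply/coord_changeP; split; last exact: X0.
  by split; [exact: hX | exact: X0 | rewrite X10 | rewrite X21].
pose q1 := a^-1 *: (a ^+ nu *: subst2 Fo.1 X).
pose q2 := d^-1 *: (a ^+ nu *: subst2 Fo.2 X - c *: q1).
have [hF1 hF2] := hF.
have hq1 : ord 1 1 q1 by do 2 apply: ordZ; apply: ord_subst2.
have hq : ordp 1 1 (q1, q2).
  split=> //; apply: ordZ; apply: ordB; apply: ordZ => //; exact: ord_subst2.
have e : Defs.comp (germ nu Fo) X = Defs.comp X (germ nu (q1, q2)).
  rewrite comp_germ //; congr pair; rewrite /fst /snd.
    rewrite subst2Z subst2_z1; last exact: ordp_germ.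
    rewrite /germ /fst scalerDr [in RHS]scalerAr scalerA divff // scale1r.
    by rewrite exprZn -scalerAl -scalerAr.
  rewrite subst2D !subst2Z subst2_z1 ?subst2_z2; try exact: ordp_germ.
  rewrite /germ /fst /snd !scalerDr addrACA; congr (_ + _).
  rewrite 2!scalerAr -mulrDr [d *: _]scalerA divff // scale1r [c *: _ + _]addrC
    subrK.
  by rewrite exprZn -scalerAl -scalerAr.
have [h1 h2 h3 h4] := conjugation_linear_parts nu_gt0 hF hq hX X0 e X10 X20 X21.
rewrite F01 !mul0r ?addr0 ?mulr0 in h1 h2.
have q01 : coef q1 0 1 = 0 by move/eqP: h2; rewrite mulf_eq0 (negbTE a0) => /eqP.
have hG (p : fps2 K * fps2 K) : ordp 1 1 (germ nu p) by apply: ordp_germ.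
exists (q1, q2); split; first exact: hq.
  exact: (formally_conjugated_intro hXc (hG Fo) (hG (q1, q2)) e).
split; [|exact: q01|exact: h3|].
  by apply: (mulfI a0); rewrite h1 mulrA mulrC.
by apply: (mulfI d0); rewrite -[LHS]add0r -{1}(mulr0 c) -q01 h4 mulrA mulrC.
Qed.

End Invariants.

(** * Solving the homological equation *)

Section Solvability.
Variable K : numFieldType.
Variable nu : nat.
Hypothesis nu_gt0 : (0 < nu)%N.

Let nat_neq0 n : n.+1%:R != 0 :> K.
Proof. by rewrite pnatr_eq0. Qed.

(** The three reasons for keeping a monomial, with a = i - 1: H_1 has no pure power of z_2; the
    unknown at a lam + j = 0 is reserved for the second component; the diagonal coefficient (a - nu)
    lam + j of the first equation vanishes. *)
Definition star1_monomials (lam : K) i j :=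
  [|| i == 0%N, i.-1%:R * lam + j%:R == 0
    | (i.-1%:R - nu%:R) * lam + j%:R == 0].

Lemma solvable_star1 lam : solvable nu lam 0 1 (star1_monomials lam)
  (fun i j => (j == 0%N) && (i%:R * lam == 1)).
Proof.
move=> m _ r1 r2.
(* At a lam + j = 0 the second equation at z_1^a z_2^(j+1) reduces to - nu h1 = r2, which dictates
   [h1]; otherwise the first equation does. *)
pose h1 i j : K := if i is a.+1 then
    if a%:R * lam + j%:R == 0 then - r2 a j.+1 / nu%:R
    else r1 a.+1 j / ((a%:R - nu%:R) * lam + j%:R)
  else 0.
(* Where a lam + b = 0 the quotient is by zero, but its value is then multiplied by zero. *)
pose h2 a j : K := if j is b.+1 then
    (r2 a b.+1 + nu%:R * h1 a.+1 b) / (a%:R * lam + b%:R)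
  else r2 a 0%N / (a%:R * lam - 1).
exists h1, h2; split=> // i j _; split.
  rewrite /star1_monomials !negb_or; case: i => [//|a] /= /andP[n1 n2].
  have -> : hom1 nu lam 0 1 h1 a.+1 j = ((a%:R - nu%:R) * lam + j%:R) * h1 a.+1 j.
    by rewrite /hom1 -natr1; ring.
  by rewrite /h1 (negbTE n1) mulrC divfK.
have e0 a : hom2 nu lam 0 1 h1 h2 a 0 = (a%:R * lam - 1) * h2 a 0%N.
  by rewrite /hom2; case: a => [|a]; ring.
have e1 a b : hom2 nu lam 0 1 h1 h2 a b.+1 =
    (a%:R * lam + b%:R) * h2 a b.+1 - nu%:R * h1 a.+1 b.
  by rewrite /hom2 -[b.+1]addn1 natrD; case: a => [|a]; ring.
case: j => [|b] hn.
  by rewrite e0 /h2 mulrC divfK // subr_eq0.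
have nu0 : nu%:R != 0 :> K by rewrite pnatr_eq0 -lt0n.
rewrite e1; have [e|ne] := eqVneq (i%:R * lam + b%:R) 0.
  by rewrite e mul0r sub0r /h1 e eqxx mulrCA divff ?mulr1 ?opprK.
by rewrite /h2 mulrC divfK // addrK.
Qed.

(** A nonzero scalar plus the locally nilpotent operator z_1 d/dz_2 is inverted by recursion on the
    exponent of z_1. *)
Lemma solve_triangular (c : K) (r : nat -> nat -> K) : c != 0 ->
  exists h : nat -> nat -> K, forall i j,
    c * h i j + (if i is i'.+1 then j.+1%:R * h i' j.+1 else 0) = r i j.
Proof.
move=> c0; pose h := fix h i j : K := match i with
  | 0%N => r 0%N j / c
  | i'.+1 => (r i'.+1 j - j.+1%:R * h i' j.+1) / c
  end.
by exists h; case=> [|i] j /=; field.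
Qed.

Lemma solvable_J1 : @solvable K nu 1 1 1
  (fun i j => (i == 0%N) || (i == 1%N) && (j == nu)) (fun _ _ => false).
Proof.
move=> m m2 r1 r2.
have hom1E h i j : hom1 nu 1 1 1 h i.+1 j =
    ((i.+1 + j)%:R - nu.+1%:R) * h i.+1 j + j.+1%:R * h i j.+1 :> K.
  by rewrite /hom1 -[nu.+1]addn1 !natrD; ring.
have [h1 [h10 h1P]] : exists h1 : nat -> nat -> K, (forall j, h1 0%N j = 0) /\
    forall i j, (i + j)%N = m -> ~~ ((i == 0%N) || (i == 1%N) && (j == nu)) ->
      hom1 nu 1 1 1 h1 i j = r1 i j.
  (* In degree nu + 1 the scalar part vanishes. What remains is z_1 d/dz_2, which maps multiples of
     z_1 onto multiples of z_1^2 and misses z_1 z_2^nu. *)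
  have [e|ne] := eqVneq m nu.+1.
    pose h i j : K := if i is i'.+1 then if j is j'.+1 then r1 i.+1 j' / j%:R
      else 0 else 0.
    exists h; split=> // -[|[|i]] j hij //= hN.
      by case/eqP: hN; lia.
    by rewrite hom1E hij e subrr mul0r add0r /h mulrC divfK.
  pose c : K := m%:R - nu.+1%:R.
  have c0 : c != 0 by rewrite subr_eq0 eqr_nat.
  (* The zero right-hand side in row 0 forces [h 0 j = 0], that is z_1 | H_1. *)
  have [h hP] := solve_triangular (fun i j => if i is 0%N then 0 else r1 i j) c0.
  exists h; split=> [j|[|i] j hij //= _].
    by have := hP 0%N j; rewrite addr0 => /eqP; rewrite mulf_eq0 (negbTE c0) =>
      /eqP.
  by rewrite -(hP i.+1 j) hom1E hij.
pose g i j := r2 i j + (1 + nu%:R) * h1 i j + nu%:R * (if j is j'.+1 then h1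
  i.+1 j' else 0).
(* The scalar of the second component is m - 1, nonzero since m >= 2: nothing is obstructed
   there. *)
have c0 : m%:R - 1 != 0 :> K by rewrite subr_eq0 pnatr_eq1; case: m m2 {h1P} =>
  [|[|]].
have [h2 h2P] := solve_triangular g c0.
exists h1, h2; split=> // i j hij; split; first exact: h1P.
move=> _; have -> : r2 i j = g i j - (1 + nu%:R) * h1 i j
    - nu%:R * (if j is j'.+1 then h1 i.+1 j' else 0) by rewrite /g; ring.
rewrite -(h2P i j) /hom2 -hij natrD.
by case: i {hij} => [|i]; case: j => [|j]; ring.
Qed.

(** The operator is diagonal here, with eigenvalue i - 1 - nu on the first component and i on the
    second, independently of j. *)
Lemma solvable_star2 : @solvable K nu 1 0 0
  (fun i j => (i == 0%N) || (i == nu.+1)) (fun i j => i == 0%N :> nat).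
Proof.
move=> m _ r1 r2.
pose h1 i j : K := if i is 0%N then 0 else r1 i j / (i%:R - 1 - nu%:R).
pose h2 i j : K := r2 i j / i%:R.
exists h1, h2; split=> // -[|i] j _; split=> //= hN.
  have h : i.+1%:R - 1 - nu%:R != 0 :> K.
    by rewrite -natr1 addrK subr_eq0 eqr_nat.
  have -> : hom1 nu 1 0 0 h1 i.+1 j = (i.+1%:R - 1 - nu%:R) * h1 i.+1 j.
    by rewrite /hom1; ring.
  by rewrite /h1 mulrC divfK.
have -> : hom2 nu 1 0 0 h1 h2 i.+1 j = i.+1%:R * h2 i.+1 j.
  by rewrite /hom2; case: j => [|j]; ring.
by rewrite /h2 mulrC divfK.
Qed.

(** The operator is nilpotent. On H_1, a multiple of z_1, z_1 d/dz_2 reaches the multiples of z_1^2;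
    on H_2 it reaches the multiples of z_1, and the coupling with H_1 moves to the right-hand
    side. *)
Lemma solvable_J0 : @solvable K nu 0 1 0
  (fun i j => (i <= 1)%N) (fun i j => i == 0%N :> nat).
Proof.
move=> m _ r1 r2.
pose h1 i j : K := if i is i'.+1 then if j is j'.+1 then r1 i.+1 j' / j%:R else
  0 else 0.
pose h2 i j : K := if j is j'.+1 then (r2 i.+1 j' + (1 + nu%:R) * h1 i.+1 j') /
  j%:R else 0.
exists h1, h2; split=> // i j _; split.
  case: i => [|[|i]] // _.
  have -> : hom1 nu 0 1 0 h1 i.+2 j = j.+1%:R * h1 i.+1 j.+1.
    by rewrite /hom1; ring.
  by rewrite /h1 mulrC divfK.
case: i => [|i] // _.
have -> : hom2 nu 0 1 0 h1 h2 i.+1 j =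
    j.+1%:R * h2 i j.+1 - (1 + nu%:R) * h1 i.+1 j.
  by rewrite /hom2; case: j => [|j]; ring.
by rewrite /h2 mulrC divfK // addrK.
Qed.

End Solvability.

(** * Normal shapes of the linear part *)

Section LinearReduction.
Variable K : numClosedFieldType.
Variable nu : nat.
Hypothesis nu_gt0 : (0 < nu)%N.
Implicit Types (q Fo : fps2 K * fps2 K).

Lemma linearize_eq q lam mu del : coef q.1 1 0 = lam -> coef q.1 0 1 = 0 ->
  coef q.2 1 0 = mu -> coef q.2 0 1 = del -> linearize q = linear_field lam mu del.
Proof. by rewrite /linearize => -> -> -> ->. Qed.

(** Admissible linear changes are lower triangular. The entry a rescales both eigenvalues by a^nu,
    so a root of order nu makes one of them 1; c removes the off-diagonal entry when the eigenvalues
    differ, and otherwise d normalizes it to 1 if it is nonzero. *)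
Lemma linear_reduction Fo : ordp 1 1 Fo -> coef Fo.1 0 1 = 0 ->
  linearize Fo <> 0 ->
  exists q, [/\ ordp 1 1 q, formally_conjugated (germ nu Fo) (germ nu q) &
    [\/ exists lam, linearize q = linear_field lam 0 1,
        linearize q = linear_field 1 1 1,
        linearize q = linear_field 1 0 0 |
        linearize q = linear_field 0 1 0]].
Proof.
move=> hF F01 hnz.
set lam := coef Fo.1 1 0; set mu := coef Fo.2 1 0; set del := coef Fo.2 0 1.
have root (x : K) : x != 0 -> exists2 a, a != 0 & a ^+ nu * x = 1.
  move=> x0; have ra : (nu.-root x^-1) ^+ nu = x^-1 by apply: rootCK.
  exists (nu.-root x^-1); last by rewrite ra mulVf.
  by rewrite rootC_eq0 // invr_eq0.
have [d0|d0] := eqVneq del 0.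
  have [l0|l0] := eqVneq lam 0.
    have m0 : mu != 0.
      apply/eqP => m0; apply: hnz; rewrite /linearize -/lam -/mu -/del F01 d0 l0 m0.
      by rewrite !scale0r !addr0.
    have [q [hq hc [q1 q2 q3 q4]]] := linear_change 0 nu_gt0 hF F01 (oner_neq0
      _) m0.
    exists q; split; [exact: hq|exact: hc|apply: Or44].
    rewrite -/lam -/mu -/del expr1n !mul1r l0 d0 in q1 q3 q4.
    apply: linearize_eq => //.
    by apply: (mulfI m0); move: q3; rewrite mul0r add0r mulr1 mulr0 addr0 => ->.
  have [a a0 ha] := root _ l0.
  (* With del = 0 and a^nu lam = 1 the new off-diagonal entry is a^(nu+1) mu - c, whence this c. *)
  have [q [hq hc [q1 q2 q3 q4]]] :=
    linear_change (a ^+ nu.+1 * mu) nu_gt0 hF F01 a0 (oner_neq0 _).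
  exists q; split; [exact: hq|exact: hc|apply: Or43].
  rewrite -/lam -/mu -/del ha d0 ?mulr0 in q1 q3 q4.
  apply: linearize_eq => //.
  move: q3; rewrite q1 mulr1 mul1r mul0r addr0 => /eqP.
  by rewrite exprS -subr_eq0 => /eqP <-; ring.
have [a a0 ha] := root _ d0.
have [e|ne] := eqVneq lam del.
  have [m0|m0] := eqVneq mu 0.
    have [q [hq hc [q1 q2 q3 q4]]] :=
      linear_change 0 nu_gt0 hF F01 a0 (oner_neq0 _).
    exists q; split; [exact: hq|exact: hc|apply: Or41; exists 1].
    rewrite -/lam -/mu -/del e m0 ha in q1 q3 q4.
    apply: linearize_eq => //.
    by move: q3; rewrite !mul0r add0r mul1r mulr0 addr0 mulr0.
  have am0 : a ^+ nu.+1 * mu != 0 by rewrite mulf_neq0 // expf_neq0.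
  have [q [hq hc [q1 q2 q3 q4]]] := linear_change 0 nu_gt0 hF F01 a0 am0.
  exists q; split; [exact: hq|exact: hc|apply: Or42].
  rewrite -/lam -/mu -/del e ha in q1 q3 q4.
  apply: linearize_eq => //.
  apply: (mulfI am0); move: q3; rewrite mul0r add0r mulr0 addr0 => ->.
  by rewrite mulr1 exprS; ring.
pose l := a ^+ nu * lam.
have l1 : l - 1 != 0 by rewrite -ha -mulrBr mulf_neq0 ?expf_neq0 ?subr_eq0.
(* With a^nu del = 1 the new off-diagonal entry is a^(nu+1) mu - c (l - 1), whence this c. *)
have [q [hq hc [q1 q2 q3 q4]]] :=
  linear_change (a ^+ nu.+1 * mu / (l - 1)) nu_gt0 hF F01 a0 (oner_neq0 _).
exists q; split; [exact: hq|exact: hc|apply: Or41; exists l].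
rewrite -/lam -/mu -/del ha in q1 q3 q4.
apply: linearize_eq => //.
move: q3; rewrite q1 -/l mul1r mulrDr mulrA mulrA ha mul1r => e.
have -> : coef q.2 1 0 = a ^+ nu * mu * a + a ^+ nu.+1 * mu / (l - 1)
   - a ^+ nu.+1 * mu / (l - 1) * l by rewrite -e; ring.
by rewrite exprS; field.
Qed.

End LinearReduction.

(** * Normal forms *)

Section Monomials.
Variable K : comNzRingType.

Lemma coef_subst1_mon (g : fps1 K) a b i j :
  coef (subst1 g (z1 ^+ a * z2 ^+ b)) i j =
  \sum_(k < (i + j).+1) g k * ((i == (a * k)%N) && (j == (b * k)%N))%:R.
Proof.
apply: eq_bigr => k _; congr (_ * _).
by rewrite exprMn -!exprM coef_mon.
Qed.

Lemma coef_subst1_in (g : fps1 K) a b k : (0 < a + b)%N ->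
  coef (subst1 g (z1 ^+ a * z2 ^+ b)) (a * k) (b * k) = g k.
Proof.
move=> ab; rewrite coef_subst1_mon -mulnDl.
have hk : (k < ((a + b) * k).+1)%N by rewrite ltnS leq_pmull.
rewrite (bigD1 (Ordinal hk)) //= !eqxx mulr1 big1 ?addr0 // => l.
rewrite -val_eqE /= => /eqP lk; case: andP => [[]|_]; last by rewrite mulr0.
rewrite !eqn_mul2l => /orP[/eqP a0|/eqP e]; last by case: lk; rewrite -e.
move=> /orP[/eqP b0|/eqP e]; last by case: lk; rewrite -e.
by exfalso; clear l lk; move: ab; rewrite a0 b0.
Qed.

Lemma coef_subst1_out (g : fps1 K) a b i j :
  ~ (exists k, i = (a * k)%N /\ j = (b * k)%N) ->
  coef (subst1 g (z1 ^+ a * z2 ^+ b)) i j = 0.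
Proof.
move=> h; rewrite coef_subst1_mon big1 // => k _.
by case: andP => [[/eqP ei /eqP ej]|_]; [case: h; exists k | rewrite mulr0].
Qed.

Lemma coef_subst1_z1 (g : fps1 K) i j :
  coef (subst1 g z1) i j = if j == 0%N then g i else 0.
Proof.
have -> : z1 = z1 ^+ 1 * z2 ^+ 0 :> fps2 K by rewrite expr1 mulr1.
case: eqP => [->|j0].
  by have := @coef_subst1_in g 1 0 i isT; rewrite mul1n mul0n.
by rewrite coef_subst1_out // => -[k [_]]; rewrite mul0n.
Qed.

Lemma coef_subst1_z2 (g : fps1 K) i j :
  coef (subst1 g z2) i j = if i == 0%N then g j else 0.
Proof.
have -> : z2 = z1 ^+ 0 * z2 ^+ 1 :> fps2 K by rewrite expr1 mul1r.
case: eqP => [->|i0].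
  by have := @coef_subst1_in g 0 1 j isT; rewrite mul1n mul0n.
by rewrite coef_subst1_out // => -[k [e _]]; apply: i0; rewrite e mul0n.
Qed.

Lemma coef_tail (t : fps1 K) i j : coef (z2 ^+ 2 * subst1 t z2) i j =
  if (i == 0%N) && (2 <= j)%N then t (j - 2)%N else 0.
Proof.
by rewrite coef_z2XM coef_subst1_z2; case: (i == 0%N); case: ltnP.
Qed.

Lemma coef_z1 i j : coef (z1 : fps2 K) i j = ((i == 1%N) && (j == 0%N))%:R.
Proof. by []. Qed.

Lemma coef_z2 i j : coef (z2 : fps2 K) i j = ((i == 0%N) && (j == 1%N))%:R.
Proof. by []. Qed.

Lemma coef_z1X n i j : coef (z1 ^+ n : fps2 K) i j = ((i == n) && (j == 0%N))%:R.
Proof. by rewrite -[z1 ^+ n]mulr1 -[1](expr0 z2) coef_mon. Qed.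

(** The restriction of [F] to z_1 = 0 is exactly what the tail [t] records; the multiples of z_1 are
    compared separately with [G]. *)
Lemma fps2_split (F G : fps2 K) (t : fps1 K) : coef F 0 0 = 0 -> coef F 0 1 = 0 ->
  (forall j, coef G 0 j = 0) -> (forall n, t n = coef F 0 n.+2) ->
  (forall a j, coef F a.+1 j = coef G a.+1 j) -> F = G + z2 ^+ 2 * subst1 t z2.
Proof.
move=> F00 F01 G0 tE FG; apply: fps2P => -[|i] j; rewrite cfD coef_tail /=.
  by rewrite G0 add0r; case: j => [|[|j]] //; rewrite tE subSS subn1.
by rewrite addr0 FG.
Qed.

End Monomials.

(** * Linear part, tail and family of a normal form *)

Section NormalFormShape.
Variable R : realType.
Local Notation C := R[i].
Variable nu : nat.
Hypothesis nu_gt0 : (0 < nu)%N.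

Lemma coef_twisted p q (po : {poly C}) i j :
  coef (twisted_poly nu p q po) i j = \sum_(k < size po)
    po`_k * ((i == (nu.+1 - q * k)%N) && (j == (p * k)%N))%:R.
Proof.
by rewrite cf_sum; apply: eq_bigr => k _; rewrite cfZ coef_mon.
Qed.

Lemma coef_twisted_in p q (po : {poly C}) k : (0 < p)%N ->
  coef (twisted_poly nu p q po) (nu.+1 - q * k) (p * k) = po`_k.
Proof.
move=> p0; rewrite coef_twisted; have [hk|hk] := ltnP k (size po); last first.
  rewrite nth_default // big1 // => l _; rewrite eqn_mul2l eqn0Ngt p0 /=.
  case: (k =P l :> nat) => [e|_]; last by rewrite andbF mulr0.
  by have := ltn_ord l; rewrite -e ltnNge hk.
rewrite (bigD1 (Ordinal hk)) //= !eqxx mulr1 big1 ?addr0 // => l.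
rewrite -val_eqE /= => lk.
by rewrite eqn_mul2l eqn0Ngt p0 /= [k == l]eq_sym (negbTE lk) andbF mulr0.
Qed.

Lemma coef_twisted_out p q (po : {poly C}) i j :
  ~ (exists k, [/\ (k < size po)%N, i = (nu.+1 - q * k)%N & j = (p * k)%N]) ->
  coef (twisted_poly nu p q po) i j = 0.
Proof.
move=> h; rewrite coef_twisted big1 // => k _.
by case: andP => [[/eqP ei /eqP ej]|_]; [case: h; exists k | rewrite mulr0].
Qed.

(** Keeps the truncated subtraction nu + 1 - q k exact and positive, so that z_1 divides every term
    of [twisted_poly]. *)
Lemma twisted_exponent q (po : {poly C}) k : ((size po).-1 <= nu %/ q)%N ->
  (k < size po)%N -> (q * k <= nu)%N.
Proof.
case: q => [|q] // h hk; rewrite mulnC -leq_divRL //; apply: leq_trans h.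
by rewrite -ltnS (leq_trans hk) // leqSpred.
Qed.

(* What a normal form with linear part (lam z_1, mu z_1 + del z_2) and tail t
   looks like, up to the terms that play no role in its classification. *)
Definition shape (lam mu del : C) (t : fps1 C) (q : fps2 C * fps2 C) :=
  [/\ ord 1 2 (q.1 - lam *: z1), ord 1 2 (q.2 - (mu *: z1 + del *: z2)) &
      ord 0 1 (q.1 - z2 ^+ 2 * subst1 t z2)].

Lemma shape_ordp lam mu del t q : shape lam mu del t q -> ordp 1 1 q.
Proof.
move=> [h1 h2 _]; split.
  by apply: (ord_near (ordW _ h1)) => //; apply: ordZ; apply: ord_z1.
apply: (ord_near (ordW _ h2)) => //.
by apply: ordD; apply: ordZ; [apply: ord_z1 | apply: ord_z2].
Qed.

Lemma shape_coef lam mu del t q : shape lam mu del t q ->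
  [/\ coef q.1 1 0 = lam, coef q.1 0 1 = 0, coef q.2 1 0 = mu & coef q.2 0 1 = del].
Proof.
move=> [h1 h2 _]; split.
- by rewrite (ord_eq h1) // cfZ coef_z1 mulr1.
- by rewrite (ord_eq h1) // cfZ coef_z1 mulr0.
- by rewrite (ord_eq h2) // coef_linear_10.
- by rewrite (ord_eq h2) // coef_linear_01.
Qed.

Lemma shape_tangential lam mu del t q : shape lam mu del t q ->
  (forall n, t n = 0) <-> ord 0 1 q.1.
Proof.
move=> [_ _ h]; split=> [t0|hq n].
  apply: (ord_near h) => i j _; rewrite coef_tail t0.
  by case: ifP.
have := hq 0%N n.+2 isT; rewrite (ord_eq h) // coef_tail /=.
by rewrite subSS subn1.
Qed.

(** Conjugation preserves the ordered pair of eigenvalues up to a common factor: the line z_1 = 0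
    distinguishes the eigenvalue del along it from lam transverse to it. So the ratio lam / del is
    an invariant when del is nonzero, and mu matters only for equal nonzero eigenvalues. *)
Definition family (lam mu del : C) : form_name R :=
  if del == 0 then if lam == 0 then J0 else Star2
  else if (lam == del) && (mu != 0) then J1 else Star1 (lam / del).

Lemma ord_tail (t : fps1 C) : ord 1 2 (z2 ^+ 2 * subst1 t z2).
Proof. by apply: ordMr; apply: (@ordX _ 1 1 _ 2 (@ord_z2 C)). Qed.

Lemma shape_intro lam mu del t A B G : A = z1 * G ->
  ord 1 2 (A - lam *: z1) -> ord 1 2 (B - (mu *: z1 + del *: z2)) ->
  shape lam mu del t (A + z2 ^+ 2 * subst1 t z2, B).
Proof.
move=> eA hA hB; split=> //=.
  by rewrite addrAC; apply: ordD => //; apply: ord_tail.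
by rewrite addrK eA; apply: ordMr; apply: ord_z1.
Qed.

Lemma normal_form_shape k t fhat : normal_form nu k t fhat ->
  exists lam mu del q, [/\ fhat = germ nu q, shape lam mu del t q &
    k = family lam mu del].
Proof.
have ordz n F : (2 <= n)%N -> ord 1 2 (z1 ^+ n * F : fps2 C).
  by move=> h; apply: ordMr; apply: ordW (@ord_z1X _ 1 n).
have z2E : z2 = 0 *: z1 + 1 *: z2 :> fps2 C by rewrite scale0r scale1r add0r.
have ord_z2_refl : ord 1 2 (z2 - (0 *: z1 + 1 *: z2) : fps2 C).
  by rewrite -z2E subrr; apply: ord_zero.
have fam1 lam : Star1 lam = family lam 0 1 :> form_name R.
  by rewrite /family oner_eq0 eqxx andbF divr1.
have twE p q (po : {poly C}) : (0 < p)%N -> ((size po).-1 <= nu %/ q)%N -> (2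
  <= p + q)%N ->
    exists2 G : fps2 C, twisted_poly nu p q po = z1 * G & ord 1 2 (twisted_poly
      nu p q po).
  move=> p0 hpo hpq; exists (shift 1 (twisted_poly nu p q po)).
    apply: shift1K => j; apply: coef_twisted_out => -[l [hl e _]].
    by have := twisted_exponent hpo hl; lia.
  move=> i j hij; apply: coef_twisted_out => -[l [hl ei ej]].
  have := twisted_exponent hpo hl; case: l hl ei ej => [|l] hl ei ej hl'.
    by move: ei hij nu_gt0; rewrite muln0; lia.
  move: ej hij p0; nia.
case.
- move=> lam a t' _; exists lam, 0, 1.
  exists (lam *: z1 + a *: z1 ^+ nu.+1 + z2 ^+ 2 * subst1 t' z2, z2).
  split=> //; apply: (@shape_intro _ _ _ _ _ _ (lam *: 1 + a *: z1 ^+ nu)) => //.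
    by rewrite exprS mulrDr -!scalerAr mulr1.
  by rewrite addrAC subrr add0r; apply: ordZ; rewrite -[z1 ^+ _]mulr1; apply: ordz.
- move=> g t'; exists 0, 0, 1.
  exists (z1 ^+ 2 * subst1 g z1 + z2 ^+ 2 * subst1 t' z2, z2).
  split=> //; apply: (@shape_intro _ _ _ _ _ _ (z1 * subst1 g z1)) => //.
    by rewrite mulrA expr2.
  by rewrite scale0r subr0; apply: ordz.
- move=> p q g1 g2 t' p0 q0 cop e.
  exists (- (p%:R / q%:R)), 0, 1; set m := z1 ^+ q * z2 ^+ p.
  exists (z1 * subst1 g1 m + z1 ^+ nu.+1 * subst1 g2 m + z2 ^+ 2 * subst1 t'
    z2, z2).
  split=> //.
  apply: (@shape_intro _ _ _ _ _ _ (subst1 g1 m + z1 ^+ nu * subst1 g2 m)) => //.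
    by rewrite mulrDr mulrA -exprS.
  rewrite addrAC; apply: ordD; last by apply: ordz.
  rewrite -e -[X in _ - _ *: X]mulr1 scalerAr -mulrBr; apply: (@ordM _ 1 1 1).
    exact: ord_z1.
  move=> i j hij; have [-> ->] : i = 0%N /\ j = 0%N by lia.
  have := @coef_subst1_in _ g1 q p 0; rewrite !muln0 => h.
  by rewrite cfB h ?addn_gt0 ?q0 // cfZ cf1 mulr1 subrr.
- move=> q a po t' q2 hpo.
  exists q%:R^-1, 0, 1.
  exists (q%:R^-1 *: z1 + twisted_poly nu 1 q po + z2 ^+ 2 * subst1 t' z2,
          z2 + a *: z1 ^+ q).
  have [G eG hG] := twE 1%N q po isT hpo (leq_trans q2 (leq_addl _ _)).
  split=> //; apply: (@shape_intro _ _ _ _ _ _ (q%:R^-1 *: 1 + G)) => //.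
  + by rewrite mulrDr -eG -scalerAr mulr1.
  + by rewrite addrAC subrr add0r.
  + rewrite addrAC; apply: ordD => //; apply: ordZ.
    by rewrite -[z1 ^+ _]mulr1; apply: ordz.
- move=> p q po t' q1 p2 cop hpo.
  exists (p%:R / q%:R), 0, 1.
  exists ((p%:R / q%:R) *: z1 + twisted_poly nu p q po + z2 ^+ 2 * subst1 t'
    z2, z2).
  have [G eG hG] := twE p q po (ltnW p2) hpo (leq_trans p2 (leq_addr _ _)).
  split=> //; apply: (@shape_intro _ _ _ _ _ _ ((p%:R / q%:R) *: 1 + G)) => //.
  + by rewrite mulrDr -eG -scalerAr mulr1.
  + by rewrite addrAC subrr add0r.
- move=> pnu t' hp; exists 1, 0, 1.
  exists (z1 + z1 * pnu + z2 ^+ 2 * subst1 t' z2, z2).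
  split=> //; apply: (@shape_intro _ _ _ _ _ _ (1 + pnu)) => //.
    by rewrite mulrDr mulr1.
  rewrite scale1r addrAC subrr add0r; apply: (@ordM _ 1 1 1); first exact: ord_z1.
  by rewrite -hp => i j hij /=; case: eqP => // e; move: hij nu_gt0; lia.
- move=> a t'; exists 1, 1, 1.
  exists (z1 + a *: (z1 * z2 ^+ nu) + z2 ^+ 2 * subst1 t' z2, z1 + z2).
  split=> //; last by rewrite /family oner_eq0 eqxx.
  apply: (@shape_intro _ _ _ _ _ _ (1 + a *: z2 ^+ nu)).
  + by rewrite mulrDr mulr1 -scalerAr.
  + rewrite scale1r addrAC subrr add0r; apply: ordZ; apply: (@ordM _ 1 1 1).
      exact: ord_z1.
    by apply: (ordW nu_gt0); rewrite -[X in ord 1 X _]muln1; apply: ordX;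
      apply: ord_z2.
  + by rewrite !scale1r subrr; apply: ord_zero.
- move=> g1 g2 t'; exists 1, 0, 0.
  exists (z1 + z1 ^+ nu.+1 * subst1 g1 z2 + z2 ^+ 2 * subst1 t' z2,
          z2 ^+ 2 * subst1 g2 z2).
  split=> //; last by rewrite /family eqxx oner_eq0.
  apply: (@shape_intro _ _ _ _ _ _ (1 + z1 ^+ nu * subst1 g1 z2)).
  + by rewrite mulrDr mulr1 mulrA -exprS.
  + by rewrite scale1r addrAC subrr add0r; apply: ordz.
  + by rewrite !scale0r addr0 subr0; apply: ord_tail.
- move=> g1 g2 t'; exists 0, 1, 0.
  exists (z1 * z2 * subst1 g1 z2 + z2 ^+ 2 * subst1 t' z2,
          z1 + z2 ^+ 2 * subst1 g2 z2).
  split=> //; last by rewrite /family !eqxx.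
  apply: (@shape_intro _ _ _ _ _ _ (z2 * subst1 g1 z2)).
  + by rewrite mulrA.
  + rewrite scale0r subr0; apply: ordMr.
    by apply: (@ordM _ 1 1 1); [apply: ord_z1 | apply: ord_z2].
  + by rewrite scale1r scale0r addr0 addrAC subrr add0r; apply: ord_tail.
Qed.

End NormalFormShape.

Lemma coprime_mul_eq p q a b : coprime p q -> (0 < q)%N -> (a * p = b * q)%N ->
  exists k, a = (q * k)%N /\ b = (p * k)%N.
Proof.
move=> cop q0 e.
have : (q %| a)%N by rewrite -(@Gauss_dvdl _ _ p) 1?coprime_sym // e dvdn_mull.
case/dvdnP => k ak; exists k; split; first by rewrite ak mulnC.
apply/eqP; rewrite -(eqn_pmul2r q0) -e ak; apply/eqP; ring.
Qed.

(** * Resonances of the diagonal linear part *)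

Section NormalFormExistence.
Variable R : realType.
Local Notation C := R[i].
Variable nu : nat.
Hypothesis nu_gt0 : (0 < nu)%N.

Variant eigenvalue_class (lam : C) : Prop :=
| Generic of ~ exceptional nu lam
| Zero of lam = 0
| Negative p q of (0 < p)%N & (0 < q)%N & coprime p q & lam = - (p%:R / q%:R)
| One of lam = 1
| Inverse q of (2 <= q)%N & lam = q%:R^-1
| Positive p q of (1 <= q <= nu)%N & (2 <= p)%N & coprime p q & lam = p%:R / q%:R.

(** Reduction to lowest terms only shrinks a denominator, so it stays at most nu. Unit fractions go
    to [One] or [Inverse], which leaves numerators at least 2 for [Positive]. *)
Lemma eigenvalueP lam : eigenvalue_class lam.
Proof.
have [|h] := pselect (exceptional nu lam); last exact: Generic.
case=> [[[[q /= /andP[q1 qn] [n _ <-]]|[d /= d2 <-]]|/= ->]|[x /= x0 <-]].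
- have [->|n0] := posnP n; first by apply: Zero; rewrite mul0r.
  pose g := gcdn n q; have g0 : (0 < g)%N by rewrite gcdn_gt0 n0.
  have en : n = (n %/ g * g)%N by rewrite divnK ?dvdn_gcdl.
  have eq : q = (q %/ g * g)%N by rewrite divnK ?dvdn_gcdr.
  have cop : coprime (n %/ g) (q %/ g).
    by rewrite /coprime -(eqn_pmul2r g0) muln_gcdl -en -eq mul1n.
  have n'0 : (0 < n %/ g)%N by rewrite divn_gt0 // dvdn_leq // dvdn_gcdl.
  have q'0 : (0 < q %/ g)%N by rewrite divn_gt0 // dvdn_leq // dvdn_gcdr.
  have q'n : (q %/ g <= nu)%N by apply: leq_trans qn; apply: leq_div.
  have -> : n%:R / q%:R = (n %/ g)%:R / (q %/ g)%:R :> C.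
    rewrite en [in LHS]eq !natrM -mulf_div divff ?mulr1 ?pnatr_eq0 -?lt0n //.
    by rewrite mulnK // mulnK.
  case: (n %/ g)%N (q %/ g)%N n'0 q'0 q'n cop => [|[|p]] // [|[|q']] // _ _ hq cop.
  + by apply: One; rewrite divr1.
  + by apply: (@Inverse _ q'.+2); rewrite // div1r.
  + by apply: (@Positive _ p.+2 1).
  + exact: (@Positive _ p.+2 q'.+2).
- exact: (@Inverse _ d).
- exact: Zero.
- have nx : numq x = - (`|numq x|%N%:Z).
    by rewrite ltz0_abs ?opprK // numq_lt0.
  have dx : denq x = `|denq x|%N%:Z by rewrite gez0_abs // ltW ?denq_gt0.
  apply: (@Negative _ `|numq x|%N `|denq x|%N).
  + by rewrite absz_gt0 numq_eq0 lt_eqF.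
  + by rewrite absz_gt0 denq_neq0.
  + exact: coprime_num_den.
  + by rewrite /ratr {1}nx {1}dx rmorphN mulNr.
Qed.

Lemma linearize_coef (q : fps2 C * fps2 C) lam mu del :
  linearize q = linear_field lam mu del ->
  [/\ coef q.1 1 0 = lam, coef q.1 0 1 = 0, coef q.2 1 0 = mu & coef q.2 0 1 = del].
Proof.
move=> e; have e1 := congr1 fst e; have e2 := congr1 snd e.
split; [have := congr1 (fun F => coef F 1 0) e1
       |have := congr1 (fun F => coef F 0 1) e1
       |have := congr1 (fun F => coef F 1 0) e2
       |have := congr1 (fun F => coef F 0 1) e2];
  by rewrite ?coef_linear_10 ?coef_linear_01.
Qed.

Section Star1.
Variables (lam : C) (q : fps2 C * fps2 C).
Hypothesis q_ord : ordp 1 1 q.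
Hypothesis q_linear : linearize q = linear_field lam 0 1.
Hypothesis q_supp : forall i j, (2 <= i + j)%N ->
  (~~ star1_monomials nu lam i j -> coef q.1 i j = 0) /\
  (~~ ((j == 0%N) && (i%:R * lam == 1)) -> coef q.2 i j = 0).

Let t n := coef q.1 0 n.+2.

Let linear_coef := linearize_coef q_linear.

Let first_eq G : (forall j, coef G 0 j = 0) ->
  (forall a j, coef q.1 a.+1 j = coef G a.+1 j) ->
  q.1 = G + z2 ^+ 2 * subst1 t z2.
Proof.
move=> G0 hG; apply: fps2_split => //; last by case: linear_coef.
by case: q_ord => h _; apply: h.
Qed.

Let first0 a j : (0 < a + j)%N -> a%:R * lam + j%:R != 0 ->
  (a%:R - nu%:R) * lam + j%:R != 0 -> coef q.1 a.+1 j = 0.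
Proof.
move=> aj n1 n2; have h2 : (2 <= a.+1 + j)%N by lia.
have [h _] := q_supp h2.
by apply: h; rewrite /star1_monomials /= negb_or n1 n2.
Qed.

Let second_eq c n : (2 <= n)%N ->
  (forall i, (2 <= i)%N -> i%:R * lam = 1 -> i = n) -> c = coef q.2 n 0 ->
  q.2 = z2 + c *: z1 ^+ n.
Proof.
move=> n2 hn ->; have [_ _ h10 h01] := linear_coef; have [_ h00] := q_ord.
apply: fps2P => i j; rewrite cfD cfZ coef_z2 coef_z1X.
have [hij|hij] := leqP 2 (i + j).
  have [_ h] := q_supp hij; have [e|ne] := boolP ((j == 0%N) && (i%:R * lam == 1)).
    have /andP[/eqP j0 /eqP il] := e; rewrite j0 addn0 in hij *.
    by rewrite (hn i) // !eqxx mulr1 andbF add0r.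
  rewrite h //; case: (eqVneq i n) => [ei|_] /=; last first.
    by rewrite mulr0 addr0; case: eqP => // i0; case: eqP => // j1; lia.
  case: (eqVneq j 0%N) => [ej|_]; last first.
    by rewrite mulr0 addr0; case: eqP => // i0; lia.
  have [_ h'] := q_supp hij.
  by rewrite -ei -ej h // ej andbF mulr1 addr0.
case: i j hij => [|[|i]] [|[|j]] //= hij.
- by rewrite h00 // andbT; case: eqP => [n0|_]; [lia|rewrite mulr0 addr0].
- by rewrite h01 andbF mulr0 addr0.
- by rewrite h10 andbT; case: eqP => [n0|_]; [lia|rewrite mulr0 addr0].
Qed.

Let second_z2 : (forall i, (2 <= i)%N -> i%:R * lam != 1) -> q.2 = z2.
Proof.
(* The exponent 2 is a dummy: without resonance its coefficient is 0 as well. *)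
move=> h; rewrite (@second_eq (coef q.2 2 0) 2) //; last first.
  by move=> i i2 e; have := h i i2; rewrite e eqxx.
have [_ h2] := q_supp (isT : (2 <= 2 + 0)%N).
by rewrite h2 ?scale0r ?addr0 // h.
Qed.

Lemma star1_generic : ~ exceptional nu lam -> exists t, normal_form nu (Star1
  lam) t (germ nu q).
Proof.
move=> hE; exists t.
have nonneg n d : (1 <= d <= nu)%N -> lam <> n%:R / d%:R.
  by move=> hd e; apply: hE; left; left; left; exists d => //; exists n.
have nonpos p d : (0 < d)%N -> lam <> - (p%:R / d%:R).
  move=> d0 e; have [p0|p0] := posnP p.
    by apply: hE; left; right; rewrite /= e p0 mul0r oppr0.
  apply: hE; right; exists (- (p%:R / d%:R)) => /=.
    by rewrite oppr_lt0 divr_gt0 ?ltr0n.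
  by rewrite rmorphN fmorph_div /= !ratr_nat.
have e2 : q.2 = z2.
  apply: second_z2 => i i2; apply/eqP => e; apply: hE; left; left; right.
  exists i => //=; have i0 : i%:R != 0 :> C by rewrite pnatr_eq0; lia.
  by apply: (mulfI i0); rewrite e divff.
have e1 : q.1 = lam *: z1 + coef q.1 nu.+1 0 *: z1 ^+ nu.+1 + z2 ^+ 2 * subst1 t z2.
  apply: first_eq => [j|a j]; first by rewrite cfD !cfZ coef_z1 coef_z1X /=
    !mulr0 addr0.
  rewrite cfD !cfZ coef_z1 coef_z1X !eqSS.
  have [/eqP|aj] := posnP (a + j).
    rewrite addn_eq0 => /andP[/eqP -> /eqP ->]; rewrite (ltn_eqF nu_gt0) mulr0
      addr0 mulr1.
    by case: linear_coef.
  have -> : (a == 0%N) && (j == 0%N) = false by apply/negP => /andP[/eqP ea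
    /eqP ej]; lia.
  rewrite mulr0 add0r; have [/andP[/eqP -> /eqP ->]|ne] := boolP ((a == nu) &&
    (j == 0%N)).
    by rewrite mulr1.
  rewrite mulr0 first0 //; apply/eqP => e.
    have [a0|a0] := posnP a.
      by move/eqP: e; rewrite a0 mul0r add0r pnatr_eq0; lia.
    apply: (nonpos j a a0); have a0' : a%:R != 0 :> C by rewrite pnatr_eq0 -lt0n.
    by apply: (mulfI a0'); rewrite mulrN mulrCA divff // mulr1; move/eqP: e;
      rewrite addr_eq0 => /eqP.
  (* A resonance (a - nu) lam + j = 0 with a < nu puts lam in (1/(nu - a)) N, and one with a > nu
     makes it negative or zero; only a = nu, j = 0 survives, the term in z_1^(nu+1). *)
  have [an|na|an] := ltngtP a nu.
  - have d0 : (nu - a)%:R != 0 :> C by rewrite pnatr_eq0; lia.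
    apply: (nonneg j (nu - a)%N); first lia.
    apply: (mulfI d0); rewrite mulrCA divff // mulr1 natrB 1?ltnW //.
    by move/eqP: e; rewrite -opprB mulNr addrC subr_eq0 => /eqP.
  - have d0 : (a - nu)%:R != 0 :> C by rewrite pnatr_eq0; lia.
    apply: (nonpos j (a - nu)%N); first lia.
    apply: (mulfI d0); rewrite mulrN mulrCA divff // mulr1 natrB 1?ltnW //.
    by move/eqP: e; rewrite addr_eq0 => /eqP.
  - by move/eqP: e; rewrite an subrr mul0r add0r pnatr_eq0 => /eqP j0; rewrite
    an j0 !eqxx in ne.
by rewrite /germ {1}e1 e2; apply: NFgeneric.
Qed.

(** Both resonance conditions reduce to j = 0: off the line, exactly the pure powers of z_1
    survive. *)
Lemma star1_zero : lam = 0 -> exists t, normal_form nu (Star1 0) t (germ nu q).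
Proof.
move=> l0; exists t; pose g n := coef q.1 n.+2 0.
have e2 : q.2 = z2 by apply: second_z2 => i _; rewrite l0 mulr0 eq_sym oner_eq0.
have e1 : q.1 = z1 ^+ 2 * subst1 g z1 + z2 ^+ 2 * subst1 t z2.
  apply: first_eq => [j|a j]; rewrite coef_z1XM //.
  case: a => [|a].
    case: j => [|j]; first by case: linear_coef => ->.
    by rewrite first0 // l0 !mulr0 add0r pnatr_eq0.
  rewrite !ltnS leq0n !subSS subn0 coef_subst1_z1; case: j => [|j] //.
  by rewrite first0 // l0 !mulr0 add0r pnatr_eq0.
by rewrite /germ e1 e2; apply: NFzero.
Qed.

Lemma star1_negative (p d : nat) : (0 < p)%N -> (0 < d)%N -> coprime p d ->
  lam = - (p%:R / d%:R) -> exists t, normal_form nu (Star1 lam) t (germ nu q).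
Proof.
move=> p0 d0 cop el; exists t.
have d0' : d%:R != 0 :> C by rewrite pnatr_eq0 -lt0n.
have p0' : p%:R != 0 :> C by rewrite pnatr_eq0 -lt0n.
have reson a b : a%:R * lam + b%:R = 0 -> exists k, a = (d * k)%N /\ b = (p * k)%N.
  move=> e; apply: coprime_mul_eq => //; apply/eqP; rewrite -(eqr_nat C) !natrM.
  move/eqP: e; rewrite el mulrN addrC subr_eq0 => /eqP ->.
  by apply/eqP; field.
have e2 : q.2 = z2.
  apply: second_z2 => i i2; apply/eqP => e.
  have : i%:R * p%:R + d%:R = 0 :> C.
    have -> : i%:R * p%:R = - (i%:R * lam * d%:R) by rewrite el; field.
    by rewrite e mul1r addNr.
  by rewrite -natrM -natrD => /eqP; rewrite pnatr_eq0; lia.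
pose m : fps2 C := z1 ^+ d * z2 ^+ p.
pose g1 k := coef q.1 (d * k).+1 (p * k); pose g2 k := coef q.1 (nu + d * k).+1
  (p * k).
have e1 : q.1 = z1 * subst1 g1 m + z1 ^+ nu.+1 * subst1 g2 m + z2 ^+ 2 * subst1
  t z2.
  apply: first_eq => [j|a j]; first by rewrite cfD coef_z1M coef_z1XM addr0.
  rewrite cfD coef_z1M coef_z1XM ltnS subSS.
  have [[k [-> ->]]|h1] := pselect (exists k, a = (d * k)%N /\ j = (p * k)%N).
    rewrite coef_subst1_in ?addn_gt0 ?p0 ?orbT //.
    (* The two resonant series share no monomial: p k = p l gives k = l, and then a = a - nu with nu
       > 0. *)
    case: ifP => [na|_]; rewrite ?addr0 //.
    rewrite coef_subst1_out ?addr0 // => -[l [el1 /eqP]].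
    by rewrite eqn_pmul2l // => /eqP kl; move: el1 na; rewrite kl; lia.
  rewrite coef_subst1_out // add0r; case: (leqP nu a) => na.
    have [[k [ea ej]]|h2] := pselect (exists k, (a - nu = d * k)%N /\ j = (p *
      k)%N).
      rewrite [in RHS]ea [in RHS]ej coef_subst1_in ?addn_gt0 ?p0 ?orbT //.
      by rewrite /g2 -ea -ej subnKC.
    rewrite coef_subst1_out // first0 //.
    - by rewrite lt0n; apply/eqP => e; apply: h1; exists 0%N; rewrite !muln0; lia.
    - by apply/eqP => /reson.
    - by apply/eqP; rewrite -natrB // => /reson.
  rewrite first0 //.
  - by rewrite lt0n; apply/eqP => e; apply: h1; exists 0%N; rewrite !muln0; lia.
  - by apply/eqP => /reson.
  (* For a < nu and lam < 0 the sum (a - nu) lam + j is positive; clearing the denominator turns it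
     into a sum of naturals. *)
  apply/eqP => e; have : ((nu - a) * p + j * d)%:R = 0 :> C.
    have -> : ((nu - a) * p + j * d)%:R = ((a%:R - nu%:R) * lam + j%:R) * d%:R :> C.
      by rewrite natrD !natrM natrB 1?ltnW // el; field.
    by rewrite e mul0r.
  by move/eqP; rewrite pnatr_eq0 addn_eq0 muln_eq0; lia.
rewrite el /germ e1 e2; apply: NFnegative => //.
by rewrite /g1 !muln0 -el; case: linear_coef.
Qed.

(** For lam > 0 the sum a lam + j vanishes only at the origin, and (a - nu) lam + j = 0 forces nu -
    a = d k and j = p k, so k <= nu / d: finitely many resonances, hence a polynomial. *)
Let coef_twisted_eq (p d : nat) : (0 < p)%N -> (0 < d)%N -> coprime p d ->
  lam = p%:R / d%:R ->
  let po := \poly_(k < (nu %/ d).+1) coef q.1 (nu.+1 - d * k) (p * k) in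
  ((size po).-1 <= nu %/ d)%N /\
  q.1 = lam *: z1 + twisted_poly nu p d po + z2 ^+ 2 * subst1 t z2.
Proof.
move=> p0 d0 cop el po.
have d0' : d%:R != 0 :> C by rewrite pnatr_eq0 -lt0n.
have hpo : ((size po).-1 <= nu %/ d)%N.
  by have : (size po <= (nu %/ d).+1)%N := size_poly _ _; case: (size po).
split=> //; apply: first_eq => [j|a j].
  rewrite cfD cfZ coef_z1 mulr0 add0r coef_twisted_out // => -[k [hk e _]].
  by have := twisted_exponent hpo hk; lia.
rewrite cfD cfZ coef_z1 eqSS.
have [/eqP|aj] := posnP (a + j).
  rewrite addn_eq0 => /andP[/eqP -> /eqP ->]; rewrite mulr1 coef_twisted_out ?addr0.
    by case: linear_coef.
  move=> [[|k] [hk e1 e2]]; last by move: e2; nia.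
  by move: e1; rewrite muln0; lia.
have -> : (a == 0%N) && (j == 0%N) = false by apply/negP => /andP[/eqP ea /eqP
  ej]; lia.
rewrite mulr0 add0r.
have [[k [hk ea ej]]|h] := pselect (exists k,
    [/\ (k <= nu %/ d)%N, a.+1 = (nu.+1 - d * k)%N & j = (p * k)%N]).
  by rewrite ea ej coef_twisted_in // coef_poly ltnS hk.
rewrite coef_twisted_out => [|[k [hk ea ej]]]; last first.
  by apply: h; exists k; split=> //; rewrite -ltnS (leq_trans hk) // size_poly.
rewrite first0 //; apply/eqP => e.
  have : (a * p + j * d)%:R = 0 :> C.
    have -> : (a * p + j * d)%:R = (a%:R * lam + j%:R) * d%:R :> C.
      by rewrite natrD !natrM el; field.
    by rewrite e mul0r.
  by move/eqP; rewrite pnatr_eq0 addn_eq0 !muln_eq0; lia.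
have [an|na] := leqP a nu.
  have [k [ek ej]] : exists k, (nu - a = d * k)%N /\ j = (p * k)%N.
    apply: coprime_mul_eq => //; apply/eqP; rewrite -(eqr_nat C) !natrM natrB //.
    by move/eqP: e; rewrite addrC addr_eq0 => /eqP ->; rewrite el; apply/eqP; field.
  apply: h; exists k; split=> //; last lia.
  by rewrite leq_divRL // mulnC -ek leq_subr.
have : ((a - nu) * p + j * d)%:R = 0 :> C.
  have -> : ((a - nu) * p + j * d)%:R = ((a%:R - nu%:R) * lam + j%:R) * d%:R :> C.
    by rewrite natrD !natrM natrB 1?ltnW // el; field.
  by rewrite e mul0r.
by move/eqP; rewrite pnatr_eq0 addn_eq0 !muln_eq0; lia.
Qed.

(** The second component has the single resonance z_1^d, for every d >= 2; when d > nu the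
    polynomial is constant. *)
Lemma star1_inverse d : (2 <= d)%N -> lam = d%:R^-1 ->
  exists t, normal_form nu (Star1 lam) t (germ nu q).
Proof.
move=> d2 el; exists t; have d0 : (0 < d)%N by lia.
have d0' : d%:R != 0 :> C by rewrite pnatr_eq0 -lt0n.
have [hpo e1] := @coef_twisted_eq 1 d isT d0 (coprime1n d) (etrans el (esym
  (div1r _))).
have e2 : q.2 = z2 + coef q.2 d 0 *: z1 ^+ d.
  apply: second_eq => // i _ e; apply/eqP; rewrite -(eqr_nat C).
  by rewrite -[i%:R](mulfVK d0') -el e mul1r.
by rewrite /germ {1}e1 e2 el; apply: NFinverse.
Qed.

(** A resonance in the second component would need i p = d, impossible for coprime p and d with p >=
    2. *)
Lemma star1_positive (p d : nat) : (1 <= d <= nu)%N -> (2 <= p)%N -> coprime p d ->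
  lam = p%:R / d%:R -> exists t, normal_form nu (Star1 lam) t (germ nu q).
Proof.
move=> /andP[d1 dn] p2 cop el; exists t.
have d0' : d%:R != 0 :> C by rewrite pnatr_eq0 -lt0n.
have [hpo e1] := @coef_twisted_eq p d (ltnW p2) d1 cop el.
have e2 : q.2 = z2.
  apply: second_z2 => i i2; apply/eqP => e.
  have /eqP : (i * p)%:R = d%:R :> C.
    rewrite natrM; transitivity (i%:R * lam * d%:R); last by rewrite e mul1r.
    by rewrite el; field.
  rewrite eqr_nat => /eqP ed; move: cop; rewrite -ed /coprime gcdnMl => /eqP p1.
  by rewrite p1 in p2.
by rewrite /germ {1}e1 e2 el; apply: NFpositive => //; apply/andP.
Qed.

(** Here (a - nu) lam + j = 0 means a + j = nu, which selects z_1 times a homogeneous polynomial of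
    degree nu. *)
Lemma star1_one : lam = 1 -> exists t, normal_form nu (Star1 1) t (germ nu q).
Proof.
move=> el; exists t.
pose pnu := FPS2 (fun i j => if (i + j)%N == nu then coef q.1 i.+1 j else 0).
have hp : homogeneous nu pnu.
  by apply: fps2P => i j /=; case: eqP => // ->; rewrite eqxx.
have e2 : q.2 = z2.
  by apply: second_z2 => i i2; rewrite el mulr1 pnatr_eq1; lia.
have e1 : q.1 = z1 + z1 * pnu + z2 ^+ 2 * subst1 t z2.
  apply: first_eq => [j|a j]; first by rewrite cfD coef_z1 coef_z1M addr0.
  rewrite cfD coef_z1 coef_z1M eqSS.
  have [/eqP|aj] := posnP (a + j).
    rewrite addn_eq0 => /andP[/eqP -> /eqP ->]; rewrite /pnu /= addn0.
    by rewrite (ltn_eqF nu_gt0) addr0 -el; case: linear_coef.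
  have -> : (a == 0%N) && (j == 0%N) = false by apply/negP => /andP[/eqP ea
    /eqP ej]; lia.
  rewrite add0r /pnu /=; case: eqP => // ne; rewrite first0 //.
    by rewrite el mulr1 -natrD pnatr_eq0; lia.
  by rewrite el mulr1 addrAC -natrD subr_eq0 eqr_nat; apply/eqP.
by rewrite /germ e1 e2; apply: NFone.
Qed.

Lemma star1_normal_form : exists t, normal_form nu (Star1 lam) t (germ nu q).
Proof.
case: (eigenvalueP lam) => [h|l0|p d p0 d0 cop el|el|d d2 el|p d hd p2 cop el].
- exact: star1_generic.
- by rewrite l0; apply: star1_zero.
- exact: star1_negative p0 d0 cop el.
- by rewrite el; apply: star1_one.
- exact: star1_inverse d2 el.
- exact: star1_positive hd p2 cop el.
Qed.

End Star1.

End NormalFormExistence.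

(** * Existence and uniqueness of the formal normal form *)

Section FormalClassification.
Variable R : realType.
Local Notation C := R[i].
Variable nu : nat.
Hypothesis nu_gt0 : (0 < nu)%N.

Lemma J1_normal_form (q : fps2 C * fps2 C) : ordp 1 1 q ->
  linearize q = linear_field 1 1 1 ->
  (forall i j, (2 <= i + j)%N ->
    (~~ ((i == 0%N) || (i == 1%N) && (j == nu)) -> coef q.1 i j = 0) /\
    (~~ false -> coef q.2 i j = 0)) ->
  exists t, normal_form nu J1 t (germ nu q).
Proof.
move=> [h1 h2] /linearize_coef[l1 l2 l3 l4] hs.
pose t n := coef q.1 0 n.+2; exists t.
have e1 : q.1 = z1 + coef q.1 1 nu *: (z1 * z2 ^+ nu)
    + z2 ^+ 2 * subst1 t z2.
  apply: fps2_split => // [|j|a j]; first exact: h1.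
    by rewrite cfD cfZ coef_z1 coef_z1M mulr0 addr0.
  have cm : coef (z1 * z2 ^+ nu) a.+1 j = ((a.+1 == 1%N) && (j == nu))%:R :> C.
    exact: (coef_mon _ 1).
  rewrite cfD cfZ coef_z1 {}cm !eqSS.
  case: a j => [|a] [|j] /=.
  - by rewrite (ltn_eqF nu_gt0) mulr0 addr0.
  - case: eqP => [->|ne]; first by rewrite mulr1 add0r.
    rewrite mulr0 addr0; case: (hs 1%N j.+1 isT) => -> //=.
    by apply/eqP.
  - by rewrite mulr0 addr0; case: (hs a.+2 0%N isT) => ->.
  - by rewrite mulr0 addr0; case: (hs a.+2 j.+1 isT) => ->.
have e2 : q.2 = z1 + z2.
  apply: fps2P => i j; rewrite cfD coef_z1 coef_z2.
  case: i j => [|[|i]] [|[|j]] /=; rewrite ?addr0 ?add0r //.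
  - by rewrite h2.
  - by case: (hs 0%N j.+2 isT) => _ ->.
  - by case: (hs 1%N 1%N isT) => _ ->.
  - by case: (hs 1%N j.+2 isT) => _ ->.
  - by case: (hs i.+2 0%N isT) => _ ->.
  - by case: (hs i.+2 1%N isT) => _ ->.
  - by case: (hs i.+2 j.+2 isT) => _ ->.
by rewrite /germ {1}e1 e2; apply: NFJ1.
Qed.

Lemma star2_normal_form (q : fps2 C * fps2 C) : ordp 1 1 q ->
  linearize q = linear_field 1 0 0 ->
  (forall i j, (2 <= i + j)%N ->
    (~~ ((i == 0%N) || (i == nu.+1)) -> coef q.1 i j = 0) /\
    (~~ (i == 0%N) -> coef q.2 i j = 0)) ->
  exists t, normal_form nu Star2 t (germ nu q).
Proof.
move=> [h1 h2] /linearize_coef[l1 l2 l3 l4] hs.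
pose t n := coef q.1 0 n.+2; exists t.
have e1 : q.1 = z1 + z1 ^+ nu.+1 * subst1 (fun j => coef q.1 nu.+1 j) z2
    + z2 ^+ 2 * subst1 t z2.
  apply: fps2_split => // [|j|a j]; first exact: h1.
    by rewrite cfD coef_z1 coef_z1XM addr0.
  rewrite cfD coef_z1 coef_z1XM coef_subst1_z2 ltnS subSS eqSS subn_eq0.
  have -> : (if (nu <= a)%N then if (a <= nu)%N then coef q.1 nu.+1 j else 0 else 0)
      = if a == nu then coef q.1 nu.+1 j else 0.
    by rewrite eqn_leq; case: (leqP nu a) => na; case: (leqP a nu).
  have [/eqP|aj] := posnP (a + j).
    rewrite addn_eq0 => /andP[/eqP -> /eqP ->].
    by rewrite (ltn_eqF nu_gt0) addr0.
  have -> : (a == 0%N) && (j == 0%N) = false by apply/negP => /andP[/eqP ea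
    /eqP ej]; lia.
  rewrite add0r; case: eqP => [->//|ne]; have h : (2 <= a.+1 + j)%N by lia.
  by case: (hs _ _ h) => -> //=; rewrite eqSS; apply/eqP.
have e2 : q.2 = z2 ^+ 2 * subst1 (fun n => coef q.2 0 n.+2) z2.
  rewrite -[RHS]add0r; apply: fps2_split => // [|a j]; first exact: h2.
  have [/eqP|aj] := posnP (a + j).
    by rewrite addn_eq0 => /andP[/eqP -> /eqP ->].
  by have h : (2 <= a.+1 + j)%N; [lia | case: (hs _ _ h) => _ ->].
by rewrite /germ {1}e1 {1}e2; apply: NFStar2.
Qed.

Lemma J0_normal_form (q : fps2 C * fps2 C) : ordp 1 1 q ->
  linearize q = linear_field 0 1 0 ->
  (forall i j, (2 <= i + j)%N ->
    (~~ (i <= 1)%N -> coef q.1 i j = 0) /\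
    (~~ (i == 0%N) -> coef q.2 i j = 0)) ->
  exists t, normal_form nu J0 t (germ nu q).
Proof.
move=> [h1 h2] /linearize_coef[l1 l2 l3 l4] hs.
pose t n := coef q.1 0 n.+2; exists t.
have e1 : q.1 = z1 * z2 * subst1 (fun j => coef q.1 1 j.+1) z2
    + z2 ^+ 2 * subst1 t z2.
  apply: fps2_split => // [|j|a j]; first exact: h1.
    by rewrite -mulrA coef_z1M.
  rewrite -mulrA coef_z1M coef_z2M; case: j => [|j].
    by case: a => [|a] //; case: (hs a.+2 0%N isT) => ->.
  rewrite coef_subst1_z2; case: a => [|a] //.
  by case: (hs a.+2 j.+1 isT) => ->.
have e2 : q.2 = z1 + z2 ^+ 2 * subst1 (fun n => coef q.2 0 n.+2) z2.
  apply: fps2_split => // [|a j]; first exact: h2.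
  rewrite coef_z1; have [/eqP|aj] := posnP (a + j).
    by rewrite addn_eq0 => /andP[/eqP -> /eqP ->].
  have h : (2 <= a.+1 + j)%N by lia.
  case: (hs _ _ h) => _ -> //; rewrite eqSS.
  by have -> : (a == 0%N) && (j == 0%N) = false by apply/negP => /andP[/eqP ea
    /eqP ej]; lia.
by rewrite /germ {1}e1 {1}e2; apply: NFJ0.
Qed.

Lemma linearize_near (q q' : fps2 C * fps2 C) : ordp 1 2 (q - q') ->
  linearize q = linearize q'.
Proof.
by move=> [h1 h2]; rewrite /linearize !(ord_eq h1) ?(ord_eq h2).
Qed.

Theorem normal_form_exists (Fo : fps2 C * fps2 C) : ordp 1 1 Fo ->
  coef Fo.1 0 1 = 0 -> linearize Fo <> 0 ->
  exists k t fhat, normal_form nu k t fhat /\ formally_conjugated (germ nu Fo) fhat.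
Proof.
move=> hF F01 hnz.
have [q [hq hc hl]] := linear_reduction nu_gt0 hF F01 hnz.
have fin k (q' : fps2 C * fps2 C) : formally_conjugated (germ nu q) (germ nu q') ->
    (exists t, normal_form nu k t (germ nu q')) ->
    exists k t fhat, normal_form nu k t fhat /\ formally_conjugated (germ nu
      Fo) fhat.
  move=> hc' [t ht]; exists k, t, (germ nu q'); split; first exact: ht.
  exact: (formally_conjugated_trans (ordp_germ nu_gt0 Fo) hc hc').
case: hl => [[lam hl]|hl|hl|hl].
- have [q' [hc' hq' /linearize_near e hs]] :=
    normalization nu_gt0 hq hl (solvable_star1 nu_gt0 lam).
  apply: (fin (Star1 lam) q' hc'); apply: star1_normal_form hs => //.
  by rewrite e.
- have [q' [hc' hq' /linearize_near e hs]] :=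
    normalization nu_gt0 hq hl (@solvable_J1 _ nu nu_gt0).
  by apply: (fin J1 q' hc'); apply: J1_normal_form hs => //; rewrite e.
- have [q' [hc' hq' /linearize_near e hs]] :=
    normalization nu_gt0 hq hl (@solvable_star2 _ nu).
  by apply: (fin Star2 q' hc'); apply: star2_normal_form hs => //; rewrite e.
- have [q' [hc' hq' /linearize_near e hs]] :=
    normalization nu_gt0 hq hl (@solvable_J0 _ nu).
  by apply: (fin J0 q' hc'); apply: J0_normal_form hs => //; rewrite e.
Qed.

(** The entry mu is tested only for equal eigenvalues; the contributions of c then cancel, leaving d
    mu' = a^(nu+1) mu with nonzero factors. *)
Lemma family_scale (lam mu del a c d lam' mu' del' : C) : a != 0 -> d != 0 ->
  lam' = a ^+ nu * lam -> del' = a ^+ nu * del ->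
  c * lam' + d * mu' = a ^+ nu * (mu * a + del * c) ->
  family lam' mu' del' = family lam mu del.
Proof.
move=> a0 d0 -> -> e; have an0 : a ^+ nu != 0 by rewrite expf_neq0.
rewrite /family !mulf_eq0 (negbTE an0) /=.
case: ifP => // del0; rewrite (inj_eq (mulfI an0)).
case: eqP => [el|_] /=; last by rewrite -mulf_div divff // mul1r.
rewrite -mulf_div divff // mul1r; have -> // : (mu' != 0) = (mu != 0).
have /(congr1 (fun x => x == 0)) : d * mu' = a ^+ nu * a * mu.
  have -> : d * mu' = a ^+ nu * (mu * a + del * c) - c * (a ^+ nu * lam) by
    rewrite -e; ring.
  by rewrite el; ring.
by rewrite !mulf_eq0 (negbTE an0) (negbTE a0) (negbTE d0) /= => ->.
Qed.

Lemma family_conj (Fo q : fps2 C * fps2 C) : ordp 1 1 Fo -> ordp 1 1 q ->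
  coef Fo.1 0 1 = 0 -> coef q.1 0 1 = 0 ->
  formally_conjugated (germ nu Fo) (germ nu q) ->
  family (coef q.1 1 0) (coef q.2 1 0) (coef q.2 0 1) =
  family (coef Fo.1 1 0) (coef Fo.2 1 0) (coef Fo.2 0 1).
Proof.
move=> hF hq F01 q01 /(formally_conjugated_elim (ordp_germ nu_gt0 Fo)).
move=> [_ [X /coord_changeP[[hX _ X10 X2] X0] e]].
have [h1 _ h3 h4] := conjugation_linear_parts nu_gt0 hF hq hX X0 e erefl erefl
  erefl.
apply: (family_scale X10 X2 _ _ h3).
  by apply: (mulfI X10); rewrite h1 F01 mul0r addr0 mulrA mulrC.
by apply: (mulfI X2); rewrite -[LHS]add0r -{1}(mulr0 (coef X.2 1 0)) -q01 h4
  mulrA mulrC.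
Qed.

(** The label is computed from [Fo] alone, so any two normal forms conjugate to the same germ carry
    the same label. *)
Theorem formal_classification (Fo : fps2 C * fps2 C) k t fhat : ordp 1 1 Fo ->
  coef Fo.1 0 1 = 0 -> normal_form nu k t fhat ->
  formally_conjugated (germ nu Fo) fhat ->
  k = family (coef Fo.1 1 0) (coef Fo.2 1 0) (coef Fo.2 0 1) /\
  ((forall n, t n = 0) <-> ord 0 1 Fo.1).
Proof.
move=> hF F01 /(normal_form_shape nu_gt0)[lam [mu [del [q [-> hs ->]]]]] hc.
have hq := shape_ordp hs; have [e1 e2 e3 e4] := shape_coef hs.
split; first by rewrite -e1 -e3 -e4; apply: family_conj.
apply: (iff_trans (shape_tangential hs)); apply: iff_sym.
exact: tangential_conj nu_gt0 hF hq hc.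
Qed.

End FormalClassification.

(** * Taylor expansions of germs *)

Lemma geometric_le2 (K : numFieldType) (x : K) m :
  0 <= x -> x <= 2^-1 -> \sum_(a < m) x ^+ a <= 2.
Proof.
move=> x0 x2; elim: m => [|m IH]; first by rewrite big_ord0.
rewrite big_ord_recl expr0.
have -> : \sum_(a < m) x ^+ lift ord0 a = x * \sum_(a < m) x ^+ a.
  by rewrite mulr_sumr; apply: eq_bigr => a _; apply: exprS.
rewrite -[leRHS]/(1 + 1 : K) lerD2l.
apply: (le_trans (ler_wpM2l x0 IH)); rewrite -[leRHS](@mulVf K 2) ?pnatr_eq0 //.
by rewrite ler_wpM2r.
Qed.

(** Weight j + 1 on the first exponent makes one extra unit there outweigh the loss of the whole
    second exponent j. *)
Lemma lex_exponent i j a b : ~~ ((a < i) || (a == i) && (b < j))%N ->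
  ~ (a = i /\ b = j) -> ((j.+1 * i + j).+1 <= j.+1 * a + b)%N.
Proof.
rewrite negb_or negb_and -!leqNgt => /andP[ia h1] h2.
have [e|lt] := eqVneq a i; first by move: h1 h2; rewrite e eqxx /=; lia.
have : (i < a)%N by rewrite ltn_neqAle eq_sym lt ia.
by move=> /(leq_mul (leqnn j.+1)); lia.
Qed.

Section TaylorExpansions.
Variable R : realType.
Local Notation C := R[i].
Implicit Types (F G : fps2 C) (phi psi : C * C -> C) (r M : C).

Lemma near_OS (P Q : C * C -> Prop) :
  (forall z, P z -> Q z) -> near_O P -> near_O Q.
Proof. by move=> h [r r0 hr]; exists r => // z h1 h2; apply/h/hr. Qed.

Lemma sums_to_unique u l l' : sums_to u l -> sums_to u l' -> l = l' :> C.
Proof.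
move=> h h'; apply/eqP; rewrite -subr_eq0 -normr_eq0; apply/negPn/negP => ne.
have d0 : 0 < `|l - l'| by rewrite lt_def ne normr_ge0.
have e0 : 0 < `|l - l'| / 2 by rewrite divr_gt0 // ltr0n.
have [N hN] := h _ e0; have [N' hN'] := h' _ e0.
have hm := leq_maxl N N'; have hm' := leq_maxr N N'.
have := ltrD (hN' _ _ hm' hm') (hN _ _ hm hm); rewrite -splitr.
move/(le_lt_trans (ler_normB _ _)); rewrite opprB addrC addrA subrK.
by rewrite ltxx.
Qed.

Lemma sums_to_ext (u v : nat -> nat -> C) l k : (forall m n, (k <= m)%N -> (k
  <= n)%N ->
    \sum_(i < m) \sum_(j < n) u i j = \sum_(i < m) \sum_(j < n) v i j) ->
  sums_to u l -> sums_to v (l : C).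
Proof.
move=> e h d d0; have [N hN] := h d d0; exists (maxn N k) => m n.
by rewrite !geq_max => /andP[m1 m2] /andP[n1 n2]; rewrite -e //; apply: hN.
Qed.

Lemma sums_to_finite (u : nat -> nat -> C) l k : (forall m n, (k <= m)%N -> (k
  <= n)%N ->
    \sum_(i < m) \sum_(j < n) u i j = l) -> sums_to u (l : C).
Proof.
by move=> e d d0; exists k => m n hm hn; rewrite e // subrr normr0.
Qed.

Lemma sums_toB u v l l' : sums_to u l -> sums_to v l' ->
  sums_to (fun i j => u i j - v i j) (l - l' : C).
Proof.
move=> h h' e e0; have e20 : 0 < e / 2 by rewrite divr_gt0 // ltr0n.
have [N hN] := h _ e20; have [N' hN'] := h' _ e20; exists (maxn N N') => m n.
rewrite !geq_max => /andP[m1 m2] /andP[n1 n2].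
under eq_bigr do rewrite sumrB.
rewrite sumrB; set S := \sum_(i < m) _; set T := \sum_(i < m) _.
have -> : S - T - (l - l') = S - l - (T - l') by ring.
have := ltrD (hN _ _ m1 n1) (hN' _ _ m2 n2).
by rewrite -splitr => /(le_lt_trans (ler_normB _ _)).
Qed.

Lemma sums_toZ u l (c : C) : sums_to u l -> sums_to (fun i j => c * u i j) (c * l).
Proof.
move=> h e e0; have d0 : 0 < e / (`|c| + 1).
  by rewrite divr_gt0 // ltr_wpDl.
have [N hN] := h _ d0; exists N => m n hm hn.
under eq_bigr do rewrite -mulr_sumr.
rewrite -mulr_sumr -mulrBr normrM.
have c1 : 0 < `|c| + 1 by rewrite ltr_wpDl.
have := hN _ _ hm hn; rewrite ltr_pdivlMr // mulrC; apply: le_lt_trans.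
by rewrite ler_wpM2r // lerDl.
Qed.

Lemma taylor_shrink F r s : 0 < s -> s <= r ->
  (exists M, forall i j, `|coef F i j| * r ^+ (i + j) <= M) ->
  exists M, forall i j, `|coef F i j| * s ^+ (i + j) <= M.
Proof.
move=> s0 sr [M hM]; exists M => i j; apply: le_trans (hM i j).
rewrite ler_wpM2l //; apply: lerXn2r => //; rewrite nnegrE ltW //.
exact: lt_le_trans sr.
Qed.

Lemma taylor_funB phi psi F G : taylor_fun phi F -> taylor_fun psi G ->
  taylor_fun (fun z => phi z - psi z) (F - G).
Proof.
move=> [r [M [r0 hM hF]]] [s [N [s0 hN hG]]].
have rs : 0 < r + s by rewrite addr_gt0.
(* An explicit radius below both r and s, which avoids a minimum for the partial order of the
   complex numbers. *)
pose t := r * s / (r + s); have t0 : 0 < t by rewrite divr_gt0 ?mulr_gt0.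
have lr : t <= r.
  by rewrite /t -mulrA ler_piMr ?ltW // ltr_pdivrMr // mul1r ltrDr.
have ls : t <= s.
  by rewrite /t [r * s]mulrC -mulrA ler_piMr ?ltW // ltr_pdivrMr // mul1r ltrDl.
have [M' hM'] := taylor_shrink t0 lr (ex_intro _ M hM).
have [N' hN'] := taylor_shrink t0 ls (ex_intro _ N hN).
exists t, (M' + N'); split=> // [i j|z h1 h2].
  rewrite cfB; apply: le_trans (lerD (hM' i j) (hN' i j)).
  by rewrite -mulrDl ler_wpM2r ?ler_normB // exprn_ge0 // ltW.
have := sums_toB (hF z (lt_le_trans h1 lr) (lt_le_trans h2 lr))
  (hG z (lt_le_trans h1 ls) (lt_le_trans h2 ls)).
apply: (@sums_to_ext _ _ _ 0) => m n _ _; apply: eq_bigr => i _.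
by apply: eq_bigr => j _; rewrite cfB mulrBl.
Qed.

Lemma taylor_fun_ext phi psi F : (forall z, phi z = psi z) ->
  taylor_fun phi F -> taylor_fun psi F.
Proof.
move=> e [r [M [r0 hM hF]]]; exists r, M; split=> // z h1 h2.
by rewrite -e; apply: hF.
Qed.

Lemma taylor_fun0 : @taylor_fun R (fun=> 0) 0.
Proof.
exists 1, 0; split=> // [i j|z _ _]; first by rewrite cf0 normr0 mul0r.
by apply: (@sums_to_finite _ _ 0) => m n _ _; rewrite big1 // => i _;
  rewrite big1 // => j _; rewrite cf0 mul0r.
Qed.

Lemma taylor_funD phi psi F G : taylor_fun phi F -> taylor_fun psi G ->
  taylor_fun (fun z => phi z + psi z) (F + G).
Proof.
move=> hF /(taylor_funB taylor_fun0) /(taylor_funB hF).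
by rewrite sub0r opprK; apply: taylor_fun_ext => z; rewrite sub0r opprK.
Qed.

Lemma sum2_single (c : C) i j m n : (i < m)%N -> (j < n)%N ->
  \sum_(a < m) \sum_(b < n) ((a == i :> nat) && (b == j :> nat))%:R * c = c.
Proof.
move=> hi hj; rewrite (bigD1 (Ordinal hi)) //= [X in _ + X]big1 ?addr0.
  rewrite (bigD1 (Ordinal hj)) //= !eqxx mul1r big1 ?addr0 // => b.
  by rewrite -val_eqE /= => /negbTE ->; rewrite mul0r.
move=> a; rewrite -val_eqE /= => /negbTE ->.
by rewrite big1 // => b _; rewrite mul0r.
Qed.

Lemma taylor_fun_mon i j :
  @taylor_fun R (fun z => z.1 ^+ i * z.2 ^+ j) (z1 ^+ i * z2 ^+ j).
Proof.
exists 1, 1; split=> // [a b|z _ _].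
  rewrite coef_mon expr1n mulr1 normr_nat.
  by case: (_ && _); rewrite ?ler01.
apply: (@sums_to_finite _ _ (maxn i j).+1) => m n hm hn.
rewrite -[RHS](@sum2_single _ i j m n).
- apply: eq_bigr => a _; apply: eq_bigr => b _; rewrite coef_mon.
  by case: eqP => [->|]; rewrite ?mul0r //; case: eqP => [->|]; rewrite ?mul0r.
- by apply: leq_ltn_trans hm; rewrite leq_maxl.
- by apply: leq_ltn_trans hn; rewrite leq_maxr.
Qed.

Lemma taylor_fun_z1M phi F : taylor_fun phi F ->
  taylor_fun (fun z => z.1 * phi z) (z1 * F).
Proof.
move=> [r [M [r0 hM hF]]]; exists r, (M * r); split=> // [i j|z h1 h2].
  rewrite coef_z1M; case: i => [|i].
    rewrite normr0 mul0r mulr_ge0 ?(ltW r0) //.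
    by apply: le_trans (hM 0%N 0%N); rewrite mulr_ge0 // exprn_ge0 // ltW.
  by rewrite addSn exprSr mulrA ler_wpM2r // ltW.
have h := sums_toZ z.1 (hF z h1 h2) => e e0; have [N hN] := h e e0.
exists N.+1 => -[//|m] n hm hn; rewrite big_ord_recl big1 ?add0r; last first.
  by move=> j _; rewrite coef_z1M /= mul0r.
have := hN m n hm (ltnW hn); apply: le_lt_trans; rewrite le_eqVlt; apply/orP; left.
apply/eqP; congr (`|_ - _|); apply: eq_bigr => i _; apply: eq_bigr => j _.
by rewrite coef_z1M /= /bump /= add1n exprS; ring.
Qed.

Lemma taylor_fun_z1XM k phi F : taylor_fun phi F ->
  taylor_fun (fun z => z.1 ^+ k * phi z) (z1 ^+ k * F).
Proof.
move=> h; elim: k => [|k IH].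
  by rewrite mul1r; apply: taylor_fun_ext h => z; rewrite mul1r.
rewrite exprS -mulrA; apply: taylor_fun_ext (taylor_fun_z1M IH) => z.
by rewrite exprS mulrA.
Qed.

(* Along z_1 = r s^(j+1), z_2 = r s the monomial z_1^i z_2^j dominates, as s
   tends to 0, all the lexicographically larger ones. *)
Lemma dominant_coef_bound F r M i j s s0 : 0 < r -> 0 <= M ->
  (forall a b, `|coef F a b| * r ^+ (a + b) <= M) ->
  (forall a b, (a < i)%N || (a == i) && (b < j)%N -> coef F a b = 0) ->
  0 < s -> s <= s0 -> s0 <= 2^-1 ->
  sums_to (fun a b => coef F a b * ((r * s ^+ j.+1) ^+ a * (r * s) ^+ b)) 0 ->
  `|coef F i j| * r ^+ (i + j) * s ^+ (j.+1 * i + j) <=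
    (s / s0) ^+ (j.+1 * i + j).+1 * (4 * M + 1).
Proof.
move=> r0 M0 hM hz s_gt0 ss0 s02 hs.
have s0_gt0 : 0 < s0 := lt_le_trans s_gt0 ss0.
set L := (j.+1 * i + j).+1; pose w := s / s0.
have w0 : 0 < w by rewrite divr_gt0.
have w1 : w <= 1 by rewrite ler_pdivrMr // mul1r.
have sE : s = w * s0 by rewrite divfK // gt_eqF.
(* The tolerance w^L is the size to which the remaining terms are bounded below. *)
have [N hN] := hs _ (exprn_gt0 L w0).
pose k := maxn N (maxn i j).+1.
have kN : (N <= k)%N by rewrite leq_maxl.
have ki : (i < k)%N by rewrite leq_max ltnS leq_maxl orbT.
have kj : (j < k)%N by rewrite leq_max ltnS leq_maxr orbT.
pose u (p : 'I_k * 'I_k) : C :=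
  coef F p.1 p.2 * ((r * s ^+ j.+1) ^+ p.1 * (r * s) ^+ p.2).
pose p0 := (Ordinal ki, Ordinal kj).
have := hN k k kN kN; rewrite subr0 pair_bigA /= -/(\sum_p u p) (bigD1 p0) //=.
have uE p : `|u p| = `|coef F p.1 p.2| * r ^+ (p.1 + p.2) * s ^+ (j.+1 * p.1 + p.2).
  rewrite /u normrM -mulrA; congr (_ * _).
  rewrite !exprMn -exprM ger0_norm; last by rewrite !mulr_ge0 ?exprn_ge0 // ltW.
  by rewrite !exprD mulrACA.
have -> : `|coef F i j| * r ^+ (i + j) * s ^+ (j.+1 * i + j) = `|u p0| by
  rewrite uE.
set rest := \sum_(_ | _) _ => hlt.
(* Later monomials have weight e >= L, so s^e = w^e s0^e <= w^L s0^e. The powers of s0 <= 1/2 sum to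
   at most 2 in each variable, whence the factor 4. *)
have hrest : `|rest| <= w ^+ L * (4 * M).
  pose g (p : 'I_k * 'I_k) : C := w ^+ L * M * ((s0 ^+ j.+1) ^+ p.1 * s0 ^+ p.2).
  have g0 p : 0 <= g p by rewrite !mulr_ge0 ?exprn_ge0 ?(ltW w0) ?(ltW s0_gt0).
  apply: le_trans (ler_norm_sum _ _ _) _.
  apply: (@le_trans _ _ (\sum_(p | p != p0) g p)).
    apply: ler_sum => p pne; rewrite uE.
    have [lt|ge] := boolP ((p.1 < i)%N || (p.1 == i :> nat) && (p.2 < j)%N).
      by rewrite hz // normr0 !mul0r.
    have hL : (L <= j.+1 * p.1 + p.2)%N.
      have ne : ~ (p.1 = i :> nat /\ p.2 = j :> nat).
        move=> [e1 e2]; case/eqP: pne; case: p {ge} e1 e2 => a b /= e1 e2.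
        by congr pair; apply: val_inj.
      exact: lex_exponent.
    have -> : g p = M * (w ^+ L * s0 ^+ (j.+1 * p.1 + p.2)).
      by rewrite /g -exprM -exprD; ring.
    apply: ler_pM => //; try by rewrite ?mulr_ge0 ?exprn_ge0 // ltW.
    rewrite {1}sE exprMn ler_wpM2r ?exprn_ge0 ?(ltW s0_gt0) //.
    by rewrite ler_wiXn2l // ltW.
  apply: (@le_trans _ _ (\sum_p g p)).
    by rewrite [leRHS](bigD1 p0) //= lerDr.
  have -> : \sum_p g p =
      w ^+ L * M * ((\sum_(a < k) (s0 ^+ j.+1) ^+ a) * \sum_(b < k) s0 ^+ b).
    rewrite big_distrlr /= pair_bigA /= mulr_sumr; exact: eq_bigr.
  rewrite [4 * M]mulrC [leRHS]mulrA ler_wpM2l //.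
    by rewrite mulr_ge0 // exprn_ge0 // ltW.
  have s01 : s0 <= 1.
    by apply: (le_trans s02); rewrite invf_le1 ?ltr0n // ler1n.
  have -> : 4 = 2 * 2 :> C by rewrite -natrM.
  apply: ler_pM.
  - by apply: sumr_ge0 => a _; rewrite exprn_ge0 // exprn_ge0 // ltW.
  - by apply: sumr_ge0 => a _; rewrite exprn_ge0 // ltW.
  - apply: geometric_le2; first by rewrite exprn_ge0 // ltW.
    apply: (le_trans _ s02); rewrite exprS ler_piMr ?(ltW s0_gt0) //.
    by rewrite exprn_ile1 // ltW.
  - by apply: geometric_le2; rewrite // ltW.
have -> : u p0 = u p0 + rest - rest by rewrite addrK.
apply: le_trans (ler_normB _ _) _.
by rewrite mulrDr mulr1 addrC lerD // ltW.
Qed.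

(** Lexicographic induction on (i, j): once the earlier coefficients vanish, the dominant term is
    bounded by a constant times s^(n+1), n being its weight. Dividing by s^n and taking s small
    forces it to be 0. *)
Lemma taylor_fun_eq0 phi F : taylor_fun phi F -> near_O (fun z => phi z = 0) ->
  F = 0.
Proof.
move=> [r [M [r_gt0 hM hF]]] [rho rho0 hphi].
have M0 : 0 <= M.
  by apply: le_trans (hM 0%N 0%N); rewrite mulr_ge0 // exprn_ge0 // ltW.
have rr : 0 < r + rho by rewrite addr_gt0.
have two0 : 0 < 2 :> C by rewrite ltr0n.
(* At most 1/2 for the geometric series, and such that r s0 < rho, so that the whole path lies where
   [phi] vanishes. *)
pose s0 := rho / (r + rho) / 2; have s0_gt0 : 0 < s0 by rewrite !divr_gt0.
have s02 : s0 <= 2^-1.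
  by rewrite /s0 ler_piMl ?invr_ge0 ?ltW // ltr_pdivrMr // mul1r ltrDr.
have s01 : s0 < 1 by apply: le_lt_trans s02 _; rewrite invf_lt1 // ltr1n.
have rs0 : r * s0 < rho.
  have -> : r * s0 = rho * (r / (r + rho) / 2) by rewrite /s0; ring.
  rewrite gtr_pMr // ltr_pdivrMr // mul1r.
  apply: (@lt_trans _ _ 1); last by rewrite ltr1n.
  by rewrite ltr_pdivrMr // mul1r ltrDl.
have sums s j : 0 < s -> s <= s0 ->
    sums_to (fun a b => coef F a b * ((r * s ^+ j.+1) ^+ a * (r * s) ^+ b)) 0.
  move=> s_gt0 ss0; have s1 : s <= 1 by apply: ltW; apply: le_lt_trans s01.
  have rs_ge0 : 0 <= r * s by rewrite mulr_ge0 // ltW.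
  have rsj : r * s ^+ j.+1 <= r * s.
    by rewrite ler_wpM2l ?(ltW r_gt0) // exprS ler_piMr ?(ltW s_gt0) //
      exprn_ile1 // ltW.
  have rsj0 : 0 <= r * s ^+ j.+1 by rewrite mulr_ge0 ?exprn_ge0 // ltW.
  have rsr : r * s < r by rewrite gtr_pMr // (le_lt_trans ss0).
  have rsrho : r * s < rho by apply: le_lt_trans rs0; rewrite ler_wpM2l // ltW.
  have n1 : `|r * s ^+ j.+1| = r * s ^+ j.+1 by apply: ger0_norm.
  have n2 : `|r * s| = r * s by apply: ger0_norm.
  have := hF (r * s ^+ j.+1, r * s); rewrite /= n1 n2 hphi /= ?n1 ?n2 //.
    by apply; [apply: le_lt_trans rsr | ].
  exact: le_lt_trans rsrho.
suff h i : forall j, coef F i j = 0 by apply: fps2P => i j; rewrite h.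
elim/ltn_ind: i => i IHi; elim/ltn_ind => j IHj.
have hz a b : (a < i)%N || (a == i) && (b < j)%N -> coef F a b = 0.
  by case/orP => [ai|/andP[/eqP -> bj]]; [apply: IHi|apply: IHj].
pose c := `|coef F i j| * r ^+ (i + j).
apply/eqP; rewrite -normr_eq0; apply/negPn/negP => ne.
have c0 : 0 < c by rewrite mulr_gt0 ?exprn_gt0 // lt_def ne normr_ge0.
pose n := (j.+1 * i + j)%N; pose B := (4 * M + 1) / s0 ^+ n.+1.
have B0 : 0 < B by rewrite divr_gt0 ?exprn_gt0 // ltr_wpDl // mulr_ge0 // ler0n.
have bound s : 0 < s -> s <= s0 -> c <= s * B.
  move=> s_gt0 ss0.
  have := dominant_coef_bound r_gt0 M0 hM hz s_gt0 ss0 s02 (sums s j s_gt0 ss0).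
  rewrite -/n -/c expr_div_n.
  have -> : s ^+ n.+1 / s0 ^+ n.+1 * (4 * M + 1) = s * B * s ^+ n.
    by rewrite /B exprS; ring.
  by rewrite ler_pM2r // exprn_gt0.
have D0 : 0 < s0 * B + c by rewrite addr_gt0 // mulr_gt0.
(* This s is at most s0 and satisfies s B < c, contradicting [bound]. *)
have s1 : 0 < s0 * (c / (s0 * B + c)) by rewrite mulr_gt0 // divr_gt0.
have s2 : s0 * (c / (s0 * B + c)) <= s0.
  by rewrite ler_piMr ?(ltW s0_gt0) // ler_pdivrMr // mul1r lerDr ltW // mulr_gt0.
have := bound _ s1 s2.
have -> : s0 * (c / (s0 * B + c)) * B = c * (s0 * B / (s0 * B + c)) by ring.
rewrite -{1}[c]mulr1 ler_pM2l // ler_pdivlMr // mul1r gerDl.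
by move=> /(lt_le_trans c0); rewrite ltxx.
Qed.

Lemma taylor_fun_unique phi psi F G : taylor_fun phi F -> taylor_fun psi G ->
  near_O (fun z => phi z = psi z) -> F = G.
Proof.
move=> hF hG h; apply/eqP; rewrite -subr_eq0; apply/eqP.
apply: (taylor_fun_eq0 (taylor_funB hF hG)).
by apply: near_OS h => z ->; rewrite subrr.
Qed.

Lemma taylor_fun_at_O phi F : taylor_fun phi F -> phi (0, 0) = coef F 0 0.
Proof.
move=> [r [M [r0 _ hF]]]; have := hF (0, 0); rewrite /= normr0.
move=> /(_ r0 r0) h; apply: (sums_to_unique h).
apply: (@sums_to_finite _ _ 1) => -[|m] [|n] // _ _.
rewrite big_ord_recl big_ord_recl /= !mulr1 !big1 ?addr0 // => [a _|b _].
  by rewrite big1 // => b _; rewrite exprS !mul0r mulr0.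
by rewrite /bump /= exprS mul0r !mulr0.
Qed.

Lemma taylor_fun_line phi F : taylor_fun phi F ->
  (near_O (fun z => z.1 = 0 -> phi z = 0) <-> ord 0 1 F).
Proof.
move=> [r [M [r0 hM hF]]]; split=> [hphi|h0].
  (* [G] is the expansion of phi(0, z_2), viewed as a function of both variables; it vanishes near
     the origin, so uniqueness applies. *)
  pose G : fps2 C := FPS2 (fun i j => if i == 0%N then coef F 0 j else 0).
  suff G0 : G = 0.
    move=> i j; rewrite mul0n addn0 ltnS leqn0 => /eqP ->.
    exact: (congr1 (fun H => coef H 0 j) G0).
  apply: (@taylor_fun_eq0 (fun z => phi (0, z.2))); last first.
    by case: hphi => rho rho0 h; exists rho => // z h1 h2; apply: h; rewrite
      //= normr0.
  exists r, M; split=> // [i j|z h1 h2].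
    rewrite /=; case: eqP => [->|_]; first exact: hM.
    rewrite normr0 mul0r; apply: le_trans (hM 0%N 0%N).
    by rewrite mulr_ge0 // exprn_ge0 // ltW.
  have := hF (0, z.2); rewrite /= normr0 => /(_ r0 h2).
  apply: (@sums_to_ext _ _ _ 1) => m n _ _.
  apply: eq_bigr => -[[|i] hi] _; apply: eq_bigr => j _ /=.
    by rewrite !expr0.
  by rewrite exprS !mul0r mulr0.
exists r => // z h1 h2 e; apply: (sums_to_unique (hF z h1 h2)).
apply: (@sums_to_finite _ _ 0) => m n _ _; rewrite big1 // => -[[|i] hi] _.
  by rewrite big1 // => j _; rewrite h0 ?mul0r.
by rewrite big1 // => j _; rewrite e exprS !mul0r mulr0.
Qed.

Lemma taylor_germ_eq f fo (F Fo : fps2 C * fps2 C) nu : taylor f F ->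
  contact_decomp f nu fo ->
  taylor fo Fo -> F = germ nu Fo.
Proof.
move=> [f1 f2] [_ hn] [g1 g2].
have z1T : @taylor_fun R (fun z => z.1) z1.
  by have := taylor_fun_mon 1 0; rewrite mulr1; apply: taylor_fun_ext => z;
    rewrite mulr1.
have z2T : @taylor_fun R (fun z => z.2) z2.
  by have := taylor_fun_mon 0 1; rewrite mul1r; apply: taylor_fun_ext => z;
    rewrite mul1r.
apply: injective_projections.
  apply: (taylor_fun_unique f1 (taylor_funD z1T (taylor_fun_z1XM nu g1))).
  by apply: near_OS hn => z ->.
apply: (taylor_fun_unique f2 (taylor_funD z2T (taylor_fun_z1XM nu g2))).
by apply: near_OS hn => z ->.
Qed.

(** [tangential] allows any decomposition of f, but all of them have the same expansion: the
    expansion of f is unique and z_1^nu cancels. *)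
Lemma tangentialP f fo (F Fo : fps2 C * fps2 C) nu : taylor f F ->
  contact_decomp f nu fo ->
  taylor fo Fo -> (tangential f nu <-> ord 0 1 Fo.1).
Proof.
move=> hf hfo hFo; split=> [[fo' hfo' hl]|h].
  have [[Fo' hFo'] _] := hfo'.
  have e := etrans (esym (taylor_germ_eq hf hfo hFo)) (taylor_germ_eq hf hfo' hFo').
  have -> : Fo.1 = Fo'.1.
    by have /addrI/z1X_inj := congr1 fst e.
  exact/(taylor_fun_line hFo'.1).
by exists fo => //; apply/(taylor_fun_line hFo.1).
Qed.

End TaylorExpansions.

Theorem theorem2p1 (R : realType) (f fo : R[i] * R[i] -> R[i] * R[i])
    (F Fo : fps2 R[i] * fps2 R[i]) (nu : nat)
    (f_taylor : taylor f F)
    (f_O : f (0, 0) = (0, 0))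
    (f_neq_id : ~ near_O (fun z => f z = z))
    (f_tangent_id : linear_part F = 1%:M)
    (f_fixes_line : fixes_line_pointwise f)
    (nu_ge1 : (1 <= nu)%N)
    (f_order : order_of_contact f nu)
    (fo_decomp : contact_decomp f nu fo)
    (fo_taylor : taylor fo Fo)
    (f_singular : fo (0, 0) = (0, 0))
    (f_pure_order : has_pure_order Fo 1)
    (P1_line : subst2 (hom_part 1 Fo).1 (0, z2) = 0) :
  (exists! k : form_name R, exists (t : fps1 R[i]) (fhat : fps2 R[i] * fps2 R[i]),
     normal_form nu k t fhat /\ formally_conjugated F fhat) /\
  (forall (k : form_name R) (t : fps1 R[i]) (fhat : fps2 R[i] * fps2 R[i]),
     normal_form nu k t fhat -> formally_conjugated F fhat ->
     ((forall n, t n = 0) <-> tangential f nu)).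
Proof.
have eF := taylor_germ_eq f_taylor fo_decomp fo_taylor.
have hFo : ordp 1 1 Fo.
  have [h1 h2] := fo_taylor; apply/no_constP; split.
    by rewrite -(taylor_fun_at_O h1) f_singular.
  by rewrite -(taylor_fun_at_O h2) f_singular.
(* The coefficient of z_2 in P^1_1(0, z_2) = 0: the linear part is lower triangular. *)
have Fo01 : coef Fo.1 0 1 = 0.
  have hX : ordp 1 1 (0 : fps2 R[i], z2 : fps2 R[i]).
    by split; [apply: ord_zero | apply: ord_z2].
  have hH : ord 1 1 (hom_part 1 Fo).1.
    by move=> i j /= hij; case: eqP => // e; lia.
  have := congr1 (fun G => coef G 0 1) P1_line; rewrite (coef_subst2_01 hX hH).
  by rewrite !cf0 mulr0 add0r coef_z2 mulr1.
have Fo_lin : linearize Fo <> 0.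
  move=> e; have [_ ne _] := f_pure_order; apply: ne.
  have e1 := congr1 fst e; have e2 := congr1 snd e.
  have := congr1 (fun G => coef G 1 0) e1; have := congr1 (fun G => coef G 0 1) e1.
  have := congr1 (fun G => coef G 1 0) e2; have := congr1 (fun G => coef G 0 1) e2.
  rewrite !coef_linear_10 !coef_linear_01 => h1 h2 h3 h4.
  by congr pair; apply: fps2P => -[|[|i]] [|[|j]] //=; rewrite ?h1 ?h2 ?h3 ?h4.
have hT := tangentialP f_taylor fo_decomp fo_taylor.
rewrite eF; split.
  have [k [t [fhat [hk hc]]]] := normal_form_exists nu_ge1 hFo Fo01 Fo_lin.
  exists k; split; first by exists t, fhat.
  (* Both labels equal the family of the linear part of [Fo]. *)
  move=> k' [t' [fhat' [hk' hc']]].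
  have [-> _] := formal_classification nu_ge1 hFo Fo01 hk hc.
  by have [-> _] := formal_classification nu_ge1 hFo Fo01 hk' hc'.
move=> k t fhat hk hc; rewrite hT.
by have [] := formal_classification nu_ge1 hFo Fo01 hk hc.
Qed.
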